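(* Let $\widehat h_n$ be a random bandwidth such that $\widehat h_n=O_{\mathbb P}(h_n)$ and $1/\widehat h_n=O_{\mathbb P}(1/h_n)$, where $h_n$ is a deterministic sequence satisfying $h_n=o(1)$ and $\lim_{n\to\infty}(\log n)/(nh_n^d)=0$. Suppose that assumptions (X), (F) and (K) stated in the context hold and that $Q(\alpha|x)$ is in $\mathcal C(L,s)$ for some $L,s>0$ with $\lfloor s\rfloor\le p$. Then for any $\mathbf v\in\mathbb N^d$ with $|\mathbf v|\le\lfloor s\rfloor$, $$\sup_{(\alpha,x)\in[\underline\alpha,\overline\alpha]\times\mathcal X_0}\left|\widehat b_{\mathbf v}(\alpha;\widehat h_n,x)-b_{\mathbf v}(\alpha|x)\right|=h_n^{-|\mathbf v|}\,O_{\mathbb P}\left(h_n^s+\left(\frac{\log n}{nh_n^d}\right)^{1/2}\right).$$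
   Context: Data. $(X,Y)$ is a random pair with $X\in\mathbb R^d$ and $Y\in\mathbb R$; $(X_1,Y_1),\dots,(X_n,Y_n)$ are i.i.d. copies of $(X,Y)$. $F(y|x)$ is the conditional c.d.f. of $Y$ given $X=x$ and $Q(\alpha|x)=\inf\{y:F(y|x)\ge\alpha\}$. $[\underline\alpha,\overline\alpha]\subset(0,1)$ is a fixed interval. $\|\cdot\|$ is the Euclidean norm. Assumption (X). $X$ has a Lebesgue density $f(\cdot)$ that is strictly positive and continuously differentiable over the compact support $\mathcal X$ of $X$. $\mathcal X_0$ is a compact subset of the interior of $\mathcal X$. Assumption (F). $F(\cdot|\cdot)$ has a continuous conditional density $f(y|x)$, strictly positive for $y\in\mathbb R$, $x\in\mathcal X$. The partial derivative $\partial F(y|x)/\partial x$ is continuous over $\mathbb R\times\mathcal X$. There is $L_0>0$ with $|f(y|x)-f(y'|x')|\le L_0\|(x,y)-(x',y')\|$ for all $(x,y),(x',y')\in\mathcal X\times\mathbb R$. Assumption (K). The nonnegative kernel $K:\mathbb R^d\to\mathbb R$ is Lipschitz, has compact support $\mathcal K$, satisfies $\int K(z)dz=1$ and, for some $\underline K>0$, $K(z)\ge\underline K\,\mathbb I(\|z\|\le1)$. Notation. For $\mathbf v\in\mathbb N^d$: $|\mathbf v|=v_1+\cdots+v_d$, $\mathbf v!=\prod_i v_i!$, $z^{\mathbf v}=\prod_i z_i^{v_i}$. $p$ is the (fixed) order of the local polynomial, $P$ is the number of $\mathbf v\in\mathbb N^d$ with $|\mathbf v|\le p$ (ordered lexicographically),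 $\mathbf U(z)=(z^{\mathbf v}/\mathbf v!,\ |\mathbf v|\le p)^T\in\mathbb R^P$. The loss is $\ell_\alpha(q)=|q|+(2\alpha-1)q=2q(\alpha-\mathbb I(q\le0))$. Estimator: for $h>0$, $\widehat{\mathbf b}(\alpha;h,x)=(\widehat b_{\mathbf v}(\alpha;h,x),|\mathbf v|\le p)^T$ is a minimizer over $\mathbf b\in\mathbb R^P$ of $\frac1{nh^d}\sum_{i=1}^n\ell_\alpha(Y_i-\mathbf U(X_i-x)^T\mathbf b)K(\frac{X_i-x}h)$. Partial derivatives: $b_{\mathbf v}(\alpha|x)=\partial^{|\mathbf v|}Q(\alpha|x)/\partial x_1^{v_1}\cdots\partial x_d^{v_d}$. H\''older class. $\lfloor s\rfloor$ denotes the lowest integer part of $s$: the unique integer with $\lfloor s\rfloor<s\le\lfloor s\rfloor+1$ (strict inequality on the left). $Q\in\mathcal C(L,s)$ means: for all $\alpha\in[\underline\alpha,\overline\alpha]$, $x\mapsto Q(\alpha|x)$ is $\lfloor s\rfloor$ times continuously differentiable over $\mathcal X$; and for all $\mathbf v$ with $|\mathbf v|=\lfloor s\rfloor$, all $\alpha\in[\underline\alpha,\overline\alpha]$ and all $x,x'\in\mathcal X$, $|b_{\mathbf v}(\alpha|x)-b_{\mathbf v}(\alpha|x')|\le L\|x-x'\|^{s-\lfloor s\rfloor}$. *)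

(* Defs.v *)
From HB Require Import structures.
From mathcomp Require Import all_boot all_order all_algebra.
From mathcomp Require Import all_classical all_reals all_analysis.

Set Implicit Arguments.
Unset Strict Implicit.
Unset Printing Implicit Defensive.
Import Order.TTheory GRing.Theory Num.Theory.
Import numFieldNormedType.Exports.

Local Open Scope classical_set_scope.
Local Open Scope ring_scope.

(* R^n is 'rV[R]_n.  The library provides its topology but neither a
   sigma-algebra nor Lebesgue measure.  The sigma-algebra below is generated by
   the coordinates, hence it is the Borel one. *)
Definition measure_rV_display : measure_display -> measure_display.
Proof. exact. Qed.

Section measurable_rV.
Context (R : realType) (n : nat).

Definition rV_coord (i : 'I_n) (x : 'rV[R]_n) : R := x ord0 i.

Let rV_set0 : g_sigma_preimage rV_coord set0.
Proof. exact: sigma_algebra0. Qed.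

Let rV_setC A : g_sigma_preimage rV_coord A -> g_sigma_preimage rV_coord (~` A).
Proof. exact: sigma_algebraC. Qed.

Let rV_bigcup (F : _^nat) : (forall i, g_sigma_preimage rV_coord (F i)) ->
  g_sigma_preimage rV_coord (\bigcup_i (F i)).
Proof. exact: sigma_algebra_bigcup. Qed.

HB.instance Definition _ :=
  @isMeasurable.Build (measure_rV_display default_measure_display)
    'rV[R]_n (g_sigma_preimage rV_coord) rV_set0 rV_setC rV_bigcup.

End measurable_rV.

Section lebesgue_rV.
Context (R : realType).

Definition cons_rV n (xz : R * 'rV[R]_n) : 'rV[R]_n.+1 :=
  \row_i if unlift ord0 i is Some j then xz.2 ord0 j else xz.1.

Lemma measurable_rV_coord n (i : 'I_n) : measurable_fun setT (@rV_coord R n i).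
Proof.
move=> _ Y mY; rewrite setTI; apply: sub_sigma_algebra => /=.
rewrite -bigcup_seq/=; exists i => /=; first by rewrite mem_index_enum.
by exists Y => //; rewrite setTI.
Qed.

Lemma measurable_fun_rV d (T : measurableType d) n (f : T -> 'rV[R]_n) :
  (forall i, measurable_fun setT (@rV_coord R n i \o f)) -> measurable_fun setT f.
Proof.
move=> fi _ A mA; rewrite setTI.
suff: measurable `<=` [set B | d.-measurable (f @^-1` B)] by exact.
apply: smallest_sub.
  split => [|B /= mB|F /= mF].
  - by rewrite /= preimage_set0.
  - by rewrite setTD preimage_setC; exact: measurableC.
  - by rewrite preimage_bigcup; exact: bigcup_measurable.
rewrite -bigcup_seq; apply: bigcup_sub => i _ B [C mC <-] /=.
by have := fi i measurableT C mC; rewrite !setTI.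
Qed.

Lemma measurable_cons_rV n : measurable_fun setT (@cons_rV n).
Proof.
apply: measurable_fun_rV => i; case: (unliftP ord0 i) => [j|] ->.
  rewrite (_ : _ \o _ = @rV_coord R n j \o snd).
    by apply: measurableT_comp => //; exact: measurable_rV_coord.
  by apply/funext => -[x z]; rewrite /= /rV_coord mxE liftK.
rewrite (_ : _ \o _ = fst); first exact: measurable_fst.
by apply/funext => -[x z]; rewrite /= /rV_coord mxE unlift_none.
Qed.

HB.instance Definition _ n :=
  isMeasurableFun.Build _ _ _ _ (@cons_rV n) (@measurable_cons_rV n).

Definition lebesgue_cons n (mu : {measure set 'rV[R]_n -> \bar R}) :
  {measure set 'rV[R]_n.+1 -> \bar R}.
Proof.
refine (pushforward (@lebesgue_measure R \x^ mu)%E (@cons_rV n)).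
exact: measurable_cons_rV.
Defined.

Fixpoint lebesgue_rV n : {measure set 'rV[R]_n -> \bar R} :=
  if n is m.+1 then lebesgue_cons (lebesgue_rV m) else \d_(0 : 'rV[R]_0).

Lemma lebesgue_rV_box n (B : 'I_n -> set R) : (forall i, measurable (B i)) ->
  lebesgue_rV n [set x | forall i, B i (x ord0 i)] =
  (\prod_(i < n) lebesgue_measure (B i))%E.
Proof.
elim: n B => [|n IHn] B mB.
  rewrite big_ord0 /= diracE (_ : _ \in _) //.
  by rewrite inE => -[].
rewrite big_ord_recl -IHn; last by move=> i; exact: mB.
have mB' : measurable [set z : 'rV[R]_n | forall i, B (lift ord0 i) (z ord0 i)].
  rewrite (_ : [set _ | _] = \bigcap_(i in [set: 'I_n])
      (@rV_coord R n i @^-1` B (lift ord0 i))); last first.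
    by apply/seteqP; split => z /= Bz i => [_|]; exact: Bz.
  apply: fin_bigcap_measurable; first exact: finite_finset.
  move=> i _; rewrite -[X in measurable X]setTI.
  by apply: measurable_rV_coord => //; exact: mB.
rewrite -(product_measure2E (@lebesgue_measure R) (lebesgue_rV n) (mB ord0) mB').
rewrite /= /pushforward; congr (product_measure2 _ _ _); apply/seteqP; split => -[x z] /=.
  move=> H; split => /=.
    by have := H ord0; rewrite mxE unlift_none.
  by move=> i; have := H (lift ord0 i); rewrite mxE liftK.
move=> [H0 H] i; rewrite mxE; case: (unliftP ord0 i) => [j|] ->.
  exact: H.
exact: H0.
Qed.

End lebesgue_rV.

Section multi_indices.
Context (R : realType) (d : nat).

Definition multi := {ffun 'I_d -> nat}.
Definition mdeg (v : multi) : nat := (\sum_i v i)%N.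
Definition mfact (v : multi) : nat := (\prod_i (v i)`!)%N.
Definition mpow (z : 'rV[R]_d) (v : multi) : R := \prod_i z ord0 i ^+ v i.
Definition mzero : multi := [ffun=> 0%N].
Definition mincr (v : multi) (i : 'I_d) : multi := [ffun j => (v j + (j == i))%N].

(* The finite type of multi-indices of degree at most p; R^P is represented by
   the finite functions on it, so that no enumeration has to be chosen. *)
Definition mindex (p : nat) :=
  {v : {ffun 'I_d -> 'I_p.+1} | (\sum_i v i <= p)%N}.
Definition multi_of p (v : mindex p) : multi := [ffun i => val v i : nat].

End multi_indices.

Section smoothness.
Context (R : realType) (d : nat).
Implicit Types (A : set 'rV[R]_d) (g : 'rV[R]_d -> R).

Definition enorm (x : 'rV[R]_d) : R := Num.sqrt (\sum_i x ord0 i ^+ 2).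

Definition partial1 (i : 'I_d) g : 'rV[R]_d -> R := 'D_(delta_mx ord0 i) g.
Definition partial (v : multi d) g : 'rV[R]_d -> R :=
  foldr (fun i u => iter (v i) (partial1 i) u) g (enum 'I_d).

(* Differentiability over a closed set A: the partial derivatives exist in the
   interior of A, where b v is partial v g (see partials_overE), and b v is
   their continuous extension to A. *)
Definition partials_over (k : nat) A g (b : multi d -> 'rV[R]_d -> R) : Prop :=
  [/\ forall x, A x -> b (mzero d) x = g x,
      forall v, (mdeg v <= k)%N -> {within A, continuous (b v)} &
      forall v i x, (mdeg v < k)%N -> A° x ->
        is_derive x (delta_mx ord0 i : 'rV[R]_d) (b v) (b (mincr v i) x)].

Definition Ck_over (k : nat) A g : Prop := exists b, partials_over k A g b.

Lemma partials_overE k A g b v x : partials_over k A g b ->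
  (mdeg v <= k)%N -> A° x -> partial v g x = b v x.
Proof.
move=> [b0 _ bD] vk.
have stepD w i u : (mdeg w < k)%N -> (forall y, A° y -> u y = b w y) ->
    forall y, A° y -> partial1 i u y = b (mincr w i) y.
  move=> wk uw y Ay; rewrite /partial1 -(@derive_val _ _ _ _ _ _ _ (bD w i y wk Ay)).
  apply: near_eq_derive.
  by near=> z; apply: uw; near: z; apply: open_nbhs_nbhs; split => //; exact: open_interior.
have mdegI w i : mdeg (mincr w i) = (mdeg w).+1.
  rewrite /mdeg (eq_bigr (fun j => w j + (j == i)))%N; last by move=> j _; rewrite ffunE.
  rewrite big_split /= -addn1; congr (_ + _)%N.
  by rewrite (bigD1 i) //= eqxx big1 ?addn0 // => j /negPf ->.
pose vres (l : seq 'I_d) : multi d := [ffun j => if j \in l then v j else 0%N].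
have vresk l : (mdeg (vres l) <= mdeg v)%N.
  by apply: leq_sum => j _; rewrite ffunE; case: ifP.
have main l : uniq l -> forall y, A° y ->
    foldr (fun i u => iter (v i) (partial1 i) u) g l y = b (vres l) y.
  elim: l => [_ y Ay|i l IHl /= /andP[il ul]].
    rewrite /= -b0; last exact: interior_subset.
    by congr b; apply/ffunP => j; rewrite !ffunE.
  pose w m : multi d := [ffun j => if j == i then m else vres l j].
  have wS m : w m.+1 = mincr (w m) i.
    by apply/ffunP => j; rewrite !ffunE; case: eqP => _; rewrite ?addn1 ?addn0.
  have -> : vres (i :: l) = w (v i).
    by apply/ffunP => j; rewrite !ffunE inE; case: eqP => [->|].
  have wk m : (m <= v i)%N -> (mdeg (w m) <= k)%N.
    move=> mv; apply: leq_trans vk; apply: leq_sum => j _; rewrite !ffunE.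
    by case: eqP => [->//|_]; case: ifP.
  have : (v i <= v i)%N by [].
  elim: {1 3 4}(v i) => [_|m IHm mv] /=.
    move=> y Ay; rewrite (IHl ul y Ay); congr b; apply/ffunP => j.
    by rewrite !ffunE; case: eqP => // ->; rewrite (negPf il).
  rewrite wS; apply: stepD; last exact/IHm/ltnW.
  by rewrite -(mdegI _ _ i) -wS; exact: wk.
move=> Ax; rewrite /partial (main _ (enum_uniq _) _ Ax); congr b.
by apply/ffunP => j; rewrite ffunE mem_enum.
Unshelve. all: by end_near. Qed.

End smoothness.

Section holder.
Context (R : realType) (d : nat).

(* The lowest integer part, strictly below s; for an integer s it is s - 1. *)
Definition lfloor (s : R) : nat := `|Num.ceil s|%N.-1.

Lemma lfloorP (s : R) : 0 < s -> (lfloor s)%:R < s <= (lfloor s).+1%:R.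
Proof.
move=> s0; have c0 : (0 < Num.ceil s)%R by rewrite ceil_gt0.
have cE : (lfloor s).+1%:R = (Num.ceil s)%:~R :> R.
  by rewrite /lfloor prednK ?absz_gt0 ?gt_eqF// natr_absz gtr0_norm.
rewrite cE ceil_ge andbT.
by have := ceilB1_lt s; rewrite intrD -cE -natr1 addrK.
Qed.

Definition holder_class (A : set 'rV[R]_d) (alo ahi : R)
    (Q : R -> 'rV[R]_d -> R) (L s : R) : Prop :=
  forall a, alo <= a <= ahi -> exists b : multi d -> 'rV[R]_d -> R,
    partials_over (lfloor s) A (Q a) b /\
    forall v, mdeg v = lfloor s -> forall x x', A x -> A x' ->
      `|b v x - b v x'| <= L * enorm (x - x') `^ (s - (lfloor s)%:R).

End holder.

Section estimator.
Context (R : realType) (d p : nat).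
Local Notation RP := {ffun mindex d p -> R}.

Definition loss (a q : R) : R := `|q| + (2 * a - 1) * q.

Definition Ubasis (z : 'rV[R]_d) : RP :=
  [ffun w => mpow z (multi_of w) / (mfact (multi_of w))%:R].

Definition dotP (u b : RP) : R := \sum_w u w * b w.

Definition objective (K : 'rV[R]_d -> R) (n : nat) (data : nat -> 'rV[R]_d * R)
    (a h : R) (x : 'rV[R]_d) (b : RP) : R :=
  (n%:R * h ^+ d)^-1 *
  \sum_(i < n) loss a ((data i).2 - dotP (Ubasis ((data i).1 - x)) b) *
               K (h^-1 *: ((data i).1 - x)).

Definition is_minimizer (g : RP -> R) (b : RP) : Prop := forall b', g b <= g b'.

End estimator.

Section probability_notions.
Context (R : realType) (dOm : measure_display) (Om : measurableType dOm)
  (P : probability Om R).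

(* Taking some A i to be the whole space gives every finite subfamily. *)
Definition iid_copies dT (T : measurableType dT) (Z : nat -> Om -> T)
    (Z0 : Om -> T) : Prop :=
  (forall i A, measurable A -> P (Z i @^-1` A) = P (Z0 @^-1` A)) /\
  (forall n (A : nat -> set T), (forall i, measurable (A i)) ->
    P (\bigcap_(i < n) (Z i @^-1` A i)) = (\prod_(i < n) P (Z i @^-1` A i))%E).

Definition cond_distribution d (X : Om -> 'rV[R]_d) (Y : Om -> R)
    (k : R.-pker 'rV[R]_d ~> R) : Prop :=
  forall A B, measurable A -> measurable B ->
    P (X @^-1` A `&` Y @^-1` B) = (\int[P]_(w in X @^-1` A) k (X w) B)%E.

Definition law_support d (X : Om -> 'rV[R]_d) : set 'rV[R]_d :=
  [set x | forall U, open U -> U x -> (0 < P (X @^-1` U))%E].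

(* Z_n = O_P(r_n), for r_n > 0.  The outer measure of P is used as Z_n may fail
   to be measurable (supremum over an uncountable set, arbitrary selection of a
   minimizer); it coincides with P on measurable events. *)
Definition O_P (Z : nat -> Om -> \bar R) (r : nat -> R) : Prop :=
  forall e : R, 0 < e -> exists2 M : R, 0 < M &
    \forall n \near \oo,
      (mu_ext P [set w | (M * r n)%:E < `|Z n w|] <= e%:E)%E.

End probability_notions.

Section model.
Context (R : realType) (d : nat).

Definition cond_cdf (k : R.-pker 'rV[R]_d ~> R) (y : R) (x : 'rV[R]_d) : R :=
  fine (k x `]-oo, y]%classic).

Definition cond_quantile (F : R -> 'rV[R]_d -> R) (a : R) (x : 'rV[R]_d) : R :=
  inf [set y | a <= F y x].

Definition assumption_X (dOm : measure_display) (Om : measurableType dOm)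
    (P : probability Om R) (X : Om -> 'rV[R]_d) (X0 : set 'rV[R]_d) : Prop :=
  [/\ compact (law_support P X),
      exists f : 'rV[R]_d -> R,
        [/\ measurable_fun setT f,
            forall x, 0 <= f x,
            forall A, measurable A ->
              P (X @^-1` A) = (\int[lebesgue_rV R d]_(x in A) (f x)%:E)%E,
            forall x, law_support P X x -> 0 < f x &
            Ck_over 1 (law_support P X) f],
      compact X0 &
      X0 `<=` (law_support P X)°].

Definition assumption_F (S : set 'rV[R]_d) (F : R -> 'rV[R]_d -> R) : Prop :=
  (exists f : R -> 'rV[R]_d -> R,
    [/\ {within [set yx | S yx.2], continuous (fun yx => f yx.1 yx.2)},
        forall y x, S x -> 0 < f y x,
        forall y x, S x ->
          (F y x)%:E = (\int[lebesgue_measure]_(u in `]-oo, y]) (f u x)%:E)%E &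
        exists2 L0 : R, 0 < L0 & forall x x' y y', S x -> S x' ->
          `|f y x - f y' x'| <=
            L0 * Num.sqrt (enorm (x - x') ^+ 2 + (y - y') ^+ 2)]) /\
  (* same convention as in partials_over at the boundary of S *)
  (exists DF : 'I_d -> R -> 'rV[R]_d -> R, forall i,
    {within [set yx | S yx.2], continuous (fun yx => DF i yx.1 yx.2)} /\
    forall y x, S° x ->
      is_derive x (delta_mx ord0 i : 'rV[R]_d) (F y) (DF i y x)).

Definition assumption_K (K : 'rV[R]_d -> R) : Prop :=
  [/\ forall z, 0 <= K z,
      exists c : R, forall z z', `|K z - K z'| <= c * enorm (z - z'),
      compact (closure [set z | K z != 0]),
      (\int[lebesgue_rV R d]_z (K z)%:E = 1)%E &
      exists2 Kl : R, 0 < Kl & forall z, enorm z <= 1 -> Kl <= K z].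

(* The supremum of |g| over A; adding 0 only matters when A is empty. *)
Definition sup_abs T (A : set T) (g : T -> R) : \bar R :=
  ereal_sup (0%E |` [set `|g t|%:E | t in A]).

End model.

(* Main.v *)
Require Import Defs.
From HB Require Import structures.
From mathcomp Require Import all_boot all_order all_algebra.
From mathcomp Require Import all_classical all_reals all_analysis.
From mathcomp Require Import measurable_realfun.
From mathcomp Require Import ring lra.

Set Implicit Arguments.
Unset Strict Implicit.
Unset Printing Implicit Defensive.
Import Order.TTheory GRing.Theory Num.Theory.
Import numFieldNormedType.Exports.

Local Open Scope classical_set_scope.
Local Open Scope ring_scope.

(** The estimator is compared with the coefficients of the Taylor polynomial of
    the quantile function, both being multiplied by powers of the bandwidth.  The
    objective is convex: if the rescaled difference had norm larger than [t], the
    derivative of the objective in its direction would be nonpositive at distance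
    [t] from the target ([minimizer_score]).  The theorem thus amounts to the
    positivity of a sum of i.i.d. scores, uniformly in the level, the location,
    the bandwidth and the direction, for [t] = M rho, where rho is the sum of
    h^s and of the square root of ln n / (n h^d) and [M] is a large constant.

    In mean, the score is of order h^d t.  The Taylor polynomial approximates the
    quantile function up to h^s uniformly in the level ([holder_expansion]), the
    conditional distribution function has slope between two positive constants
    near its quantiles ([mean_score_ge]), and a normalized polynomial is large on
    a cube of size comparable to the window ([normalized_large_on_cube]), whose
    probability is of order h^d ([design_cubes]).

    For the fluctuations, the parameters are covered by polynomially many cells
    ([proper_net]), in each of which all the scores are bounded below by one
    function with nearly the same mean and a second moment of order h^d
    ([bracket_le_score], [bracket_moments]).  A Chernoff bound ([chernoff_iid])
    then makes the sum of these functions positive outside an event of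
    probability at most a power of 1 / n with exponent proportional to [M], since
    n h^d rho^2 >= ln n; a union bound over the cells ends the proof
    ([uniform_score_positive]).  All the events are finite unions of measurable
    sets, and neither the suprema nor the estimator have to be measurable.

    A random bandwidth lies between two multiples of [h n] with probability close
    to one, and the uniformity in the bandwidth takes care of the rest. *)

(** * Borel sets and cubes of Euclidean space *)

Section rV_borel.
Variables (R : realType) (d : nat).
Implicit Types x y z : 'rV[R]_d.

Lemma rV_norm_leP x r : 0 <= r -> reflect (forall i, `|x ord0 i| <= r) (`|x| <= r).
Proof.
move=> r0; rewrite [X in X <= _]/Num.norm /= mx_normrE; apply: (iffP idP).
  by move=> /bigmax_leP[_ xr] i; exact: (xr (ord0, i)).
by move=> xr; apply/bigmax_leP; split => // -[i j] _ /=; rewrite ord1.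
Qed.

Lemma rV_coord_le x i : `|x ord0 i| <= `|x|.
Proof. by move: i; apply/rV_norm_leP. Qed.

Lemma measurable_rV_cube (a : 'I_d -> R) (b : 'I_d -> R) :
  measurable [set x : 'rV[R]_d | forall i, x ord0 i \in `[a i, b i]].
Proof.
rewrite (_ : [set _ | _] = \bigcap_(i in [set: 'I_d])
    (@rV_coord R d i @^-1` `[a i, b i]%classic)); last first.
  by apply/seteqP; split => z /= Bz i => [_|]; exact: Bz.
apply: fin_bigcap_measurable; first exact: finite_finset.
move=> i _; rewrite -[X in measurable X]setTI.
by apply: measurable_rV_coord.
Qed.

(** The sigma-algebra is only generated by the coordinates; open sets belong to
    it because each of them is the union of the rational cubes it contains. *)
Lemma measurable_open_rV (U : set 'rV[R]_d) : open U -> measurable U.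
Proof.
move=> oU.
pose cube (qk : 'rV[rat]_d * nat) := [set x : 'rV[R]_d |
  forall i, x ord0 i \in `[ratr (qk.1 ord0 i) - qk.2.+1%:R^-1,
                           ratr (qk.1 ord0 i) + qk.2.+1%:R^-1]].
rewrite (_ : U = \bigcup_(qk in [set qk | cube qk `<=` U]) cube qk); last first.
  apply/seteqP; split => [x Ux|x [qk /= + xq]]; last by apply.
  have /nbhs_ballP[e /= e0 xeU] : nbhs x U by exact: open_nbhs_nbhs.
  pose k := Num.trunc (e / 2)^-1.
  have [r [rE r0 re]] : exists r : R, [/\ r = k.+1%:R^-1, 0 < r & r < e / 2].
    exists k.+1%:R^-1; split => //.
    by rewrite -[ltRHS]invrK ltf_pV2 ?posrE ?ltr0n ?invr_gt0 ?divr_gt0// truncnS_gt.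
  have q_ i : {q : rat | x ord0 i - r < ratr q < x ord0 i + r}.
    apply: cid; have [|q] := @rat_in_itvoo R (x ord0 i - r) (x ord0 i + r).
      lra.
    by rewrite in_itv /= => ?; exists q.
  exists (\row_i sval (q_ i), k) => /=; last first.
    by move=> i; rewrite in_itv /= mxE -rE; case: (q_ i) => q /= /andP[? ?]; lra.
  move=> z /= zq; apply: xeU; rewrite mx_norm_ball /ball_ /=.
  apply: (@le_lt_trans _ _ (r * 2)); last lra.
  apply/rV_norm_leP => [|i]; first lra.
  have := zq i; rewrite in_itv /= !mxE -rE; case: (q_ i) => q /=.
  by move=> /andP[? ?] /andP[? ?]; rewrite ler_norml; lra.
rewrite bigcup_mkcond; apply: countable_bigcupT_measurable; first exact: countableP.
by move=> qk; case: ifPn => // _; exact: measurable_rV_cube.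
Qed.

Lemma continuous_measurable_rV (f : 'rV[R]_d -> R) :
  continuous f -> measurable_fun setT f.
Proof.
move=> cf; apply: (measurability _ (RGenOpens.measurableE R)) => //.
move=> _ [_ [a [b ->] <-]]; rewrite setTI; apply: measurable_open_rV.
by move/continuousP: cf; apply; exact: interval_open.
Qed.

End rV_borel.

Section cube_measure.
Variables (R : realType) (d : nat).

Definition cube (x : 'rV[R]_d) (r : R) : set 'rV[R]_d := [set y | `|y - x| <= r].

Lemma cubeE x r : 0 <= r ->
  cube x r = [set y | forall i, y ord0 i \in `[x ord0 i - r, x ord0 i + r]].
Proof.
move=> r0; apply/seteqP; split => y /=.
  by move=> /rV_norm_leP yx i; have := yx r0 i; rewrite !mxE in_itv /= ler_norml; lra.
by move=> yx; apply/rV_norm_leP => // i; have := yx i; rewrite !mxE in_itv /= ler_norml; lra.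
Qed.

Lemma measurable_cube x r : 0 <= r -> measurable (cube x r).
Proof. by move=> r0; rewrite cubeE//; exact: measurable_rV_cube. Qed.

Lemma lebesgue_cube x r : 0 <= r -> lebesgue_rV R d (cube x r) = ((2 * r) ^+ d)%:E.
Proof.
move=> r0; rewrite cubeE//.
rewrite (lebesgue_rV_box (B := fun i => `[x ord0 i - r, x ord0 i + r]%classic))//.
rewrite (eq_bigr (fun=> (2 * r)%:E)).
  by rewrite prodEFin prodr_const card_ord.
move=> i _; rewrite lebesgue_measure_itv /= lte_fin.
case: ifPn => [_|]; first by rewrite -EFinB; congr EFin; lra.
by rewrite -leNgt => ?; congr EFin; lra.
Qed.

End cube_measure.

(** * Mixtures of measures *)

Section mixture.
Context d0 (Om : measurableType d0) d1 (T : measurableType d1) (R : realType).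
Variables (P : probability Om R) (kappa : Om -> {measure set T -> \bar R}).
Hypothesis mkappa : forall A, measurable A -> measurable_fun [set: Om] (kappa ^~ A).
Hypothesis kappa_bounded : exists M : R, forall w, (kappa w setT < M%:E)%E.

Let base : unit -> {measure set Om -> \bar R} := fun=> P.
Let mbase U : measurable U -> measurable_fun setT (base ^~ U).
Proof. by move=> _; exact: measurable_cst. Qed.
HB.instance Definition _ := @isKernel.Build _ _ _ _ R base mbase.
Let base_uub : measure_fam_uub base.
Proof. by exists 2; case; rewrite (_ : base tt _ = 1%E) ?lte_fin ?ltr1n//; exact: probability_setT. Qed.
HB.instance Definition _ := @Kernel_isFinite.Build _ _ _ _ R base base_uub.

Let fiber : unit * Om -> {measure set T -> \bar R} := fun tw => kappa tw.2.
Let mfiber U : measurable U -> measurable_fun setT (fiber ^~ U).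
Proof. by move=> mU; apply: (measurableT_comp (mkappa mU)); exact: measurable_snd. Qed.
HB.instance Definition _ := @isKernel.Build _ _ _ _ R fiber mfiber.
Let fiber_uub : measure_fam_uub fiber.
Proof. by have [M HM] := kappa_bounded; exists M => -[? w]; exact: HM. Qed.
HB.instance Definition _ := @Kernel_isFinite.Build _ _ _ _ R fiber fiber_uub.

(** Encoding the mixture as the composition of two kernels, the first of which
    starts from a one-point space, gives both its sigma-additivity and the
    mixture formula for integrals. *)
Definition mixture : {measure set T -> \bar R} := (base \; fiber)%E tt.

Lemma mixtureE A : mixture A = (\int[P]_w kappa w A)%E.
Proof. by []. Qed.

Lemma integral_mixture (f : T -> \bar R) : (forall z, 0 <= f z)%E ->
  measurable_fun setT f -> (\int[mixture]_z f z = \int[P]_w \int[kappa w]_z f z)%E.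
Proof. by move=> f0 mf; rewrite /mixture integral_kcomp. Qed.

End mixture.

(** * Expectation of a product of independent variables *)

Section iid_expectation.
Context d0 (Om : measurableType d0) (R : realType) (P : probability Om R).
Context d1 (T : measurableType d1) (Z : nat -> Om -> T) (Z0 : Om -> T).
Hypothesis mZ : forall i, measurable_fun setT (Z i).
Hypothesis mZ0 : measurable_fun setT Z0.
Hypothesis iidZ : iid_copies P Z Z0.
Variables (g : T -> R) (C e : R).
Hypothesis mg : measurable_fun setT g.
Hypothesis gC : forall z, 0 <= g z <= C.
Hypothesis gE : (\int[P]_w (g (Z0 w))%:E = e%:E)%E.

Let law_eq i : (\int[P]_w (g (Z i w))%:E = e%:E)%E.
Proof.
rewrite -gE; transitivity (\int[pushforward P (Z i)]_z (g z)%:E)%E.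
  rewrite ge0_integral_pushforward//; first exact/measurable_EFinP.
  by move=> z _; rewrite lee_fin; case/andP: (gC z).
transitivity (\int[pushforward P Z0]_z (g z)%:E)%E; last first.
  rewrite ge0_integral_pushforward//; first exact/measurable_EFinP.
  by move=> z _; rewrite lee_fin; case/andP: (gC z).
by apply: eq_measure_integral => A mA _ /=; exact: iidZ.1.
Qed.

Let W k n (A : nat -> set T) (w : Om) : R :=
  (\prod_(i < k) g (Z i w)) * \prod_(k <= j < n) \1_(A j) (Z j w).

Let W_ge0 k n A w : 0 <= W k n A w.
Proof.
apply: mulr_ge0; first by apply: prodr_ge0 => i _; case/andP: (gC (Z i w)).
by apply: prodr_ge0 => i _; rewrite indicE.
Qed.

Let measurable_W k n A : (forall j, measurable (A j)) -> measurable_fun setT (W k n A).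
Proof.
move=> mA; apply: measurable_funM.
  by apply: measurable_prod => i _; exact: measurableT_comp.
by apply: measurable_prod => i _; apply: measurableT_comp => //; exact: measurable_indic.
Qed.

Let W_le k n A w : W k n A w <= \prod_(i < k) C.
Proof.
rewrite -[leRHS]mulr1; apply: ler_pM.
- by apply: prodr_ge0 => i _; case/andP: (gC (Z i w)).
- by apply: prodr_ge0 => i _; rewrite indicE.
- by apply: ler_prod => i _; exact: gC.
- by apply: Num.Theory.prodr_ile1 => i _; rewrite indicE; case: (_ \in _); rewrite ?lexx ?ler01.
Qed.

(** Independence is given on sets, that is for products of indicators, which are
    replaced one at a time by [g].  If [U] is the product of the other factors,
    the measure A |-> E[U 1_A(Z k)] is by induction a multiple of the law of
    [Z k]; being a mixture of point masses, it integrates [g] to E[U g(Z k)]. *)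
Let integral_W k n A : (k <= n)%N -> (forall j, measurable (A j)) ->
  (\int[P]_w (W k n A w)%:E =
   (e ^+ k * \prod_(k <= j < n) fine (P (Z j @^-1` A j)))%:E)%E.
Proof.
move=> + mA.
have mZA j B : measurable B -> measurable (Z j @^-1` B).
  by move=> mB; rewrite -[X in measurable X]setTI; exact: mZ.
elim: k A mA => [|k IH] A mA kn.
  rewrite expr0 mul1r !big_mkord -prodEFin.
  rewrite (eq_bigr (fun i : 'I_n => P (Z i @^-1` A i))); last first.
    by move=> i _; rewrite fineK// fin_num_measure//; exact: mZA.
  rewrite -iidZ.2// -[X in P X]setIT -integral_indic//=; last first.
    by apply: fin_bigcap_measurable => [|i _]; [exact: finite_II|exact: mZA].
  apply: eq_integral => w _; congr EFin; rewrite /W big_ord0 mul1r big_mkord.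
  case: (pselect (forall i : nat, (i < n)%N -> A i (Z i w))) => Aw.
    rewrite big1 => [|i _]; last by rewrite indicE mem_set//; exact: Aw.
    by rewrite indicE mem_set.
  rewrite indicE memNset//=.
  have /existsNP[i /not_implyP[i_n Ai]] := Aw.
  by rewrite (bigD1 (Ordinal i_n))//= indicE memNset// mul0r.
have e0 : 0 <= e.
  by rewrite -lee_fin -gE integral_ge0// => w _; rewrite lee_fin; case/andP: (gC (Z0 w)).
pose AB B := fun j => if j == k then B else A j.
have mAB B : measurable B -> forall j, measurable (AB B j).
  by move=> mB j; rewrite /AB; case: eqP.
pose U := W k n (AB setT).
have WU B w : W k n (AB B) w = U w * \1_B (Z k w).
  rewrite /U /W !(big_ltn kn) /AB eqxx !indicE mem_setT mul1r.
  rewrite -!mulrA; congr (_ * _); rewrite mulrC; congr (_ * _).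
  by apply: eq_big_nat => j /andP[kj _]; rewrite gtn_eqF.
have WS w : W k.+1 n A w = U w * g (Z k w).
  rewrite /U /W (big_ltn kn) /AB eqxx indicE mem_setT mul1r big_ord_recr /=.
  rewrite -!mulrA; congr (_ * _); rewrite mulrC; congr (_ * _).
  by apply: eq_big_nat => j /andP[kj _]; rewrite gtn_eqF.
have mU : measurable_fun setT U by apply: measurable_W; exact: mAB.
have U0 w : 0 <= U w by exact: W_ge0.
pose kap w := mscale (NngNum (U0 w)) (\d_(Z k w)) : {measure set T -> \bar R}.
have kapDE w B : kap w B = (U w * \1_B (Z k w))%:E by rewrite EFinM.
have mkap B : measurable B -> measurable_fun [set: Om] (kap ^~ B).
  move=> mB; apply: (eq_measurable_fun (fun w => (U w * \1_B (Z k w))%:E)).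
    by move=> w _; rewrite kapDE.
  apply/measurable_EFinP/measurable_funM => //.
  by apply: measurableT_comp => //; exact: measurable_indic.
have kap_bounded : exists M : R, forall w, (kap w setT < M%:E)%E.
  exists ((\prod_(i < k) C) + 1) => w.
  rewrite kapDE indicE mem_setT mulr1 lte_fin.
  by rewrite (le_lt_trans (W_le _ _ _ _))// ltrDl.
pose c := e ^+ k * \prod_(k.+1 <= j < n) fine (P (Z j @^-1` A j)).
have c0 : 0 <= c.
  apply: mulr_ge0; first exact: exprn_ge0.
  by apply: prodr_ge0 => j _; exact: fine_ge0.
have kapE B : measurable B ->
    mixture P mkap B = mscale (NngNum c0) (pushforward P (Z k)) B.
  move=> mB; rewrite mixtureE.
  transitivity (\int[P]_w (W k n (AB B) w)%:E)%E.
    apply: eq_integral => w _.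
    by rewrite kapDE WU.
  rewrite IH//; [|exact: mAB|exact: ltnW].
  rewrite /mscale /= /pushforward (big_ltn kn) mulrCA /AB eqxx EFinM muleC.
  congr (_ * _)%E; last by rewrite fineK// fin_num_measure//; exact: mZA.
  congr (_ * _)%:E.
  by apply: eq_big_nat => j /andP[kj _]; rewrite gtn_eqF.
transitivity (\int[mixture P mkap]_z (g z)%:E)%E.
  rewrite integral_mixture//; last 2 first.
  - by move=> z; rewrite lee_fin; case/andP: (gC z).
  - exact/measurable_EFinP.
  apply: eq_integral => w _; rewrite ge0_integral_mscale//; last 2 first.
  - exact/measurable_EFinP.
  - by move=> z _; rewrite lee_fin; case/andP: (gC z).
  rewrite integral_dirac//; last exact/measurable_EFinP.
  rewrite diracE mem_setT mul1e -EFinM; congr EFin.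
  exact: WS.
rewrite (eq_measure_integral (mscale (NngNum c0) (pushforward P (Z k))))//; last first.
  by move=> B mB _; exact: kapE.
rewrite ge0_integral_mscale//; last 2 first.
- exact/measurable_EFinP.
- by move=> z _; rewrite lee_fin; case/andP: (gC z).
rewrite ge0_integral_pushforward//; last 2 first.
- exact/measurable_EFinP.
- by move=> z _; rewrite lee_fin; case/andP: (gC z).
rewrite /= preimage_setT [X in (_ * X)%E](law_eq k) -EFinM; congr EFin.
by rewrite /c exprS; ring.
Qed.

Lemma integral_iid_prod n :
  (\int[P]_w (\prod_(i < n) g (Z i w))%:E = (e ^+ n)%:E)%E.
Proof.
have := @integral_W n n (fun=> setT) (leqnn n) (fun=> measurableT).
rewrite big_geq// mulr1 => <-; apply: eq_integral => w _.
by rewrite /W [X in _ * X]big_geq// mulr1.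
Qed.

End iid_expectation.

(** * An exponential inequality *)

Section bounded_integrands.
Context d0 (Om : measurableType d0) (R : realType) (mu : {measure set Om -> \bar R}).
Hypothesis mu1 : mu setT = 1%E.

Lemma bounded_integrable (f : Om -> R) (C : R) : measurable_fun setT f ->
  (forall w, `|f w| <= C) -> mu.-integrable setT (EFin \o f).
Proof.
move=> mf fC; apply: measurable_bounded_integrable => //; first by rewrite mu1 ltry.
exists C; split; first exact: num_real.
by move=> x Cx w _ /=; rewrite (le_trans (fC w))// ltW.
Qed.

Lemma Rintegral_EFin (f : Om -> R) (C : R) : measurable_fun setT f ->
  (forall w, `|f w| <= C) -> (\int[mu]_w (f w)%:E = (\int[mu]_w f w)%:E)%E.
Proof.
move=> mf fC; rewrite /Rintegral fineK//.
by apply: integrable_fin_num => //; exact: bounded_integrable mf fC.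
Qed.

Lemma Rintegral_cst1 (C : R) : \int[mu]_w C = C.
Proof. by rewrite Rintegral_cst// mu1 mulr1. Qed.

Lemma RintegralDcst (f : Om -> R) (C D : R) : measurable_fun setT f ->
  (forall w, `|f w| <= C) -> \int[mu]_w (f w + D) = \int[mu]_w f w + D.
Proof.
move=> mf fC; rewrite RintegralD//; first by rewrite Rintegral_cst1.
  exact: bounded_integrable mf fC.
by apply: (@bounded_integrable _ `|D|).
Qed.

End bounded_integrands.

Lemma expR_le_quad (R : realType) (y : R) : `|y| <= 1 / 2 ->
  expR y <= 1 + y + 2 * y ^+ 2.
Proof.
move=> /ler_normlP[y1 y2].
have y3 : 0 < 1 - y / 2 by lra.
have e1 : 1 - y / 2 <= expR (- (y / 2)) by have := expR_ge1Dx (- (y / 2)); lra.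
have e2 : expR (y / 2) <= (1 - y / 2)^-1.
  by rewrite -[expR _]invrK -expRN lef_pV2 ?posrE ?expR_gt0.
rewrite (splitr y) expRD -splitr.
apply: (@le_trans _ _ ((1 - y / 2)^-1 * (1 - y / 2)^-1)).
  by apply: ler_pM => //; exact: expR_ge0.
rewrite -invfM -[leLHS]mulr1 ler_pdivrMl ?mulr_gt0//.
have := sqr_ge0 y; nra.
Qed.

Section chernoff_iid.
Context d0 (Om : measurableType d0) (R : realType) (P : probability Om R).
Context d1 (T : measurableType d1) (Z : nat -> Om -> T) (Z0 : Om -> T).
Hypothesis mZ : forall i, measurable_fun setT (Z i).
Hypothesis mZ0 : measurable_fun setT Z0.
Hypothesis iidZ : iid_copies P Z Z0.
Variables (W : T -> R) (C l a v : R).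
Hypothesis mW : measurable_fun setT W.
Hypothesis WC : forall z, `|W z| <= C.
Hypothesis l0 : 0 <= l.
Hypothesis lC : l * C <= 1 / 2.
Hypothesis aE : a <= \int[P]_w W (Z0 w).
Hypothesis vE : \int[P]_w (W (Z0 w) ^+ 2) <= v.

Let P1 : P setT = 1%E := @probability_setT _ _ _ P.

Lemma measurable_sum_le0 n : measurable [set w | \sum_(i < n) W (Z i w) <= 0].
Proof.
pose S w : R := \sum_(i < n) W (Z i w).
have mS : measurable_fun setT S by apply: measurable_sum => i; exact: measurableT_comp.
rewrite (_ : [set _ | _] = setT `&` S @^-1` `]-oo, 0]%classic); first exact: mS.
by rewrite setTI; apply/seteqP; split => w /=; rewrite in_itv.
Qed.

(** The indicator of the event is at most the product of the [expR (- l * W)],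
    whose expectation factorizes, and [expR_le_quad] bounds each factor by
    1 - l a + 2 l^2 v.  The second moment [v] may be much smaller than [C ^+ 2]:
    this is what makes the bound sharp for variables living on a small set. *)
Lemma chernoff_iid n : (P [set w | (\sum_(i < n) W (Z i w) <= 0)%R]
  <= (expR (- (n%:R * (l * a - 2 * l ^+ 2 * v))))%:E)%E.
Proof.
pose g z := expR (- l * W z).
have lW z : `|- l * W z| <= 1 / 2.
  by rewrite normrM normrN (ger0_norm l0) (le_trans _ lC)// ler_wpM2l.
have mg : measurable_fun setT g.
  by apply: measurableT_comp; [exact: measurable_expR|exact: measurable_funM].
have gb z : 0 <= g z <= expR (1 / 2).
  by rewrite expR_ge0 ler_expR (le_trans (ler_norm _) (lW z)).
have mWZ : measurable_fun setT (fun w => W (Z0 w)) by exact: measurableT_comp.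
have mgZ : measurable_fun setT (fun w => g (Z0 w)) by exact: measurableT_comp.
have gbn w : `|g (Z0 w)| <= expR (1 / 2).
  by rewrite ger0_norm; case/andP: (gb (Z0 w)).
have C0 : 0 <= C by apply: le_trans (WC (Z0 point)).
have iW : P.-integrable setT (EFin \o (fun w => W (Z0 w))).
  by apply: (bounded_integrable P1 (C := C)).
have iW2 : P.-integrable setT (EFin \o (fun w => W (Z0 w) ^+ 2)).
  apply: (bounded_integrable P1 (C := C ^+ 2)); first exact: measurable_funX.
  by move=> w; rewrite normrX lerXn2r ?nnegrE.
have ig : P.-integrable setT (EFin \o (fun w => g (Z0 w))).
  exact: (bounded_integrable P1 mgZ gbn).
pose e := \int[P]_w g (Z0 w).
have eE : (\int[P]_w (g (Z0 w))%:E = e%:E)%E by exact: (Rintegral_EFin P1 mgZ gbn).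
have e0 : 0 <= e by apply: Rintegral_ge0 => w _; exact: expR_ge0.
have ele : e <= expR (- (l * a - 2 * l ^+ 2 * v)).
  apply: (@le_trans _ _ (1 + - (l * a - 2 * l ^+ 2 * v))); last exact: expR_ge1Dx.
  apply: (@le_trans _ _ (\int[P]_w (1 + (- l * W (Z0 w) + 2 * l ^+ 2 * W (Z0 w) ^+ 2)))).
    apply: le_Rintegral => //.
      apply: (bounded_integrable P1 (C := 1 + (l * C + 2 * l ^+ 2 * C ^+ 2))).
        by apply: measurable_funD => //; apply: measurable_funD;
           apply: measurable_funM => //; exact: measurable_funX.
      move=> w; rewrite (le_trans (ler_normD _ _))// normr1 lerD2l.
      rewrite (le_trans (ler_normD _ _))// lerD//.
        by rewrite normrM normrN (ger0_norm l0) ler_wpM2l.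
      rewrite normrM ger0_norm; last by rewrite mulr_ge0// sqr_ge0.
      by rewrite ler_wpM2l ?normrX ?lerXn2r ?nnegrE// mulr_ge0// sqr_ge0.
    move=> w _; rewrite /g; apply: le_trans (expR_le_quad (lW _)) _.
    by rewrite exprMn sqrrN mulrA addrA.
  have i1 : P.-integrable setT (EFin \o (fun w => - l * W (Z0 w))).
    exact: (@integrableZl _ _ _ _ _ measurableT (- l) _ iW).
  have i2 : P.-integrable setT (EFin \o (fun w => 2 * l ^+ 2 * W (Z0 w) ^+ 2)).
    exact: (@integrableZl _ _ _ _ _ measurableT (2 * l ^+ 2) _ iW2).
  rewrite RintegralD//; last 2 first.
  - exact: finite_measure_integrable_cst.
  - exact: (integrableD measurableT i1 i2).
  rewrite RintegralD// !RintegralZl// Rintegral_cst1//.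
  rewrite lerD2l opprB addrC lerD//; first by rewrite ler_wpM2l// mulr_ge0// sqr_ge0.
  by rewrite mulNr lerN2 ler_wpM2l.
have mprod : measurable_fun setT (fun w => \prod_(i < n) g (Z i w)).
  by apply: measurable_prod => i _; exact: measurableT_comp.
apply: (@le_trans _ _ (\int[P]_w (\prod_(i < n) g (Z i w))%:E)%E).
  rewrite -[X in P X]setIT -integral_indic//; last exact: measurable_sum_le0.
  apply: ge0_le_integral => //.
  - by apply/measurable_EFinP; apply: measurable_indic; exact: measurable_sum_le0.
  - exact/measurable_EFinP.
  - move=> w _; rewrite lee_fin indicE.
    have -> : \prod_(i < n) g (Z i w) = expR (- l * \sum_(i < n) W (Z i w)).
      by rewrite mulr_sumr expR_sum.
    case: (boolP (w \in _)) => [|_]; last by rewrite expR_ge0.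
    rewrite inE /= => Sw; rewrite -[leLHS]expR0 ler_expR mulNr oppr_ge0.
    by rewrite mulr_ge0_le0.
rewrite (integral_iid_prod mZ mZ0 iidZ mg gb eE) lee_fin.
apply: (@le_trans _ _ (expR (- (l * a - 2 * l ^+ 2 * v)) ^+ n)).
  by rewrite lerXn2r ?nnegrE ?expR_ge0.
by rewrite -expRM_natl mulrN.
Qed.

End chernoff_iid.

(** * Disintegration along the conditional distribution *)

Section disintegration.
Context d0 (Om : measurableType d0) (R : realType) (P : probability Om R).
Context d1 (T1 : measurableType d1) d2 (T2 : measurableType d2).
Variables (X : Om -> T1) (Y : Om -> T2) (k : R.-pker T1 ~> T2).
Hypothesis mX : measurable_fun setT X.
Hypothesis mY : measurable_fun setT Y.
Hypothesis condk : forall A B, measurable A -> measurable B ->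
  P (X @^-1` A `&` Y @^-1` B) = (\int[P]_(w in X @^-1` A) k (X w) B)%E.

Let mXY : measurable_fun setT (fun w => (X w, Y w)).
Proof. exact/measurable_fun_pair. Qed.

Let kap (w : Om) : {measure set (T1 * T2) -> \bar R}.
Proof.
refine (pushforward (k (X w)) (fun y : T2 => (X w, y))).
exact: pair1_measurable.
Defined.

Let kapE w A : kap w A = k (X w) (xsection A (X w)).
Proof. by rewrite /kap /= /pushforward xsectionE. Qed.

Let mkap A : measurable A -> measurable_fun [set: Om] (kap ^~ A).
Proof.
move=> mA; apply: (eq_measurable_fun (fun w => k (X w) (xsection A (X w)))).
  by move=> w _; rewrite kapE.
apply: (measurableT_comp (f := fun x => k x (xsection A x))) => //.
by apply: measurable_fun_xsection_finite_kernel; rewrite inE.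
Qed.

Let kap_bounded : exists M : R, forall w, (kap w setT < M%:E)%E.
Proof.
exists 2 => w; rewrite kapE (_ : xsection _ _ = setT); last first.
  by rewrite xsectionE; apply/seteqP; split.
by rewrite prob_kernel lte_fin ltr1n.
Qed.

(** The rectangles on which the kernel is known to disintegrate the law of
    [(X, Y)] form a generating pi-system. *)
Let jointE A : measurable A ->
  pushforward P (fun w => (X w, Y w)) A = mixture P mkap A.
Proof.
move=> mA.
apply: (measure_unique [set C | exists2 A, measurable A &
    exists2 B, measurable B & A `*` B = C] (fun=> setT)) => //.
- exact: measurable_prod_measurableType.
- move=> _ _ [A1 mA1 [B1 mB1 <-]] [A2 mA2 [B2 mB2 <-]].
  exists (A1 `&` A2); first exact: measurableI.
  by exists (B1 `&` B2); [exact: measurableI|rewrite setXI].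
- by move=> _; exists setT => //; exists setT => //; rewrite setXTT.
- by apply/seteqP; split => // z _; exists 0%N.
- move=> _ [A1 mA1 [B1 mB1 <-]].
  transitivity (P (X @^-1` A1 `&` Y @^-1` B1)) => //.
  rewrite condk// mixtureE integral_mkcond; apply: eq_integral => w _.
  rewrite kapE patchE; case: (pselect (A1 (X w))) => A1X.
    by rewrite mem_set// in_xsectionX ?mem_set.
  by rewrite memNset// notin_xsectionX ?measure0 ?memNset.
- move=> _; apply: le_lt_trans (ltry 1); apply: probability_le1.
  by rewrite /= preimage_setT.
Qed.

(** The law of [(X, Y)] is the mixture of the images of the [k (X w)] by
    y |-> (X w, y).  The mixture formula needs nonnegative integrands: both
    functions are first shifted by their bound [C]. *)
Lemma le_expectation_cond (phi : T1 * T2 -> R) (psi : T1 -> R) (C : R) :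
  measurable_fun setT phi -> measurable_fun setT psi ->
  (forall z, `|phi z| <= C) -> (forall x, `|psi x| <= C) ->
  (forall x, psi x <= \int[k x]_y phi (x, y)) ->
  \int[P]_w psi (X w) <= \int[P]_w phi (X w, Y w).
Proof.
move=> mphi mpsi phiC psiC le_cond.
have mphiXY : measurable_fun setT (fun w => phi (X w, Y w)) by exact: measurableT_comp.
have mpsiX : measurable_fun setT (fun w => psi (X w)) by exact: measurableT_comp.
have mphix x : measurable_fun setT (fun y => phi (x, y)) by exact: measurableT_comp.
have P1 : P setT = 1%E := @probability_setT _ _ _ P.
rewrite -(lerD2r C) -!(RintegralDcst P1 (C := C))// -lee_fin.
have bC (f : R) : `|f| <= C -> `|f + C| <= C + `|C|.
  by move=> fC; rewrite (le_trans (ler_normD _ _))// lerD2r.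
have phi0 z : (0 <= (phi z + C)%:E)%E.
  by rewrite lee_fin; have := phiC z; rewrite ler_norml; lra.
rewrite -(Rintegral_EFin P1 (C := C + `|C|)); last 2 first.
- exact: measurable_funD.
- by move=> w; exact: bC.
rewrite -(Rintegral_EFin P1 (C := C + `|C|)); last 2 first.
- exact: measurable_funD.
- by move=> w; exact: bC.
have mphiC : measurable_fun setT (fun z => (phi z + C)%:E).
  by apply/measurable_EFinP; exact: measurable_funD.
have -> : (\int[P]_w (phi (X w, Y w) + C)%:E =
    \int[P]_w \int[kap w]_z (phi z + C)%:E)%E.
  rewrite -(integral_mixture P mkap)//.
  transitivity (\int[pushforward P (fun w => (X w, Y w))]_z (phi z + C)%:E)%E.
    by rewrite ge0_integral_pushforward.
  by apply: eq_measure_integral => A mA _; exact: jointE.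
apply: ge0_le_integral => //.
- by move=> w _; rewrite lee_fin; have := psiC (X w); rewrite ler_norml; lra.
- by apply/measurable_EFinP; exact: measurable_funD.
- exact: measurable_fun_integral_kernel.
- move=> w _; rewrite ge0_integral_pushforward//; last exact: pair1_measurable.
  rewrite /= preimage_setT.
  have mp : measurable_fun setT (fun y => phi (X w, y) + C) by exact: measurable_funD.
  have k1 : k (X w) setT = 1%E by exact: prob_kernel.
  rewrite [leRHS](Rintegral_EFin k1 mp (fun y => bC _ (phiC _))).
  by rewrite lee_fin (RintegralDcst k1 (C := C))// lerD2r.
Qed.
End disintegration.

(** * Recovering a polynomial from its values on a grid *)

Section interpolation.
Variables (R : realType) (d p : nat) (r : R).
Hypothesis r_gt0 : 0 < r.

Definition grid := {ffun 'I_d -> 'I_p.+1}.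
Definition node (j : 'I_p.+1) : R := r * j%:R / p.+1%:R.
Definition grid_point (z : grid) : 'rV[R]_d := \row_i node (z i).

Lemma grid_point_norm z : `|grid_point z| <= r.
Proof.
apply/rV_norm_leP => [|i]; first exact: ltW.
rewrite mxE /node ger0_norm; last by rewrite !mulr_ge0// ?invr_ge0// ltW.
by rewrite ler_pdivrMr ?ltr0n// ler_pM2l// ler_nat ltnW.
Qed.

Let vdm : 'M[R]_p.+1 := Vandermonde p.+1 (\row_j node j).

Let vdm_unit : vdm \in unitmx.
Proof.
rewrite unitmxE det_Vandermonde unitfE; apply/prodf_neq0 => i _.
apply/prodf_neq0 => j ij; rewrite !mxE subr_eq0 /node.
apply/eqP => ji.
have /(mulIf _) : r * j%:R * p.+1%:R^-1 = r * i%:R * p.+1%:R^-1 := ji.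
move=> /(_ (invr_neq0 (lt0r_neq0 (ltr0Sn R p)))).
move=> /(mulfI (lt0r_neq0 r_gt0))/eqP.
by rewrite eqr_nat => /eqP {}ji; rewrite ji ltnn in ij.
Qed.

Let wt (w z : grid) : R := \prod_i invmx vdm (z i) (w i).

Let wtE (w w' : grid) :
  \sum_z wt w z * \prod_i node (z i) ^+ w' i = (w == w')%:R.
Proof.
transitivity (\sum_(z : grid) \prod_i (invmx vdm (z i) (w i) * node (z i) ^+ w' i)).
  by apply: eq_bigr => z _; rewrite big_split.
rewrite -(bigA_distr_bigA (fun i j => invmx vdm j (w i) * node j ^+ w' i)).
transitivity (\prod_i (w i == w' i)%:R : R).
  apply: eq_bigr => i _.
  transitivity ((vdm *m invmx vdm) (w' i) (w i)).
    by rewrite mxE; apply: eq_bigr => j _; rewrite !mxE mulrC.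
  by rewrite mulmxV// mxE eq_sym.
case: eqP => [->|ww']; first by rewrite big1// => i _; rewrite eqxx.
have /existsP[i wi] : [exists i, w i != w' i].
  by rewrite -negb_forall; apply/negP => /forallP h; apply: ww'; apply/ffunP => i; exact/eqP.
by rewrite (bigD1 i)//= (negPf wi) mul0r.
Qed.

(** The values of a polynomial on a grid of nodes determine its coefficients
    linearly: the inverse of the Vandermonde matrix does it in one variable and
    its tensor powers in several. *)
Lemma coef_le_grid : exists2 C : R, 0 < C &
  forall (u : {ffun mindex d p -> R}) (B : R),
    (forall z, `|dotP (Ubasis p (grid_point z)) u| <= B) -> forall w, `|u w| <= C * B.
Proof.
pose c (w : mindex d p) : R := (mfact (multi_of w))%:R * \sum_z `|wt (val w) z|.
have c0 w : 0 <= c w by rewrite mulr_ge0// sumr_ge0.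
exists (1 + \sum_w c w); first by rewrite ltr_wpDr// sumr_ge0.
move=> u B uB w.
have fact_gt0 v : (0 : R) < (mfact (multi_of (v : mindex d p)))%:R.
  by rewrite ltr0n prodn_gt0// => i; rewrite fact_gt0.
have uwE : u w = (mfact (multi_of w))%:R *
    \sum_z wt (val w) z * dotP (Ubasis p (grid_point z)) u.
  transitivity ((mfact (multi_of w))%:R *
      \sum_w' (u w' / (mfact (multi_of w'))%:R *
        \sum_z wt (val w) z * \prod_i node (z i) ^+ val w' i)); last first.
    congr (_ * _); rewrite /dotP; under [RHS]eq_bigr do rewrite mulr_sumr.
    rewrite [RHS]exchange_big /=; apply: eq_bigr => w' _; rewrite mulr_sumr.
    apply: eq_bigr => z _; rewrite ffunE /mpow.
    under [in RHS]eq_bigr do rewrite ffunE mxE.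
    by ring.
  rewrite (bigD1 w)//= wtE eqxx mulr1 big1 ?addr0.
    by rewrite mulrC divfK// gt_eqF.
  move=> w' w'w; rewrite wtE [_ == _](_ : _ = false) ?mulr0//.
  by rewrite (inj_eq val_inj) eq_sym; exact/negbTE.
have B0 : 0 <= B by apply: le_trans (uB [ffun=> ord0]).
apply: (@le_trans _ _ (c w * B)).
  rewrite uwE normrM ger0_norm; last exact: ltW.
  rewrite /c -mulrA ler_pM2l//; apply: le_trans (ler_norm_sum _ _ _) _.
  rewrite mulr_suml; apply: ler_sum => z _; rewrite normrM.
  by rewrite ler_wpM2l.
rewrite ler_wpM2r// (bigD1 w)//= addrCA lerDl.
by rewrite addr_ge0// sumr_ge0.
Qed.

End interpolation.

(** * Taylor's formula in several variables *)

Section taylor.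
Variables (R : realType) (d : nat).
Implicit Types (x y z : 'rV[R]_d) (i j : 'I_d).
Local Notation e_ i := (delta_mx ord0 i : 'rV[R]_d).

Lemma is_derive_coordB x y i j :
  is_derive y (e_ i) (fun z => (z - x) ord0 j) ((i == j)%:R : R).
Proof.
have lim : (fun h : R => h^-1 *: (((h *: e_ i + y) - x) ord0 j - (y - x) ord0 j : R)) @ 0^'
    --> ((i == j)%:R : R).
  apply: cvg_near_cst; near=> h; rewrite /= !mxE eqxx /= eq_sym.
  have h0 : h != 0 by near: h; exact: nbhs_dnbhs_neq.
  rewrite [X in _ *: X](_ : _ = h * (i == j)%:R) ?[_ *: _]mulKf//.
  by ring.
apply: DeriveDef; first by apply/cvg_ex; eexists; exact: lim.
exact: cvg_lim lim.
Unshelve. all: by end_near. Qed.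

Lemma is_derive_bigsum (I : finType) (Q : pred I) (F : I -> 'rV[R]_d -> R)
    (dF : I -> R) y v : (forall w, is_derive y v (F w) (dF w)) ->
  is_derive y v (fun z => \sum_(w | Q w) F w z) (\sum_(w | Q w) dF w).
Proof.
move=> FdF; rewrite (_ : (fun z => _) = \sum_(w | Q w) F w); last first.
  by apply/funext => z; rewrite fct_sumE.
by elim/big_rec2 : _ => [|w l f _ IH]; [exact: is_derive_cst|exact: is_deriveD].
Qed.

Lemma is_derive_bigprod0 (I : finType) (Q : pred I) (F : I -> 'rV[R]_d -> R) y v :
  (forall w, Q w -> is_derive y v (F w) 0) ->
  is_derive y v (fun z => \prod_(w | Q w) F w z) 0.
Proof.
move=> FdF; rewrite (_ : (fun z => _) = \prod_(w | Q w) F w); last first.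
  by apply/funext => z; rewrite fct_prodE.
elim/big_rec : _ => [|w f Qw IH]; first exact: is_derive_cst.
by apply: is_derive_eq (is_deriveM (FdF _ Qw) IH) _; rewrite !scaler0 addr0.
Qed.

Definition monom (v : multi d) z : R := mpow z v / (mfact v)%:R.
Definition mdecr (v : multi d) i : multi d := [ffun j => (v j - (j == i))%N].

Lemma mfact_gt0 (v : multi d) : (0 < mfact v)%N.
Proof. by apply: prodn_gt0 => i; rewrite fact_gt0. Qed.

Lemma is_derive_monom x y i (v : multi d) : is_derive y (e_ i)
  (fun z => monom v (z - x)) (if v i == 0%N then 0 else monom (mdecr v i) (y - x)).
Proof.
pose f z : R := ((z - x) ord0 i) ^+ v i.
pose g z : R := \prod_(j | j != i) ((z - x) ord0 j) ^+ v j.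
have df : is_derive y (e_ i) f ((v i)%:R * ((y - x) ord0 i) ^+ (v i).-1).
  have := @is_deriveX _ _ _ (v i) _ _ _ (is_derive_coordB x y i i).
  by rewrite eqxx [_ *: _]mulr1 (_ : _ ^+ v i = f)//; apply/funext => z; rewrite fctE.
have dg : is_derive y (e_ i) g 0.
  apply: is_derive_bigprod0 => j ji.
  have := @is_deriveX _ _ _ (v j) _ _ _ (is_derive_coordB x y i j).
  rewrite eq_sym (negPf ji) scaler0 (_ : (fun z => _) ^+ v j = (fun z => (z - x) ord0 j ^+ v j))//.
  by apply/funext => z; rewrite fctE.
have -> : (fun z => monom v (z - x)) = (mfact v)%:R^-1 \*: (f * g).
  apply/funext => z; rewrite /monom /mpow (bigD1 i)//= mulrC.
  by rewrite fctE.
apply: is_derive_eq (is_deriveZ _ (is_deriveM df dg)) _.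
rewrite scaler0 add0r; case: eqP => [->|/eqP vi0]; first by rewrite mul0r !scaler0.
have vE : mdecr v i i = (v i).-1 by rewrite ffunE eqxx subn1.
have mfE : (mfact v = v i * mfact (mdecr v i))%N.
  rewrite /mfact (bigD1 i)//= [in RHS](bigD1 i)//= vE mulnA.
  congr (_ * _)%N; first by rewrite -[in LHS](prednK (n := v i)) ?lt0n// factS prednK ?lt0n.
  by apply: eq_bigr => j /negPf ji; rewrite ffunE ji subn0.
have mpE : mpow (y - x) (mdecr v i) = (y - x) ord0 i ^+ (v i).-1 * g y.
  rewrite /mpow (bigD1 i)//= vE; congr (_ * _).
  by apply: eq_bigr => j /negPf ji; rewrite ffunE ji subn0.
rewrite /monom mpE mfE natrM.
set m := (mfact (mdecr v i))%:R; set a := _ ^+ _; set b := g y.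
change (((v i)%:R * m)^-1 * (b * ((v i)%:R * a)) = a * b / m).
have m0 : m != 0 by rewrite pnatr_eq0 -lt0n mfact_gt0.
by field; rewrite m0 pnatr_eq0 vi0.
Qed.

End taylor.

Section taylor_polynomial.
Variables (R : realType) (d p : nat).
Implicit Types (x y z : 'rV[R]_d) (i j : 'I_d) (w : mindex d p).
Local Notation e_ i := (delta_mx ord0 i : 'rV[R]_d).

Definition taylor (k : nat) (c : multi d -> R) z : R :=
  \sum_(w : mindex d p | (mdeg (multi_of w) <= k)%N) c (multi_of w) * monom (multi_of w) z.

(** Shifts of a multi-index along [i]; the first is only meaningful when the
    result still has degree at most [p]. *)
Let up i w : mindex d p := insubd w [ffun j => inord (val w j + (j == i))].
Let down i w : mindex d p := insubd w [ffun j => inord (val w j - (j == i))].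

Let mdeg_mincr (v : multi d) i : mdeg (mincr v i) = (mdeg v).+1.
Proof.
rewrite /mdeg (eq_bigr (fun j => v j + (j == i)))%N; last by move=> j _; rewrite ffunE.
rewrite big_split /= -addn1; congr (_ + _)%N.
by rewrite (bigD1 i) //= eqxx big1 ?addn0 // => j /negPf ->.
Qed.

Let val_le w j : (val w j <= mdeg (multi_of w))%N.
Proof. by rewrite /mdeg (bigD1 j)//= ffunE leq_addr. Qed.

Lemma mdeg_mindex w : (mdeg (multi_of w) <= p)%N.
Proof.
by apply: leq_trans (valP w); rewrite /mdeg; apply: leq_sum => j _; rewrite ffunE.
Qed.

Let multi_of_inj : injective (@multi_of d p).
Proof.
by move=> w w' /ffunP ww'; apply: val_inj; apply/ffunP => j; apply: val_inj;
  have := ww' j; rewrite !ffunE.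
Qed.

Let upE i w : (mdeg (multi_of w) < p)%N -> multi_of (up i w) = mincr (multi_of w) i.
Proof.
move=> wp.
have E j : (inord (val w j + (j == i)) : 'I_p.+1) = (val w j + (j == i))%N :> nat.
  rewrite inordK// ltnS; apply: leq_trans wp; rewrite -[leqRHS]addn1 leq_add//.
  by case: eqP.
apply/ffunP => j; rewrite !ffunE /up val_insubd ifT ?ffunE ?E//.
rewrite (eq_bigr (fun j => mincr (multi_of w) i j)) => [|l _].
  by rewrite -/(mdeg _) mdeg_mincr.
by rewrite !ffunE E.
Qed.

Let downE i w : multi_of (down i w) = mdecr (multi_of w) i.
Proof.
have E j : (inord (val w j - (j == i)) : 'I_p.+1) = (val w j - (j == i))%N :> nat.
  by rewrite inordK// ltnS (leq_trans (leq_subr _ _))// -ltnS.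
apply/ffunP => j; rewrite !ffunE /down val_insubd ifT ?ffunE ?E//.
apply: leq_trans (valP w); apply: leq_sum => l _; rewrite ffunE E.
exact: leq_subr.
Qed.

(** Differentiating shifts the coefficients: the monomials that do not contain
    the variable [i] disappear and the others are reindexed by lowering their
    [i]-th exponent. *)
Lemma is_derive_taylor (k : nat) c x y i : (k < p)%N ->
  is_derive y (e_ i) (fun z => taylor k.+1 c (z - x))
    (taylor k (fun v => c (mincr v i)) (y - x)).
Proof.
move=> kp.
have D w : is_derive y (e_ i) (fun z => c (multi_of w) * monom (multi_of w) (z - x))
    (c (multi_of w) * if multi_of w i == 0%N then 0
                      else monom (mdecr (multi_of w) i) (y - x)).
  exact: (is_deriveZ (c (multi_of w)) (is_derive_monom x y i (multi_of w))).
apply: is_derive_eq (is_derive_bigsum _ D) _.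
rewrite (bigID (fun w => multi_of w i == 0%N)) /= big1 ?add0r; last first.
  by move=> w /andP[_ ->]; rewrite mulr0.
have mdK (v : multi d) : v i != 0%N -> mincr (mdecr v i) i = v.
  move=> vi; apply/ffunP => j; rewrite !ffunE; case: eqP => [->|_].
    by rewrite subnK// lt0n.
  by rewrite subn0 addn0.
have miK (v : multi d) : mdecr (mincr v i) i = v.
  by apply/ffunP => j; rewrite !ffunE addnK.
have down_lt w : multi_of w i != 0%N -> (mdeg (multi_of (down i w)) < mdeg (multi_of w))%N.
  by move=> wi; rewrite downE -[in ltnRHS](mdK _ wi) mdeg_mincr.
rewrite (reindex_onto (up i) (down i)) => [|w /andP[_ wi]] /=; last first.
  apply: multi_of_inj; rewrite upE; first by rewrite downE mdK.
  by rewrite (leq_trans (down_lt _ wi))// mdeg_mindex.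
apply: eq_big => [w|w].
  have [wp|pw] := ltnP (mdeg (multi_of w)) p.
    rewrite upE// mdeg_mincr ltnS ffunE eqxx addn1 /= andbT.
    rewrite (_ : down i _ = w) ?eqxx ?andbT//.
    by apply: multi_of_inj; rewrite downE upE// miK.
  rewrite [RHS]leqNgt (leq_trans kp pw); apply/negbTE/negP.
  move=> /andP[/andP[_ ui]] /eqP dw.
  have := down_lt _ ui; rewrite dw => h.
  by have := leq_trans h (mdeg_mindex _); rewrite ltnNge pw.
move=> /andP[/andP[uk ui] /eqP dw].
have wp : (mdeg (multi_of w) < p)%N.
  by have := down_lt _ ui; rewrite dw => h; apply: leq_trans h (mdeg_mindex _).
by rewrite (negPf ui) upE// miK.
Qed.

Lemma taylor_at0 k c : taylor k c 0 = c (Defs.mzero d).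
Proof.
pose w0 : {ffun 'I_d -> 'I_p.+1} := [ffun=> ord0].
have w0P : (\sum_i w0 i <= p)%N by rewrite big1// => i _; rewrite ffunE.
have w0E : multi_of (exist _ w0 w0P : mindex d p) = Defs.mzero d.
  by apply/ffunP => i; rewrite !ffunE.
rewrite /taylor (bigD1 (exist _ w0 w0P : mindex d p)) /=; last first.
  by rewrite w0E /mdeg big1// => i _; rewrite ffunE.
rewrite big1 ?addr0 => [|w /andP[_ ww0]].
  have z0 i : Defs.mzero d i = 0%N by rewrite ffunE.
  rewrite w0E /monom /mpow /mfact !big1 ?divr1 ?mulr1// => i _; first by rewrite z0.
  by rewrite z0 expr0.
have [i wi] : exists i, multi_of w i != 0%N.
  apply/not_existsP => h; move/negP: ww0; apply; apply/eqP/multi_of_inj.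
  rewrite w0E; apply/ffunP => i; have /negP := h i.
  by rewrite negbK ffunE => /eqP ->; rewrite ffunE.
by rewrite /monom /mpow (bigD1 i)//= mxE expr0n (negPf wi) !mul0r mulr0.
Qed.

(** Going from the centre to [y] one coordinate at a time, each of the [d] steps
    is along an axis and inside the cube, where the mean value theorem in one
    variable applies; only partial derivatives are needed. *)
Lemma cube_mean_value (g : 'rV[R]_d -> R) (g' : 'I_d -> 'rV[R]_d -> R) x r M :
  0 <= r -> (forall y i, cube x r y -> is_derive y (e_ i) g (g' i y)) ->
  (forall y i, cube x r y -> `|g' i y| <= M) -> g x = 0 ->
  forall y, cube x r y -> `|g y| <= d%:R * r * M.
Proof.
move=> r0 dg g'M gx y xy.
pose step (m : nat) : 'rV[R]_d := \row_j (if (j < m)%N then y ord0 j else x ord0 j).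
have yx j : `|y ord0 j - x ord0 j| <= r.
  by have /rV_norm_leP := xy => /(_ r0 j); rewrite !mxE.
suff main m : (m <= d)%N -> `|g (step m)| <= m%:R * r * M.
  have -> : y = step d by apply/rowP => j; rewrite mxE ltn_ord.
  exact: main.
elim: m => [_|m IH md].
  rewrite (_ : step 0%N = x) ?gx ?normr0 ?mul0r//.
  by apply/rowP => j; rewrite mxE.
pose i : 'I_d := Ordinal md.
pose phi s := g (s *: e_ i + step m).
have stepS : step m.+1 = (y ord0 i - x ord0 i) *: e_ i + step m.
  apply/rowP => j; rewrite !mxE eqxx /= ltnS leq_eqVlt -(inj_eq val_inj j i) /=.
  case: eqP => [jm|_]; last by rewrite mulr0 add0r.
  rewrite mulr1 jm ltnn (_ : j = i); last exact: val_inj.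
  by rewrite subrK.
have incube (s : R) : `|s| <= r -> cube x r (s *: e_ i + step m).
  move=> sr; apply/rV_norm_leP => // j; rewrite !mxE eqxx /= -(inj_eq val_inj j i) /=.
  case: eqP => [->|_]; first by rewrite ltnn mulr1 addrK.
  rewrite mulr0 add0r; case: ifP => _; first exact: yx.
  by rewrite subrr normr0.
have dphi (s : R) : `|s| <= r -> is_derive s (1 : R) phi (g' i (s *: e_ i + step m)).
  move=> /incube sc.
  have [Dg gE] := dg _ i sc.
  have E : (fun h : R => h^-1 *: ((phi \o shift s) (h *: 1) - phi s)) =
      (fun h : R => h^-1 *: ((g \o shift (s *: e_ i + step m)) (h *: e_ i)
         - g (s *: e_ i + step m))).
    apply/funext => h; congr (_ *: (_ - _)); rewrite /phi /=.
    by rewrite addrA -scalerDl [_ *: 1]mulr1.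
  by apply: DeriveDef; rewrite /derivable /derive E.
have phiM (a b : R) : a <= b -> `|a| <= r -> `|b| <= r -> `|phi b - phi a| <= M * (b - a).
  move=> ab ar br.
  have sr (s : R) : s \in `[a, b] -> `|s| <= r.
    move: ar br; rewrite in_itv /= !ler_norml => /andP[? ?] /andP[? ?] /andP[? ?].
    by apply/andP; split; lra.
  have [||c cab ->] := @MVT_segment R phi (fun s => g' i (s *: e_ i + step m)) a b ab.
  - move=> s; rewrite in_itv /= => /andP[? ?]; apply: dphi; apply: sr.
    by rewrite in_itv /= !ltW.
  - apply: derivable_within_continuous => s /sr sr'.
    by have [] := dphi s sr'.
  rewrite normrM (ger0_norm (_ : 0 <= b - a)) ?subr_ge0//.
  by rewrite ler_wpM2r ?subr_ge0//; exact/g'M/incube/sr.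
have M0 : 0 <= M by apply: le_trans (g'M x i _); rewrite //= /cube /= subrr normr0.
have phiD : `|g (step m.+1) - g (step m)| <= r * M.
  set a := y ord0 i - x ord0 i in stepS; have ar : `|a| <= r by exact: yx.
  have -> : g (step m.+1) = phi a by rewrite /phi -stepS.
  have -> : g (step m) = phi 0 by rewrite /phi scale0r add0r.
  have r0' : `|0 : R| <= r by rewrite normr0.
  have [a0|a0] := leP 0 a.
    apply: le_trans (phiM _ _ a0 r0' ar) _; rewrite subr0 mulrC ler_wpM2r//.
    by rewrite (le_trans (ler_norm _)).
  rewrite distrC; apply: le_trans (phiM _ _ (ltW a0) ar r0') _.
  rewrite sub0r mulrC ler_wpM2r// (le_trans _ ar)// -normrN; exact: ler_norm.
rewrite -(subrK (g (step m)) (g (step m.+1))).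
apply: le_trans (ler_normD _ _) _; rewrite -natr1 2!mulrDl mul1r addrC.
by apply: lerD => //; apply: IH; exact: ltnW.
Qed.

(** By induction on the order: the partial derivatives of the remainder are the
    remainders, of one order less, of the partial derivatives, and the remainder
    vanishes at the centre. *)
Lemma taylor_remainder (k : nat) (b : multi d -> 'rV[R]_d -> R) x r eps :
  (k <= p)%N -> 0 <= r ->
  (forall v i y, (mdeg v < k)%N -> cube x r y ->
     is_derive y (e_ i) (b v) (b (mincr v i) y)) ->
  (forall v y, mdeg v = k -> cube x r y -> `|b v y - b v x| <= eps) ->
  forall y, cube x r y ->
    `|b (Defs.mzero d) y - taylor k (fun v => b v x) (y - x)| <= (d%:R * r) ^+ k * eps.
Proof.
move=> + r0; elim: k b => [|k IH] b kp db beps y xy.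
  rewrite expr0 mul1r (_ : taylor _ _ _ = b (Defs.mzero d) x).
    by apply: beps => //; rewrite /mdeg big1// => i _; rewrite ffunE.
  rewrite -(taylor_at0 0 (fun v => b v x)); apply: eq_bigr => w.
  rewrite leqn0 sum_nat_eq0 => /forallP w0; rewrite /monom /mpow; congr (_ * (_ / _)).
  by apply: eq_bigr => i _; rewrite (eqP (w0 i)) !expr0.
pose g z := b (Defs.mzero d) z - taylor k.+1 (fun v => b v x) (z - x).
pose bi i (v : multi d) := b (mincr v i).
pose g' i z := bi i (Defs.mzero d) z - taylor k (fun v => bi i v x) (z - x).
have mC (v : multi d) i j : mincr (mincr v i) j = mincr (mincr v j) i.
  by apply/ffunP => l; rewrite !ffunE addnAC.
rewrite exprS -mulrA.
apply: (@cube_mean_value g g' x r) => //.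
- move=> z i xz; apply: is_deriveB; last exact: is_derive_taylor.
  by apply: db => //; rewrite /mdeg big1// => j _; rewrite ffunE.
- move=> z i xz; apply: (IH (bi i)) => //; first exact: ltnW.
  + by move=> v j z' vk xz'; rewrite /bi mC; apply: db => //; rewrite mdeg_mincr.
  + by move=> v z' vk xz'; apply: beps => //; rewrite mdeg_mincr vk.
- by rewrite /g subrr taylor_at0 subrr.
Qed.

End taylor_polynomial.

(** * The conditional distribution function and its quantiles *)

Lemma compact_bounds (R : realType) (T : topologicalType) (f : T -> R) (A : set T) :
  compact A -> {within A, continuous f} -> (forall t, A t -> 0 < f t) ->
  exists lo hi : R, [/\ 0 < lo, lo <= hi & forall t, A t -> lo <= f t <= hi].
Proof.
move=> cA cf f0; have [->|/set0P A0] := eqVneq A set0.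
  by exists 1, 1; split.
have [a aA fa] := compact_EVT_min A0 cA cf.
have [b bA fb] := compact_EVT_max A0 cA cf.
exists (f a), (f b); split; [|exact: fb|]; first by rewrite inE in aA; exact: f0.
by move=> t tA; rewrite fa ?fb ?inE.
Qed.

Section conditional_cdf.
Variables (R : realType) (d : nat) (k : R.-pker 'rV[R]_d ~> R) (S : set 'rV[R]_d).
Local Notation F := (cond_cdf k).
Local Notation Q := (cond_quantile (cond_cdf k)).
Hypothesis cS : compact S.
Hypothesis hypF : assumption_F S F.

Let k1 x : k x setT = 1%E.
Proof. exact: prob_kernel. Qed.

Let kfin x A : measurable A -> k x A \is a fin_num.
Proof.
move=> mA; rewrite ge0_fin_numE//; apply: le_lt_trans (ltry 1).
by rewrite -(k1 x); apply: le_measure => //; rewrite inE.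
Qed.

Lemma cond_cdfE y x : k x `]-oo, y]%classic = (F y x)%:E.
Proof. by rewrite /cond_cdf fineK// kfin. Qed.

Lemma cond_cdf_itv a b x : a <= b -> k x `]a, b]%classic = (F b x - F a x)%:E.
Proof.
move=> ab; have := cond_cdfE b x.
rewrite (@itv_bndbnd_setU _ _ -oo%O (BRight a))//.
rewrite measureU//; last first.
  apply/seteqP; split => // z /=; rewrite !in_itv /= => -[za /andP[az _]].
  by move: az; rewrite ltNge za.
rewrite [X in (X + _)%E](cond_cdfE a x) -[X in (_ + X)%E]fineK ?kfin// -EFinD => -[<-].
by rewrite addrAC subrr add0r fineK ?kfin.
Qed.

Lemma cond_cdf_mono x : {homo F ^~ x : a b / a <= b}.
Proof.
move=> a b ab; rewrite -subr_ge0 -lee_fin -(cond_cdf_itv x ab).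
exact: measure_ge0.
Qed.

(** The conditional density is continuous and positive on the compact set
    [-M, M] x S, hence it lies there between two positive constants. *)
Lemma cond_cdf_increments (M : R) : exists lo hi : R, [/\ 0 < lo, lo <= hi &
  forall x y y', S x -> - M <= y -> y <= y' -> y' <= M ->
    lo * (y' - y) <= F y' x - F y x <= hi * (y' - y)].
Proof.
have [[f [cf f0 fE [L0 L00 fL]]] _] := hypF.
have [lo [hi [lo0 hi0 flh]]] : exists lo hi : R, [/\ 0 < lo, lo <= hi &
    forall t, (`[- M, M] `*` S)%classic t -> lo <= f t.1 t.2 <= hi].
  apply: (@compact_bounds R _ (fun yx : R * 'rV[R]_d => f yx.1 yx.2)).
  - by apply: compact_setX => //; exact: segment_compact.
  - by apply: continuous_subspaceW cf => -[y x] [].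
  - by move=> [y x] [_ /= Sx]; exact: f0.
exists lo, hi; split => // x y y' Sx My yy' yM.
have mf : measurable_fun setT (fun u => f u x).
  apply: continuous_measurable_fun => u; apply/cvgrPdist_le => e e0.
  near=> t; apply: le_trans (fL _ _ _ _ Sx Sx) _.
  rewrite subrr (_ : enorm 0 = 0); last first.
    by rewrite /enorm big1 ?sqrtr0// => i _; rewrite mxE expr0n.
  rewrite expr0n add0r sqrtr_sqr -ler_pdivlMl// mulrC.
  near: t; apply: cvgr_dist_le; first exact: cvg_id.
  by rewrite divr_gt0.
have FE : ((F y' x)%:E = (F y x)%:E +
    \int[lebesgue_measure]_(u in `]y, y']) (f u x)%:E)%E.
  rewrite fE// (@itv_bndbnd_setU _ _ -oo%O (BRight y))//.
  rewrite ge0_integral_setU//=; last 3 first.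
  - by apply/measurable_EFinP; exact: measurable_funTS.
  - by move=> u _; rewrite lee_fin ltW// f0.
  - apply/disj_setPS => z /=; rewrite !in_itv /= => -[za /andP[az _]].
    by move: az; rewrite ltNge za.
  by rewrite -fE.
have lyy : lebesgue_measure `]y, y']%classic = (y' - y)%:E.
  rewrite lebesgue_measure_itv /= lte_fin; case: ifPn => [_|]; first by rewrite -EFinB.
  by rewrite -leNgt => y'y; congr EFin; apply/eqP; rewrite eq_sym subr_eq0 eq_le yy' y'y.
have bnd u : u \in `]y, y'] -> lo <= f u x <= hi.
  rewrite in_itv /= => /andP[yu uy]; apply: (flh (u, x)); split => //=.
  by rewrite in_itv /=; apply/andP; split; lra.
have i1 : (\int[lebesgue_measure]_(u in `]y, y']) (f u x)%:E <= (hi * (y' - y))%:E)%E.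
  apply: (@le_trans _ _ (\int[lebesgue_measure]_(u in `]y, y']) (cst hi%:E u))%E).
    apply: ge0_le_integral => //=.
    - by move=> u _; rewrite lee_fin ltW// f0.
    - by apply/measurable_EFinP; exact: measurable_funTS.
    - by move=> u uy; rewrite lee_fin; have /andP[] := bnd _ uy.
  by rewrite integral_cst//= lyy.
have i2 : ((lo * (y' - y))%:E <= \int[lebesgue_measure]_(u in `]y, y']) (f u x)%:E)%E.
  apply: (@le_trans _ _ (\int[lebesgue_measure]_(u in `]y, y']) (cst lo%:E u))%E).
    by rewrite integral_cst//= lyy.
  apply: ge0_le_integral => //=.
  - by move=> u _; rewrite lee_fin ltW.
  - by apply/measurable_EFinP; exact: measurable_funTS.
  - by move=> u uy; rewrite lee_fin; have /andP[] := bnd _ uy.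
have fn : (\int[lebesgue_measure]_(u in `]y, y']) (f u x)%:E)%E \is a fin_num.
  by rewrite fin_numElt (lt_le_trans _ i2) ?ltNyr// (le_lt_trans i1)// ltry.
have := congr1 fine FE; rewrite fineD//= => ->.
by rewrite addrAC subrr add0r -!lee_fin fineK// i1 i2.
Unshelve. all: by end_near. Qed.

Lemma cond_cdf_above a x : a < 1 -> exists y, a < F y x.
Proof.
move=> a1.
have : k x `]-oo, n%:R]%classic @[n --> \oo] --> k x (\bigcup_n `]-oo, n%:R]%classic).
  apply: nondecreasing_cvg_mu => //; first exact: bigcup_measurable.
  move=> m n mn; apply/subsetPset => z /=; rewrite !in_itv /= => /le_trans; apply.
  by rewrite ler_nat.
rewrite (_ : \bigcup_n _ = setT); last first.
  apply/seteqP; split => // z _; exists (Num.trunc `|z|).+1 => //=.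
  by rewrite in_itv /= (le_trans (ler_norm _))// ltW// truncnS_gt.
rewrite k1 => /fine_cvgP[_] /cvgr_gt/(_ _ a1)[N _ /(_ N (leqnn N)) h].
by exists N%:R.
Qed.

Lemma cond_cdf_below a x : 0 < a -> exists y, F y x < a.
Proof.
move=> a0.
have : k x `]-oo, (- n%:R)%R]%classic @[n --> \oo] --> k x (\bigcap_n `]-oo, - n%:R]%classic).
  apply: nonincreasing_cvg_mu => //; first by rewrite ltey_eq kfin.
    exact: bigcap_measurable.
  move=> m n mn; apply/subsetPset => z /=; rewrite !in_itv /= => /le_trans; apply.
  by rewrite lerN2 ler_nat.
rewrite (_ : \bigcap_n _ = set0); last first.
  apply/seteqP; split => // z /(_ (Num.trunc `|z|).+1 I) /=.
  rewrite in_itv /= => h; have := truncnS_gt `|z|.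
  by have := ler_norm (- z); rewrite normrN; lra.
rewrite measure0 => /fine_cvgP[_] /cvgr_lt/(_ _ a0)[N _ /(_ N (leqnn N)) h].
by exists (- N%:R).
Qed.

Lemma cond_quantileE a x : S x -> 0 < a < 1 -> F (Q a x) x = a.
Proof.
move=> Sx /andP[a0 a1].
have [y1 y1a] := cond_cdf_above x a1; have [y2 y2a] := cond_cdf_below x a0.
pose E := [set y | a <= F y x].
have lbE y : F y x < a -> lbound E y.
  move=> ya z az; rewrite leNgt; apply/negP => /ltW /(cond_cdf_mono x).
  by rewrite leNgt (lt_le_trans ya).
have infE : has_inf E by split; [exists y1; exact: ltW|exists y2; exact: lbE].
set q := Q a x; have qE : q = inf E by [].
have [lo [hi [lo0 lohi inc]]] := cond_cdf_increments (`|q| + 1).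
have hi0 := lt_le_trans lo0 lohi.
have [q1 q2] : - `|q| <= q /\ q <= `|q| by apply/andP; rewrite -ler_norml.
apply/eqP; rewrite eq_le; apply/andP; split; apply/ler_addgt0Pr => e e0.
  pose e' := Num.min 1 (e / hi).
  have e'0 : 0 < e' by rewrite lt_min ltr01 divr_gt0.
  have [e'1 e'2] : e' <= 1 /\ e' <= e / hi by split; rewrite ge_min lexx ?orbT.
  have : F (q - e') x < a.
    rewrite ltNge; apply/negP => h; have : q <= q - e' by apply: ge_inf => //; exact: infE.2.
    lra.
  have := inc x (q - e') q Sx; move=> /(_ _ _ _)/andP[||| _]; try lra.
  have : hi * e' <= e by rewrite mulrC -ler_pdivlMr.
  rewrite (_ : q - (q - e') = e'); lra.
pose e' := Num.min 1 (e / hi).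
have e'0 : 0 < e' by rewrite lt_min ltr01 divr_gt0.
have [e'1 e'2] : e' <= 1 /\ e' <= e / hi by split; rewrite ge_min lexx ?orbT.
have [z Ez zq] := inf_adherent e'0 infE.
have zq' : a <= F (q + e') x.
  by apply: le_trans Ez _; apply: cond_cdf_mono; rewrite qE ltW.
have := inc x q (q + e') Sx; move=> /(_ _ _ _)/andP[||| _]; try lra.
have : hi * e' <= e by rewrite mulrC -ler_pdivlMr.
rewrite (_ : q + e' - q = e'); lra.
Qed.

Lemma cond_quantile_mono a b x : S x -> 0 < a -> a <= b -> b < 1 -> Q a x <= Q b x.
Proof.
move=> Sx a0 ab b1.
have [y2 y2a] := cond_cdf_below x a0.
apply: ge_inf.
  exists y2 => z /= az; rewrite leNgt; apply/negP => /ltW /(cond_cdf_mono x).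
  by rewrite leNgt (lt_le_trans y2a).
by rewrite /= cond_quantileE// (lt_le_trans a0).
Qed.

End conditional_cdf.

(** * Nets of parameters *)

(** One parameter is picked in each cell of a product grid that contains some.
    Since the centres are parameters, every bound that holds for parameters is
    available at the centres.  The value [t0] fills the empty cells. *)
Lemma proper_net (R : realType) (T : Type) (J : finType) (crd : T -> J -> R)
    (Theta : set T) (t0 : T) (r e : R) (N : nat) :
  0 < e -> (forall t j, Theta t -> `|crd t j| <= r) -> 2 * r / e < N%:R ->
  exists c : {ffun J -> 'I_N} -> T, forall t, Theta t ->
    exists z, Theta (c z) /\ forall j, `|crd t j - crd (c z) j| <= e.
Proof.
move=> e0 crdr rN.
have pos t j : Theta t -> 0 <= (crd t j + r) / e.
  move=> Tt; have := crdr t j Tt; rewrite ler_norml => /andP[? ?].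
  by apply: divr_ge0; [lra|exact: ltW].
have ltN t j : Theta t -> (Num.trunc ((crd t j + r) / e) < N)%N.
  move=> Tt; rewrite -(ltr_nat R); apply: le_lt_trans rN.
  apply: (@le_trans _ _ ((crd t j + r) / e)); first by rewrite truncn_le// pos.
  by rewrite ler_pM2r ?invr_gt0//; have := crdr t j Tt; rewrite ler_norml => /andP[? ?]; lra.
pose cell t (z : {ffun J -> 'I_N}) :=
  forall j, z j = Num.trunc ((crd t j + r) / e) :> nat.
exists (fun z => if pselect (exists t, Theta t /\ cell t z) is left h
  then projT1 (cid h) else t0) => t Tt.
pose z : {ffun J -> 'I_N} := [ffun j => Ordinal (ltN t j Tt)].
have tz : cell t z by move=> j; rewrite ffunE.
exists z; case: pselect => [h|[]]; last by exists t.
case: (cid h) => t' [Tt' t'z] /=.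
split => // j; have := tz j; rewrite t'z => E.
have [a1 a2] := andP (truncn_itv (pos t j Tt)).
have [b1 b2] := andP (truncn_itv (pos t' j Tt')).
rewrite E in b1 b2.
set a := (crd t j + r) / e in a1 a2; set b := (crd t' j + r) / e in b1 b2.
rewrite (_ : _ - _ = (a - b) * e); last by rewrite /a /b; field; rewrite gt_eqF.
rewrite normrM (gtr0_norm e0) -[leRHS]mul1r ler_wpM2r ?(ltW e0)//.
by rewrite ler_norml -addn1 natrD in a2 b2 *; lra.
Qed.

(** * The score of the check loss *)

Section quantile_score.
Variables (R : realType) (d p : nat) (K : 'rV[R]_d -> R).
Local Notation RP := {ffun mindex d p -> R}.
Implicit Types (u g b : RP) (x z : 'rV[R]_d).

(** Half the derivative, in the direction [u], of the weighted loss of one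
    observation at the local polynomial [g]; [z] is the position of the covariate
    in the window rescaled to unit size. *)
Definition score (a : R) g u z (y : R) : R :=
  ((y <= dotP (Ubasis p z) g)%R%:R - a) * dotP (Ubasis p z) u * K z.

(** Multiplying the coefficients by powers of the bandwidth turns a polynomial in
    [X - x] into a polynomial in (X - x) / h, see [dotP_rescale]. *)
Definition rescale (h : R) b : RP := [ffun w => h ^+ mdeg (multi_of w) * b w].
Definition shifted (t : R) g u : RP := [ffun w => g w + t * u w].
Definition norm1 u : R := \sum_w `|u w|.

Lemma norm1_ge0 u : 0 <= norm1 u.
Proof. exact: sumr_ge0. Qed.

Lemma dotP_shifted z t g u :
  dotP (Ubasis p z) (shifted t g u) = dotP (Ubasis p z) g + t * dotP (Ubasis p z) u.
Proof.
rewrite /dotP mulr_sumr -big_split; apply: eq_bigr => w _.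
by rewrite !ffunE mulrDr mulrCA.
Qed.

Lemma dotP_rescale h z b : dotP (Ubasis p z) (rescale h b) = dotP (Ubasis p (h *: z)) b.
Proof.
apply: eq_bigr => w _; rewrite !ffunE /mpow.
have -> : \prod_i (h *: z) ord0 i ^+ (multi_of w) i =
    h ^+ mdeg (multi_of w) * \prod_i z ord0 i ^+ (multi_of w) i.
  rewrite /mdeg -prodrXr -big_split; apply: eq_bigr => i _.
  by rewrite mxE exprMn.
by ring.
Qed.

Lemma loss_subgradient (a y m m' : R) :
  loss a (y - m) + 2 * ((y <= m)%R%:R - a) * (m' - m) <= loss a (y - m').
Proof.
rewrite /loss; have [ym|my] := leP y m.
  rewrite (ler0_norm (_ : y - m <= 0)) ?subr_le0//= mulr1n.
  by have := ler_norm (- (y - m')); rewrite normrN; lra.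
rewrite (gtr0_norm (_ : 0 < y - m)) ?subr_gt0//= mulr0n.
by have := ler_norm (y - m'); lra.
Qed.

Hypothesis K_ge0 : forall z, 0 <= K z.

(** By convexity the objective decreases towards the minimizer, so that its
    derivative is nonpositive at any earlier point of the segment from [bs] to
    [bh], in particular at distance [t] from [bs].  The direction is that of the
    rescaled difference, and [loss_subgradient] replaces differentiability. *)
Lemma minimizer_score (n : nat) (data : nat -> 'rV[R]_d * R) a h x (bh bs : RP) (t : R) :
  (0 < n)%N -> 0 < h -> 0 <= t -> is_minimizer (objective K n data a h x) bh ->
  t < norm1 (rescale h [ffun w => bh w - bs w]) ->
  exists u, norm1 u = 1 /\
    \sum_(i < n) score a (shifted t (rescale h bs) u) u
                       (h^-1 *: ((data i).1 - x)) (data i).2 <= 0.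
Proof.
move=> n0 h0 t0 min_bh; set D := [ffun w => bh w - bs w]; set r := norm1 _ => tr.
have r0 : 0 < r by exact: le_lt_trans tr.
pose u : RP := [ffun w => r^-1 * rescale h D w].
exists u; split.
  rewrite /norm1; under eq_bigr do rewrite ffunE normrM gtr0_norm ?invr_gt0//.
  by rewrite -mulr_sumr mulVf// gt_eqF.
pose z i := h^-1 *: ((data i).1 - x).
have zE i : h *: z i = (data i).1 - x by rewrite scalerA mulfV ?scale1r// gt_eqF.
pose b1 : RP := [ffun w => bs w + t / r * D w].
have rb1 : rescale h b1 = shifted t (rescale h bs) u.
  by apply/ffunP => w; rewrite !ffunE; ring.
have rbh : rescale h bh = shifted (r - t) (shifted t (rescale h bs) u) u.
  by apply/ffunP => w; rewrite !ffunE; field; rewrite gt_eqF.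
have b1E i : dotP (Ubasis p ((data i).1 - x)) b1 =
    dotP (Ubasis p (z i)) (shifted t (rescale h bs) u).
  by rewrite -zE -dotP_rescale rb1.
have bhE i : dotP (Ubasis p ((data i).1 - x)) bh =
    dotP (Ubasis p (z i)) (shifted t (rescale h bs) u) +
    (r - t) * dotP (Ubasis p (z i)) u.
  by rewrite -zE -dotP_rescale rbh dotP_shifted.
have := min_bh b1; rewrite /objective ler_pM2l; last first.
  by rewrite invr_gt0 mulr_gt0 ?ltr0n ?exprn_gt0.
set S := \sum_(i < n) score _ _ _ _ _ => le_sum.
suff : \sum_(i < n) loss a ((data i).2 - dotP (Ubasis p ((data i).1 - x)) b1) *
      K (z i) + 2 * (r - t) * S <=
    \sum_(i < n) loss a ((data i).2 - dotP (Ubasis p ((data i).1 - x)) bh) * K (z i).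
  move=> h1; have {h1} h2 : 2 * (r - t) * S <= 0 by have := le_trans h1 le_sum; lra.
  by rewrite pmulr_rle0 in h2; [exact: h2|lra].
rewrite /S mulr_sumr -big_split; apply: ler_sum => i _ /=.
rewrite b1E bhE /score -/(z i).
set m := dotP _ (shifted _ _ _); set A := dotP _ u.
rewrite [leLHS](_ : _ = (loss a ((data i).2 - m) +
   2 * (((data i).2 <= m)%R%:R - a) * (m + (r - t) * A - m)) * K (z i)); last by ring.
by apply: ler_wpM2r => //; exact: loss_subgradient.
Qed.

End quantile_score.

(** * Bracketing the score *)

Section monomial_bounds.
Variables (R : realType) (d p : nat).
Implicit Types (z : 'rV[R]_d) (u : {ffun mindex d p -> R}).

Lemma monom_bound (v : multi d) z rho : `|z| <= rho -> `|monom v z| <= rho ^+ mdeg v.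
Proof.
move=> zr; have r0 : 0 <= rho by apply: le_trans zr.
have f1 : 1 <= (mfact v)%:R :> R by rewrite ler1n mfact_gt0.
have f0 := lt_le_trans ltr01 f1.
rewrite /monom normrM normfV (gtr0_norm f0) ler_pdivrMr//.
apply: (@le_trans _ _ (rho ^+ mdeg v)); last by rewrite ler_peMr// exprn_ge0.
rewrite /mpow normr_prod /mdeg -prodrXr; apply: ler_prod => i _.
rewrite normr_ge0 normrX lerXn2r ?nnegrE//.
exact: le_trans (rV_coord_le z i) zr.
Qed.

Lemma monom_lipschitz (v : multi d) z z' rho : 1 <= rho ->
  `|z| <= rho -> `|z'| <= rho ->
  `|monom v z - monom v z'| <= d%:R * `|z - z'| * (3 * rho) ^+ mdeg v.
Proof.
move=> r1 zr z'r; pose g y : R := monom v y - monom v z'.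
pose g' i y : R := (if v i == 0%N then 0 else monom (mdecr v i) (y - 0)) - 0.
apply: (@cube_mean_value _ _ g g' z'); rewrite ?subrr//.
- move=> y i _; apply: is_deriveB.
  have := is_derive_monom 0 y i v.
  by rewrite (_ : (fun z => monom v (z - 0)) = monom v)//; apply/funext => ?; rewrite subr0.
- move=> y i; rewrite /cube /= => yz'; rewrite /g' !subr0.
  case: eqP => _; first by rewrite normr0 exprn_ge0//; lra.
  apply: (@le_trans _ _ ((3 * rho) ^+ mdeg (mdecr v i))).
    apply: monom_bound; rewrite -(subrK z' y).
    apply: le_trans (ler_normD _ _) _.
    by have := ler_normB z z'; lra.
  apply: ler_weXn2l; first lra.
  by apply: leq_sum => j _; rewrite ffunE leq_subr.
- by rewrite /g subrr.
- by rewrite /cube /=.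
Qed.

Lemma UbasisE z w : Ubasis p z w = monom (multi_of w) z.
Proof. by rewrite ffunE. Qed.

Lemma dotP_bound u z rho : 1 <= rho -> `|z| <= rho ->
  `|dotP (Ubasis p z) u| <= rho ^+ p * norm1 u.
Proof.
move=> r1 zr; apply: le_trans (ler_norm_sum _ _ _) _.
rewrite /norm1 mulr_sumr; apply: ler_sum => w _; rewrite normrM ler_wpM2r// UbasisE.
apply: le_trans (monom_bound _ zr) _.
by apply: ler_weXn2l => //; exact: mdeg_mindex.
Qed.

Lemma dotP_lipschitz u z z' rho : 1 <= rho -> `|z| <= rho -> `|z'| <= rho ->
  `|dotP (Ubasis p z) u - dotP (Ubasis p z') u| <=
    d%:R * (3 * rho) ^+ p * norm1 u * `|z - z'|.
Proof.
move=> r1 zr z'r; rewrite /dotP -sumrB; apply: le_trans (ler_norm_sum _ _ _) _.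
rewrite /norm1 mulr_sumr mulr_suml; apply: ler_sum => w _.
rewrite -mulrBl normrM !UbasisE.
apply: (@le_trans _ _ (d%:R * `|z - z'| * (3 * rho) ^+ mdeg (multi_of w) * `|u w|)).
  by rewrite ler_wpM2r//; exact: monom_lipschitz.
rewrite [leRHS](_ : _ = d%:R * `|z - z'| * (3 * rho) ^+ p * `|u w|); last by ring.
rewrite ler_wpM2r// ler_wpM2l ?mulr_ge0//.
by apply: ler_weXn2l; [lra|exact: mdeg_mindex].
Qed.

Lemma dotPB z u u' :
  dotP (Ubasis p z) u - dotP (Ubasis p z) u' =
  dotP (Ubasis p z) [ffun w => u w - u' w].
Proof. by rewrite /dotP -sumrB; apply: eq_bigr => w _; rewrite -mulrBr; congr (_ * _); rewrite ffunE. Qed.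

End monomial_bounds.

Section kernel_bounds.
Variables (R : realType) (d : nat) (K : 'rV[R]_d -> R).

(** The assumptions on the kernel translated to the maximum norm, in which all
    the cubes and the nets are taken. *)
Definition kernel_props (kap CK LK Kl : R) :=
  [/\ 1 <= kap, 0 <= LK, 0 < Kl &
  [/\ (forall z, kap < `|z| -> K z = 0), (forall z, 0 <= K z <= CK),
      (forall z z', `|K z - K z'| <= LK * `|z - z'|) &
      (forall z, d%:R * `|z| <= 1 -> Kl <= K z)]].

Lemma enorm_le (x : 'rV[R]_d) : enorm x <= d%:R * `|x|.
Proof.
rewrite /enorm -[leRHS]ger0_norm ?mulr_ge0// -sqrtr_sqr ler_sqrt ?sqr_ge0//.
apply: (@le_trans _ _ (\sum_(i < d) `|x| ^+ 2)).
  apply: ler_sum => i _; rewrite -[leLHS]real_normK ?num_real// lerXn2r ?nnegrE//.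
  exact: rV_coord_le.
rewrite sumr_const card_ord -[leLHS]mulr_natl exprMn ler_wpM2r ?sqr_ge0//.
rewrite -natrX ler_nat; case: (posnP d) => [->|d0]; first by rewrite leq0n.
by rewrite -mulnn leq_pmulr.
Qed.

Lemma kernel_propsP : assumption_K K -> exists kap CK LK Kl, kernel_props kap CK LK Kl.
Proof.
move=> [K0 [c cK] cptK _ [Kl Kl0 KlK]].
have [M [_ MK]] := compact_bounded cptK.
pose kap := `|M| + 1.
have suppK z : kap < `|z| -> K z = 0.
  move=> zk; apply/eqP; apply: contraTT zk => Kz.
  rewrite -leNgt; apply: (MK kap).
    by rewrite /kap; have := ler_norm M; lra.
  exact: subset_closure.
pose LK := `|c| * d%:R.
have LKK z z' : `|K z - K z'| <= LK * `|z - z'|.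
  apply: le_trans (cK _ _) _; rewrite /LK -mulrA.
  apply: (@le_trans _ _ (`|c| * enorm (z - z'))).
    by rewrite ler_wpM2r ?ler_norm// sqrtr_ge0.
  by rewrite ler_wpM2l// enorm_le.
have LK0 : 0 <= LK by rewrite mulr_ge0.
have kap1 : 1 <= kap by rewrite lerDr.
exists kap, (K 0 + LK * kap), LK, Kl; split => //; split => // [z|z zd].
  rewrite K0 /=; have [zk|/suppK ->] := leP `|z| kap; last first.
    by rewrite addr_ge0// mulr_ge0//; lra.
  have := LKK z 0; rewrite subr0 => h.
  have := ler_norm (K z - K 0); have : LK * `|z| <= LK * kap by rewrite ler_wpM2l.
  lra.
by apply: KlK; apply: le_trans (enorm_le _) zd.
Qed.

End kernel_bounds.

Section bracket.
Variables (R : realType) (d p : nat) (K : 'rV[R]_d -> R) (kap CK LK Kl : R).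
Hypothesis Kprops : kernel_props K kap CK LK Kl.
Implicit Types (u g : {ffun mindex d p -> R}) (x z : 'rV[R]_d).

Local Notation rho := (kap + 1).

Let c1 : R := rho ^+ p.
Let c2 : R := d%:R * (3 * rho) ^+ p.

(** One constant serves both as a Lipschitz constant of the polynomials with
    coefficients at most [B] and as one of the smooth factors of the score. *)
Definition score_cst (B : R) : R :=
  (c2 * B + c1) + c1 * CK + (c1 * CK + (c2 + c1) * CK + c1 * LK) + 1.

Let c1_gt0 : 0 < c1.
Proof. by case: Kprops => ? _ _ _; rewrite exprn_gt0//; lra. Qed.
Let c2_ge0 : 0 <= c2.
Proof. by case: Kprops => ? _ _ _; rewrite mulr_ge0// exprn_ge0//; lra. Qed.
Let CK_ge0 : 0 <= CK.
Proof. by case: Kprops => _ _ _ [_ /(_ 0)/andP[h0 h1] _ _]; exact: le_trans h1. Qed.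

Lemma score_cst_ge1 B : 0 <= B -> 1 <= score_cst B.
Proof.
move=> B0; case: Kprops => _ LK0 _ _; rewrite /score_cst.
have c10 := ltW c1_gt0.
have P1 : 0 <= c2 * B by rewrite mulr_ge0.
have P2 : 0 <= c1 * CK by rewrite mulr_ge0.
have P3 : 0 <= (c2 + c1) * CK by rewrite mulr_ge0// addr_ge0.
have P4 : 0 <= c1 * LK by rewrite mulr_ge0.
lra.
Qed.

Lemma score_bound (a : R) g u z y : 0 <= a <= 1 -> `|z| <= rho -> norm1 u <= 1 ->
  `|score K a g u z y| <= c1 * CK.
Proof.
case: Kprops => k1 _ _ [_ Kb _ _] /andP[a0 a1] zr u1.
rewrite /score !normrM; apply: ler_pM => //; last first.
  by rewrite ger0_norm; case/andP: (Kb z).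
rewrite -[leRHS]mul1r; apply: ler_pM => //.
  by case: (y <= _); rewrite ?mulr1n ?mulr0n ler_norml; apply/andP; split; lra.
apply: le_trans (dotP_bound _ _ zr) _; first lra.
by rewrite -[leRHS]mulr1 ler_wpM2l// ltW.
Qed.

(** The score is Lipschitz in all its parameters but for the jump of the
    indicator, which takes place when the response lies between the values of
    the two polynomials, hence close to the second. *)
Lemma score_lipschitz (B a a' eta y : R) g g' u u' z z' : 0 <= B ->
  0 <= a <= 1 -> 0 <= a' <= 1 -> `|z| <= rho -> `|z'| <= rho ->
  norm1 u <= 1 -> norm1 u' <= 1 -> norm1 g <= B ->
  norm1 [ffun w => g w - g' w] <= eta -> norm1 [ffun w => u w - u' w] <= eta ->
  `|a - a'| <= eta -> `|z - z'| <= eta ->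
  `|score K a g u z y - score K a' g' u' z' y| <=
    score_cst B * ((`|y - dotP (Ubasis p z') g'| <= score_cst B * eta)%R%:R + eta).
Proof.
case: Kprops => k1 LK0 _ [_ Kb KL _] B0 /andP[a0 a1] /andP[a'0 a'1] zr z'r u1 u'1 gB.
move=> gg uu aa zz.
have r1 : 1 <= rho by lra.
have eta0 : 0 <= eta by exact: le_trans aa.
set m := dotP (Ubasis p z) g; set m' := dotP (Ubasis p z') g'.
set A := dotP (Ubasis p z) u; set A' := dotP (Ubasis p z') u'.
have c10 := ltW c1_gt0.
have dd (b b' : {ffun mindex d p -> R}) (B' : R) : norm1 b <= B' ->
    norm1 [ffun w => b w - b' w] <= eta ->
    `|dotP (Ubasis p z) b - dotP (Ubasis p z') b'| <= (c2 * B' + c1) * eta.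
  move=> bB bb.
  rewrite -(subrK (dotP (Ubasis p z') b) (dotP (Ubasis p z) b)) -addrA dotPB.
  apply: le_trans (ler_normD _ _) _; rewrite mulrDl; apply: lerD.
    apply: le_trans (dotP_lipschitz _ r1 zr z'r) _; rewrite -/c2.
    apply: ler_pM => //; first by rewrite mulr_ge0// norm1_ge0.
    by rewrite ler_wpM2l.
  apply: le_trans (dotP_bound _ r1 z'r) _.
  by rewrite ler_wpM2l.
have mm := dd _ _ _ gB gg; rewrite -/m -/m' in mm.
have AA := dd _ _ _ u1 uu; rewrite -/A -/A' mulr1 in AA.
have Ab : `|A| <= c1.
  apply: le_trans (dotP_bound _ r1 zr) _.
  by rewrite -[leRHS]mulr1 ler_wpM2l.
have A'b : `|A'| <= c1.
  apply: le_trans (dotP_bound _ r1 z'r) _.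
  by rewrite -[leRHS]mulr1 ler_wpM2l.
have [K0 KC] := andP (Kb z); have [K'0 K'C] := andP (Kb z').
have KK : `|K z - K z'| <= LK * eta by apply: le_trans (KL _ _) _; rewrite ler_wpM2l.
have P1 : 0 <= c2 * B by rewrite mulr_ge0.
have P2 : 0 <= c1 * CK by rewrite mulr_ge0.
have P3 : 0 <= (c2 + c1) * CK by rewrite mulr_ge0// addr_ge0.
have P4 : 0 <= c1 * LK by rewrite mulr_ge0.
have Cge : c2 * B + c1 <= score_cst B.
  by rewrite /score_cst;
    clear -R d p K kap CK LK Kl Kprops c1 c2 c1_gt0 c2_ge0 CK_ge0 P1 P2 P3 P4; lra.
rewrite /score -/m -/m' -/A -/A'.
set i := ((y <= m)%R%:R : R); set i' := ((y <= m')%R%:R : R).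
set J := ((`|y - m'| <= score_cst B * eta)%R%:R : R).
have ii : `|i - i'| <= J.
  rewrite /i /i' /J; case: (leP `|y - m'|) => [_|far].
    by case: (y <= m); case: (y <= m'); rewrite ?subrr ?normr0 ?subr0 ?sub0r ?normrN ?normr1 /= ?mulr1n.
  have mfar : `|m - m'| < `|y - m'|.
    by apply: le_lt_trans far; apply: le_trans mm _; rewrite ler_wpM2r.
  have -> : (y <= m) = (y <= m').
    move: mfar; rewrite !(leNgt y).
    have [ym'|ym'] := ltP m' y; have [ym|ym] := ltP m y => //.
      rewrite (gtr0_norm (_ : 0 < y - m')) ?subr_gt0// => h.
      by have := ler_norm (m - m');
        clear -R d p K kap CK LK Kl Kprops c1 c2 c1_gt0 c2_ge0 CK_ge0 h ym ym'; lra.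
    rewrite (ler0_norm (_ : y - m' <= 0)) ?subr_le0// => h.
    by have := ler_norm (- (m - m')); rewrite normrN;
      clear -R d p K kap CK LK Kl Kprops c1 c2 c1_gt0 c2_ge0 CK_ge0 h ym ym'; lra.
  by rewrite subrr normr0.
have i'a : `|i' - a'| <= 1.
  by rewrite /i'; case: (y <= m'); rewrite ?mulr1n ?mulr0n ler_norml; apply/andP; split;
    clear -R d p K kap CK LK Kl Kprops c1 c2 c1_gt0 c2_ge0 CK_ge0 a'0 a'1; lra.
have J0 : 0 <= J by rewrite /J.
rewrite [X in `|X|](_ : _ = (i - i') * A * K z + (a' - a) * A * K z +
  (i' - a') * (A - A') * K z + (i' - a') * A' * (K z - K z')); last by ring.
have N3 (q1 q2 q3 b1 b2 b3 : R) : `|q1| <= b1 -> `|q2| <= b2 -> `|q3| <= b3 ->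
    `|q1 * q2 * q3| <= b1 * b2 * b3.
  move=> h1 h2 h3; rewrite !normrM; apply: ler_pM => //.
  exact: ler_pM.
have Kn : `|K z| <= CK by rewrite ger0_norm.
have t1 := N3 _ _ _ _ _ _ ii Ab Kn.
have t2 : `|(a' - a) * A * K z| <= eta * c1 * CK by apply: N3 => //; rewrite distrC.
have t3 := N3 _ _ _ _ _ _ i'a AA Kn.
have t4 := N3 _ _ _ _ _ _ i'a A'b KK.
apply: le_trans (ler_normD _ _) _; apply: le_trans (lerD (ler_normD _ _) t4) _.
apply: le_trans (lerD (lerD (ler_normD _ _) t3) (lexx _)) _.
apply: le_trans (lerD (lerD (lerD t1 t2) (lexx _)) (lexx _)) _.
rewrite mulrDr; apply: (@le_trans _ _ (c1 * CK * J +
    (c1 * CK + (c2 + c1) * CK + c1 * LK) * eta)).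
  by rewrite le_eqVlt; apply/orP; left; apply/eqP; ring.
by apply: lerD; rewrite ler_wpM2r// /score_cst;
  clear -R d p K kap CK LK Kl Kprops c1 c2 c1_gt0 c2_ge0 CK_ge0 P1 P2 P3 P4 c10; lra.
Qed.

(** A lower bound for all the scores with parameters close to the given ones.
    The correction extends to the window of radius [rho] = [kap + 1], as the
    support of the kernel moves with the parameters. *)
Definition bracket (B a : R) g u (h : R) x (eta : R) (Xy : 'rV[R]_d * R) : R :=
  let z := h^-1 *: (Xy.1 - x) in
  if `|z| <= rho then score K a g u z Xy.2 - score_cst B *
    ((`|Xy.2 - dotP (Ubasis p z) g| <= score_cst B * eta)%R%:R + eta) else 0.

(** Inside the enlarged window this is [score_lipschitz].  A small displacement
    of the window does not take the support of the kernel out of the enlarged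
    one, outside of which both sides vanish. *)
Lemma bracket_le_score (B a a' eta e r h h' : R) g g' u u' x x' Xy : 0 <= B ->
  0 <= a <= 1 -> 0 <= a' <= 1 -> 0 < h -> 0 < h' -> h <= 1 -> h' <= 1 -> h'^-1 <= r ->
  h^-1 <= r ->
  norm1 u <= 1 -> norm1 u' <= 1 -> norm1 g <= B ->
  norm1 [ffun w => g w - g' w] <= eta -> norm1 [ffun w => u w - u' w] <= eta ->
  `|a - a'| <= eta -> `|x - x'| <= e -> `|h^-1 - h'^-1| <= e ->
  e * (r + kap) <= eta -> eta <= 1 ->
  bracket B a' g' u' h' x' eta Xy <= score K a g u (h^-1 *: (Xy.1 - x)) Xy.2.
Proof.
case: (Kprops) => k1 LK0 _ [Ksupp Kb KL _] B0 a01 a'01 h0 h'0 h1 h'1 hr' hr u1 u'1 gB gg uu aa xx hh er e1.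
case: Xy => X y /=; rewrite /bracket /=.
set z := h^-1 *: (X - x); set z' := h'^-1 *: (X - x').
have score0 a1 g1 u1' z1 : kap < `|z1| -> score K a1 g1 u1' z1 y = 0.
  by move=> /Ksupp; rewrite /score => ->; rewrite mulr0.
have zzE : z - z' = (- h^-1) *: (x - x') + ((h^-1 - h'^-1) * h') *: z'.
  rewrite /z /z' scalerA -mulrA mulfV ?gt_eqF// mulr1.
  by apply/rowP => j; rewrite !mxE; ring.
have zzE' : z - z' = (- h'^-1) *: (x - x') + ((h^-1 - h'^-1) * h) *: z.
  rewrite /z /z' scalerA -mulrA mulfV ?gt_eqF// mulr1.
  by apply/rowP => j; rewrite !mxE; ring.
have e0 : 0 <= e by exact: le_trans xx.
have close (l l' : R) (zz : 'rV[R]_d) : 0 < l -> l <= r -> 0 < l' -> l' <= 1 -> `|zz| <= kap ->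
    `|(- l) *: (x - x') + ((h^-1 - h'^-1) * l') *: zz| <= eta.
  move=> l0 lr l'0 l'1 zk; apply: le_trans (ler_normD _ _) _; apply: le_trans er.
  rewrite mulrDr; apply: lerD.
    by rewrite normrZ normrN gtr0_norm// mulrC ler_pM// ltW.
  rewrite normrZ; apply: ler_pM => //; rewrite normrM -[leRHS]mulr1 ler_pM//.
  by rewrite gtr0_norm.
have near_zz : `|z| <= kap \/ `|z'| <= kap -> `|z - z'| <= eta.
  case=> zk; first by rewrite zzE'; apply: close => //; rewrite invr_gt0.
  by rewrite zzE; apply: close => //; rewrite invr_gt0.
have C0 := lt_le_trans ltr01 (score_cst_ge1 B0).
have eta0 : 0 <= eta by exact: le_trans aa.
have D0 : 0 <= score_cst B *
    ((`|y - dotP (Ubasis p z') g'| <= score_cst B * eta)%R%:R + eta).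
  by apply: mulr_ge0; [exact: ltW|exact: addr_ge0].
have Bz : `|z'| <= `|z| + `|z - z'|.
  by have := ler_normB z (z - z'); rewrite subKr.
have Bz' : `|z| <= `|z'| + `|z - z'|.
  by have := ler_normD z' (z - z'); rewrite [z' + (_ - _)]addrC subrK.
have [nz|nz] := pselect (`|z| <= kap \/ `|z'| <= kap).
  have zz := near_zz nz.
  have zz1 := le_trans zz e1.
  have [zr z'r] : `|z| <= rho /\ `|z'| <= rho.
    case: nz => q; split; try by rewrite (le_trans q)// lerDl.
      exact: le_trans Bz (lerD q zz1).
    exact: le_trans Bz' (lerD q zz1).
  rewrite z'r lerBlDr -lerBlDl; apply: le_trans (ler_norm _) _.
  by rewrite distrC; exact: (@score_lipschitz B).
have [zk z'k] : kap < `|z| /\ kap < `|z'|.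
  by split; rewrite ltNge; apply/negP => ?; apply: nz; [left|right].
rewrite (score0 _ _ _ z)// (score0 _ _ _ z')//; case: ifP => // _.
by rewrite sub0r oppr_le0.
Qed.

End bracket.

(** * Probabilities of small cubes *)

Section design.
Variables (R : realType) (dOm : measure_display) (Om : measurableType dOm)
  (P : probability Om R) (d : nat) (X : Om -> 'rV[R]_d) (X0 : set 'rV[R]_d).
Local Notation S := (law_support P X).

Lemma compact_cube_interior (A B : set 'rV[R]_d) : compact A -> A `<=` B° ->
  exists2 r : R, 0 < r & forall x, A x -> cube x r `<=` B°.
Proof.
move=> /compact_near_coveringP cA AB.
have : \forall r \near 0^'+, forall x, A x -> cube x r `<=` B°.
  apply: (cA R 0^'+ (fun r x => cube x r `<=` B°)) => x Ax.
  have /nbhs_ballP[e /= e0 eB] : nbhs x B°.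
    by apply: open_nbhs_nbhs; split; [exact: open_interior|exact: AB].
  have e2 : 0 < e / 2 by rewrite divr_gt0.
  exists (ball x (e / 2), [set r : R | r < e / 2]) => /=.
    by split; [exact: nbhsx_ballx|exact: nbhs_right_lt].
  move=> [x' r] /= [xx' re] y yx'; apply: eB.
  move: xx'; rewrite !mx_norm_ball /ball_ /= => xx'.
  rewrite -(subrKA x') (splitr e); apply: le_lt_trans (ler_normD _ _) _.
  by apply: ltrD => //; rewrite distrC (le_lt_trans yx').
move=> near_r; have [r [r0 rP]] : exists r : R, 0 < r /\ forall x, A x -> cube x r `<=` B°.
  by apply: (@filter_ex _ (0^'+)); apply: filterI => //; exact: nbhs_right_gt.
by exists r.
Qed.

(** Cubes of radius at most [r0] around the points of [X0] stay inside the
    support, where the density lies between two positive constants. *)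
Lemma design_cubes : measurable_fun setT X -> assumption_X P X X0 ->
  exists r0 fl fh : R, [/\ 0 < r0, 0 < fl, 0 < fh & forall x, X0 x ->
    cube x r0 `<=` S° /\
    forall y r, 0 <= r -> cube y r `<=` cube x r0 ->
      fl * (2 * r) ^+ d <= fine (P (X @^-1` cube y r)) <= fh * (2 * r) ^+ d].
Proof.
move=> mX [cS [f [mf f0 fE fpos [b [b0 bc _]]]] cX0 X0S].
have [r0 r00 r0P] := compact_cube_interior cX0 X0S.
have [fl [fh [fl0 flh fb]]] : exists fl fh : R, [/\ 0 < fl, fl <= fh &
    forall x, S x -> fl <= b (Defs.mzero d) x <= fh].
  apply: compact_bounds => //; last by move=> x Sx; rewrite b0//; exact: fpos.
  by apply: bc; rewrite /mdeg big1// => i _; rewrite ffunE.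
exists r0, fl, fh; split => //; first exact: lt_le_trans flh.
move=> x X0x; split; first exact: r0P.
move=> y r rge0 yx.
have inS z : cube y r z -> fl <= f z <= fh.
  move=> yz; have Sz : S z by apply: interior_subset; apply: (r0P x) => //; exact: yx.
  by rewrite -b0// fb.
have mc := measurable_cube y rge0.
have mfc : measurable_fun (cube y r) (fun x => (f x)%:E).
  by apply/measurable_EFinP; exact: measurable_funTS.
have i1 : (P (X @^-1` cube y r) <= (fh * (2 * r) ^+ d)%:E)%E.
  rewrite fE//; apply: (@le_trans _ _ (\int[lebesgue_rV R d]_(u in cube y r) (cst fh%:E u))%E).
    apply: ge0_le_integral => //=.
    - by move=> u _; rewrite lee_fin.
    - by move=> u /inS/andP[]; rewrite lee_fin.
  by rewrite integral_cst// [X in (_ * X)%E]lebesgue_cube// -EFinM.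
have i2 : ((fl * (2 * r) ^+ d)%:E <= P (X @^-1` cube y r))%E.
  rewrite fE//; apply: (@le_trans _ _ (\int[lebesgue_rV R d]_(u in cube y r) (cst fl%:E u))%E).
    by rewrite integral_cst// [X in (_ * X)%E]lebesgue_cube// -EFinM.
  apply: ge0_le_integral => //=.
  - by move=> u _; rewrite lee_fin ltW.
  - by move=> u /inS/andP[]; rewrite lee_fin.
have Pfin : P (X @^-1` cube y r) \is a fin_num.
  by rewrite fin_num_measure// -[X in measurable X]setTI; exact: mX.
by rewrite -!lee_fin fineK// i1 i2.
Qed.

End design.

(** * Local polynomial approximation of the quantile function *)

Section nondegeneracy.
Variables (R : realType) (d p : nat).
Hypothesis d_gt0 : (0 < d)%N.

(** By [coef_le_grid] a normalized polynomial cannot be small at all the nodes of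
    a grid, and it stays large around the node where it is large.  This plays the
    part of the positive definiteness of the matrix of the moments of the kernel,
    and only involves the probabilities of cubes. *)
Lemma normalized_large_on_cube : exists cc e0 : R, [/\ 0 < cc, 0 < e0 &
  forall u : {ffun mindex d p -> R}, norm1 u = 1 ->
    exists z0 : 'rV[R]_d, d%:R * (`|z0| + e0) <= 1 /\
      forall z, `|z - z0| <= e0 -> cc <= `|dotP (Ubasis p z) u|].
Proof.
have dR : 0 < d%:R :> R by rewrite ltr0n.
have d1 : 1 <= d%:R :> R by rewrite ler1n.
pose r : R := (2 * d%:R)^-1.
have r0 : 0 < r by rewrite invr_gt0 mulr_gt0.
have rE : d%:R * r = 1 / 2 by rewrite /r; field; rewrite gt_eqF.
have r1 : r <= 1 by nra.
have [C C0 HC] := @coef_le_grid R d p r r0.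
pose N : R := #|{: mindex d p}|%:R + 1.
have N0 : 0 < N by rewrite ltr_pwDr.
pose cc : R := (2 * (C * N))^-1.
have cc0 : 0 < cc by rewrite invr_gt0 !mulr_gt0.
pose c2 : R := d%:R * (3 * 2) ^+ p.
have c20 : 0 < c2 by rewrite mulr_gt0 ?exprn_gt0.
pose e0 := Num.min r (cc / c2).
have e00 : 0 < e0 by rewrite lt_min r0 divr_gt0.
have [er ec] : e0 <= r /\ e0 <= cc / c2 by split; rewrite ge_min lexx ?orbT.
exists cc, e0; split => // u u1.
have [j uj] : exists j : grid d p, 2 * cc <= `|dotP (Ubasis p (grid_point r j)) u|.
  apply/not_existsP => h.
  have uw w : `|u w| <= C * (2 * cc).
    by apply: HC => j; have /negP := h j; rewrite -ltNge => /ltW.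
  have : norm1 u <= \sum_(w : mindex d p) C * (2 * cc) by apply: ler_sum.
  rewrite u1 sumr_const -[X in _ <= X]mulr_natl => h1.
suff : #|{: mindex d p}|%:R * (C * (2 * cc)) < 1 by rewrite ltNge h1.
  have -> : C * (2 * cc) = N^-1 by rewrite /cc; field; rewrite !gt_eqF.
  by rewrite ltr_pdivrMr// mul1r ltrDl.
have gr := grid_point_norm r0 j.
exists (grid_point r j); split; first by nra.
move=> z zj.
have zb : `|z| <= 2.
  rewrite -(subrK (grid_point r j) z); apply: le_trans (ler_normD _ _) _.
  by rewrite [2](_ : _ = 1 + 1)//; apply: lerD; [apply: le_trans zj (le_trans er r1)|exact: le_trans gr r1].
have gb : `|grid_point r j| <= 2 by apply: le_trans gr (le_trans r1 _); rewrite ler1n.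
have := @dotP_lipschitz R d p u z (grid_point r j) 2 _ zb gb; rewrite u1 mulr1 ler1n => /(_ isT).
rewrite -/c2 => lip.
have c2e : c2 * `|z - grid_point r j| <= cc.
  by rewrite mulrC -ler_pdivlMr// (le_trans zj).
have := ler_normB (dotP (Ubasis p z) u) (dotP (Ubasis p z) u - dotP (Ubasis p (grid_point r j)) u).
rewrite subKr; move: lip c2e uj; lra.
Qed.

End nondegeneracy.

Section holder_expansion.
Variables (R : realType) (d p : nat) (S X0 : set 'rV[R]_d) (Q : R -> 'rV[R]_d -> R).
Variables (alo ahi L s r0 : R).
Hypothesis d_gt0 : (0 < d)%N.
Hypothesis s_gt0 : 0 < s.
Hypothesis L_gt0 : 0 < L.
Hypothesis sp : (lfloor s <= p)%N.
Hypothesis cubeS : forall x, X0 x -> cube x r0 `<=` S°.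
Hypothesis Qhold : holder_class S alo ahi Q L s.

(** The coefficients of the Taylor polynomial of the quantile function at [x],
    padded with zeros up to the order of the local polynomial. *)
Definition taylor_coefs (b : multi d -> 'rV[R]_d -> R) (x : 'rV[R]_d) :
    {ffun mindex d p -> R} :=
  [ffun w => if (mdeg (multi_of w) <= lfloor s)%N then b (multi_of w) x else 0].

Lemma dotP_taylor_coefs b x z :
  dotP (Ubasis p z) (taylor_coefs b x) = taylor p (lfloor s) (fun v => b v x) z.
Proof.
rewrite /dotP /taylor [RHS]big_mkcond; apply: eq_bigr => w _.
rewrite UbasisE [X in _ * X]ffunE; case: ifP => _; first by rewrite mulrC.
by rewrite mulr0.
Qed.

(** The Hoelder condition enters through [taylor_remainder] for the derivatives
    of order [lfloor s] only, so that the bound is uniform in the level [a] though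
    nothing bounds the derivatives of [Q a] uniformly. *)
Lemma holder_expansion b a x y r : partials_over (lfloor s) S (Q a) b ->
  (forall v, mdeg v = lfloor s -> forall x x', S x -> S x' ->
      `|b v x - b v x'| <= L * enorm (x - x') `^ (s - (lfloor s)%:R)) ->
  X0 x -> 0 < r -> r <= r0 -> cube x r y ->
  `|Q a y - dotP (Ubasis p (y - x)) (taylor_coefs b x)| <= L * (d%:R * r) `^ s.
Proof.
move=> [b0 _ bD] bH X0x rgt0 rr0 xy.
have inS z : cube x r z -> S° z.
  by move=> xz; apply: (cubeS X0x); rewrite /cube /= (le_trans xz).
have dr0 : 0 < d%:R * r by rewrite mulr_gt0// ltr0n.
have xx : cube x r x by rewrite /cube /= subrr normr0 ltW.
rewrite dotP_taylor_coefs -b0; last by apply: interior_subset; exact: inS.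
have /andP[ks _] := lfloorP s_gt0.
have E : L * (d%:R * r) `^ s =
    (d%:R * r) ^+ lfloor s * (L * (d%:R * r) `^ (s - (lfloor s)%:R)).
  rewrite mulrCA -powR_mulrn ?(ltW dr0)// -powRD ?subrKC//.
  by apply/implyP => _; rewrite gt_eqF.
rewrite E.
apply: (@taylor_remainder R d p (lfloor s) b x r) => //; first exact: ltW.
  by move=> v i z vk xz; apply: bD => //; exact: inS.
move=> v z vk xz; apply: le_trans (bH _ vk _ _ _ _) _.
- by apply: interior_subset; exact: inS.
- by apply: interior_subset; exact: inS.
rewrite ler_pM2l//; apply: ge0_ler_powR; rewrite ?nnegrE ?sqrtr_ge0 ?(ltW dr0)//.
  by rewrite subr_ge0 ltW.
by apply: le_trans (enorm_le _) _; rewrite ler_pM2l ?ltr0n.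
Qed.

End holder_expansion.

(** * Moments of the bracketing functions *)

Section bracket_measurability.
Variables (R : realType) (d p : nat) (K : 'rV[R]_d -> R) (kap CK LK Kl : R).
Hypothesis Kprops : kernel_props K kap CK LK Kl.
Implicit Types (u g : {ffun mindex d p -> R}) (x z : 'rV[R]_d).

Lemma lipschitz_continuous_rV (f : 'rV[R]_d -> R) (c : R) :
  (forall z z', `|f z - f z'| <= c * `|z - z'|) -> continuous f.
Proof.
move=> fc z; apply/(@cvgrPdist_le _ _ _ (nbhs z) (nbhs_filter z)) => e e0.
near=> z'.
have c1 : 0 < `|c| + 1 by rewrite ltr_wpDl.
apply: le_trans (fc _ _) _; apply: (@le_trans _ _ ((`|c| + 1) * `|z - z'|)).
  by rewrite ler_wpM2r// (le_trans (ler_norm c))// lerDl.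
rewrite -ler_pdivlMl// mulrC; near: z'.
apply/nbhs_ballP; exists (e / (`|c| + 1)) => /=; first by rewrite divr_gt0.
by move=> t; rewrite mx_norm_ball /ball_ /= => /ltW.
Unshelve. all: by end_near. Qed.

Let mscaled (h : R) x :
  measurable_fun setT (fun Xy : 'rV[R]_d * R => h^-1 *: (Xy.1 - x)).
Proof.
apply: measurable_fun_rV => i.
rewrite (_ : _ \o _ = fun Xy : 'rV[R]_d * R => h^-1 * (rV_coord i Xy.1 - x ord0 i)); last first.
  by apply/funext => -[X y]; rewrite /rV_coord /= !mxE.
apply: measurable_funM => //; apply: measurable_funB => //.
by apply: measurableT_comp; [exact: measurable_rV_coord|exact: measurable_fst].
Qed.

Let mcoord (h : R) x i : measurable_fun setT
  (fun Xy : 'rV[R]_d * R => (h^-1 *: (Xy.1 - x)) ord0 i).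
Proof.
have := measurableT_comp (@measurable_rV_coord R d i) (mscaled h x).
by apply: eq_measurable_fun.
Qed.

Let mpolynomial h x u : measurable_fun setT
  (fun Xy : 'rV[R]_d * R => dotP (Ubasis p (h^-1 *: (Xy.1 - x))) u).
Proof.
rewrite /dotP; apply: measurable_sum => w; apply: measurable_funM => //.
rewrite (_ : (fun _ => _) = (fun Xy : 'rV[R]_d * R =>
  mpow (h^-1 *: (Xy.1 - x)) (multi_of w) / (mfact (multi_of w))%:R)); last first.
  by apply/funext => Xy; rewrite ffunE.
apply: measurable_funM => //; apply: measurable_prod => i _.
by apply: measurable_funX; exact: mcoord.
Qed.

Let measurable_natr dT (U : measurableType dT) (f : U -> bool) :
  measurable_fun setT f -> measurable_fun setT (fun t => (f t)%:R : R).
Proof.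
move=> mf; rewrite (_ : (fun _ => _) = (fun t => if f t then 1 else 0 : R)).
  exact: measurable_fun_ifT.
by apply/funext => t; case: (f t).
Qed.

Lemma measurable_bracket B a g u h x eta :
  measurable_fun setT (bracket K kap CK LK B a g u h x eta).
Proof.
have [_ LK0 _ [_ _ KL _]] := Kprops.
have mK := continuous_measurable_rV (lipschitz_continuous_rV KL).
have mnorm := continuous_measurable_rV (@norm_continuous _ 'rV[R]_d).
rewrite /bracket; apply: measurable_fun_ifT => //.
- apply: measurable_fun_ler => //.
  exact: (measurableT_comp mnorm (mscaled h x)).
- apply: measurable_funB.
    rewrite /score; apply: measurable_funM; last exact: (measurableT_comp mK (mscaled h x)).
    apply: measurable_funM => //; apply: measurable_funB => //.
    apply: measurable_natr; apply: measurable_fun_ler => //.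
  apply: measurable_funM => //; apply: measurable_funD => //.
  apply: measurable_natr; apply: measurable_fun_ler => //.
  apply: (measurableT_comp (@normr_measurable R setT)).
  by apply: measurable_funB.
Qed.

End bracket_measurability.

Section mean_score.
Variable R : realType.

(** Moving the argument of [F] from its quantile [q] by [t * A] changes [F] by at
    least [lo * t * A] in the direction of [A]; the error [e] of the
    approximation costs at most [hi * e]. *)
Lemma mean_score_ge (F : R -> R) (lo hi M q m a t A e : R) : 0 < lo -> lo <= hi ->
  (forall y y', - M <= y -> y <= y' -> y' <= M ->
     lo * (y' - y) <= F y' - F y <= hi * (y' - y)) ->
  F q = a -> - M <= q <= M -> - M <= m <= M -> 0 <= t -> `|m - q - t * A| <= e ->
  lo * t * A ^+ 2 - hi * e * `|A| <= (F m - a) * A.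
Proof.
move=> lo0 lohi inc Fq /andP[q1 q2] /andP[m1 m2] t0 dm.
have e0 : 0 <= e by exact: le_trans dm.
move: dm; rewrite ler_norml => /andP[d1 d2].
have hi0 := lt_le_trans lo0 lohi.
have [A0|A0] := leP 0 A.
  have tA : 0 <= t * A by rewrite mulr_ge0.
  suff h : lo * (t * A) - hi * e <= F m - a.
    by rewrite (ger0_norm A0); have /= := ler_wpM2r A0 h; lra.
  have [qm|mq] := leP q m.
    have /andP[h _] := inc q m q1 qm m2; rewrite Fq in h; apply: le_trans h.
    have : lo * (t * A - e) <= lo * (m - q) by rewrite ler_pM2l//; lra.
    have : lo * e <= hi * e by rewrite ler_wpM2r.
    lra.
  have /andP[_ h] := inc m q m1 (ltW mq) q2; rewrite Fq in h.
  have : hi * (t * A - e) <= hi * (m - q) by rewrite ler_pM2l//; lra.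
  have : lo * (t * A) <= hi * (t * A) by rewrite ler_wpM2r.
  lra.
have tA : t * A <= 0 by rewrite mulr_ge0_le0// ltW.
suff h : F m - a <= lo * (t * A) + hi * e.
  by rewrite (ltr0_norm A0); have /= := ler_wnM2r (ltW A0) h; lra.
have [mq|qm] := leP m q.
  have /andP[h _] := inc m q m1 mq q2; rewrite Fq in h.
  have : lo * (- (t * A) - e) <= lo * (q - m) by rewrite ler_pM2l//; lra.
  have : lo * e <= hi * e by rewrite ler_wpM2r.
  lra.
have /andP[_ h] := inc q m q1 (ltW qm) m2; rewrite Fq in h; apply: le_trans h _.
have : hi * (m - q) <= hi * (t * A + e) by rewrite ler_pM2l//; lra.
have : hi * (t * A) <= lo * (t * A) by rewrite ler_wnM2r.
lra.
Qed.

Lemma Rintegral_two_indic dT (T : measurableType dT) (mu : {measure set T -> \bar R})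
    (A B : set T) (al be ga : R) : mu setT = 1%E -> measurable A -> measurable B ->
  \int[mu]_y (al * \1_A y + be * \1_B y + ga) =
  al * fine (mu A) + be * fine (mu B) + ga.
Proof.
move=> mu1 mA mB.
have b1 (C : set T) y : `|\1_C y : R| <= 1.
  by rewrite indicE; case: (y \in C); rewrite ?normr0 ?normr1.
have iI (C : set T) : measurable C -> mu.-integrable setT (EFin \o (\1_C : T -> R)).
  by move=> mC; apply: (bounded_integrable mu1 (C := 1)) => //; exact: measurable_indic.
have EI (C : set T) : measurable C -> \int[mu]_y \1_C y = fine (mu C).
  by move=> mC; rewrite /Rintegral integral_indic// setIT.
have i1 : mu.-integrable setT (EFin \o (fun y => al * \1_A y)).
  exact: (@integrableZl _ _ _ _ _ measurableT al _ (iI A mA)).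
have i2 : mu.-integrable setT (EFin \o (fun y => be * \1_B y)).
  exact: (@integrableZl _ _ _ _ _ measurableT be _ (iI B mB)).
rewrite (RintegralDcst mu1 (C := `|al| + `|be|)).
- rewrite RintegralD// RintegralZl//; last exact: iI.
  by rewrite RintegralZl//; [rewrite !EI|exact: iI].
- by apply: measurable_funD; apply: measurable_funM => //; exact: measurable_indic.
- move=> y; apply: le_trans (ler_normD _ _) _.
  by rewrite !normrM; apply: lerD; rewrite -[leRHS]mulr1 ler_wpM2l.
Qed.

End mean_score.

Lemma compact_abs_bound (R : realType) (T : topologicalType) (f : T -> R) (A : set T) :
  compact A -> {within A, continuous f} -> exists M : R, forall t, A t -> `|f t| <= M.
Proof.
move=> cA cf; have [->|/set0P A0] := eqVneq A set0; first by exists 0.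
have [a aA fa] := compact_EVT_min A0 cA cf.
have [b bA fb] := compact_EVT_max A0 cA cf.
exists (`|f a| + `|f b|) => t tA.
have h1 := fa t (mem_set tA); have h2 := fb t (mem_set tA).
have := ler_norm (f b); have := ler_norm (- f a); rewrite normrN.
have := normr_ge0 (f a); have := normr_ge0 (f b).
by rewrite ler_norml => ? ? ? ?; apply/andP; split; lra.
Qed.

Section conditional_means.
Variables (R : realType) (dOm : measure_display) (Om : measurableType dOm)
  (P : probability Om R) (d p : nat) (XY : {RV P >-> ('rV[R]_d * R)%type})
  (k : R.-pker 'rV[R]_d ~> R) (alo ahi : R) (X0 : set 'rV[R]_d)
  (K : 'rV[R]_d -> R) (kap CK LK Kl L s : R).
Local Notation X := (fst \o XY).
Local Notation S := (law_support P X).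
Local Notation F := (cond_cdf k).
Local Notation Q := (cond_quantile F).
Local Notation rho := (kap + 1).

Hypothesis d_gt0 : (0 < d)%N.
Hypothesis alo_gt0 : 0 < alo.
Hypothesis ahi_lt1 : ahi < 1.
Hypothesis hypX : assumption_X P X X0.
Hypothesis hypF : assumption_F S F.
Hypothesis Kprops : kernel_props K kap CK LK Kl.
Hypothesis L_gt0 : 0 < L.
Hypothesis s_gt0 : 0 < s.
Hypothesis sp : (lfloor s <= p)%N.
Hypothesis Qhold : holder_class S alo ahi Q L s.

(** The quantile functions of the two extreme levels are continuous on a compact
    set, and the others lie between them. *)
Lemma cond_quantile_bounded : exists2 M : R, 0 <= M &
  forall a x, alo <= a <= ahi -> S x -> `|Q a x| <= M.
Proof.
have cS : compact S by case: hypX.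
have bnd a : alo <= a <= ahi -> exists M : R, forall x, S x -> `|Q a x| <= M.
  move=> aa; have [b [[b0 bc _] _]] := Qhold aa.
  have [|M HM] := @compact_abs_bound R _ (b (Defs.mzero d)) S cS.
    by apply: bc; rewrite /mdeg big1// => i _; rewrite ffunE.
  by exists M => x Sx; rewrite -b0//; exact: HM.
have [aa|aa] := leP alo ahi; last first.
  by exists 0 => // a x /andP[h1 h2]; have := le_trans h1 h2; rewrite leNgt aa.
have [|M1 HM1] := bnd alo; first by rewrite lexx.
have [|M2 HM2] := bnd ahi; first by rewrite lexx aa.
exists (`|M1| + `|M2|); first by rewrite addr_ge0.
move=> a x /andP[a1 a2] Sx.
have q1 : Q alo x <= Q a x.
  by apply: (cond_quantile_mono cS hypF) => //; exact: le_lt_trans ahi_lt1.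
have q2 : Q a x <= Q ahi x.
  by apply: (cond_quantile_mono cS hypF) => //; exact: lt_le_trans a1.
have := HM1 x Sx; have := HM2 x Sx; rewrite !ler_norml => /andP[? ?] /andP[? ?].
have := ler_norm M1; have := ler_norm M2; have := normr_ge0 M1; have := normr_ge0 M2.
by move=> ? ? ? ?; apply/andP; split; lra.
Qed.

Let kap1 : 1 <= kap. Proof. by case: Kprops. Qed.

Lemma powR_small (h : R) : 0 < h -> h <= 1 -> 0 < h `^ s <= 1.
Proof.
move=> h0 h1; rewrite powR_gt0//=.
rewrite (_ : 1 = 1 `^ s); last by rewrite powR1.
apply: ge0_ler_powR; rewrite ?nnegrE//; exact: ltW.
Qed.

Variable r0 : R.
Hypothesis cubeS : forall x, X0 x -> cube x r0 `<=` S°.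

(** The derivatives at a point of [X0], as coefficients: these are the target of
    the estimator, and [CT] is uniform in the level and the location. *)
Lemma local_polynomial : exists bs : R -> 'rV[R]_d -> {ffun mindex d p -> R},
  exists2 CT : R, 0 <= CT & forall a x, alo <= a <= ahi -> X0 x ->
    (forall w : mindex d p, (mdeg (multi_of w) <= lfloor s)%N ->
       bs a x w = partial (multi_of w) (Q a) x) /\
    (forall (h : R) y, 0 < h -> rho * h <= r0 -> cube x (rho * h) y ->
       `|Q a y - dotP (Ubasis p (y - x)) (bs a x)| <= CT * h `^ s).
Proof.
have k1 := kap1.
pose bs a x : {ffun mindex d p -> R} := if pselect (alo <= a <= ahi) is left aa
  then taylor_coefs p s (projT1 (cid (Qhold aa))) x else [ffun=> 0].
have X0S : X0 `<=` S° by case: hypX.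
have dr0 : 0 < d%:R * rho by rewrite mulr_gt0 ?ltr0n//; lra.
exists bs, (L * (d%:R * rho) `^ s); first by rewrite mulr_ge0// ?powR_ge0// ltW.
move=> a x aa X0x; rewrite /bs; case: pselect => // aa'.
case: (cid _) => b [bP bH] /=; split.
  by move=> w wk; rewrite ffunE wk -(partials_overE bP wk)//; exact: X0S.
move=> h y h0 hr xy; rewrite -mulrA -powRM ?(ltW dr0) ?(ltW h0)// -mulrA.
apply: (holder_expansion d_gt0 s_gt0 L_gt0 sp cubeS bP) => //.
by rewrite mulr_gt0//; lra.
Qed.

Variables (bs : R -> 'rV[R]_d -> {ffun mindex d p -> R}) (CT : R).
Hypothesis CT_ge0 : 0 <= CT.
Hypothesis bsP : forall a x, alo <= a <= ahi -> X0 x ->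
  forall (h : R) y, 0 < h -> rho * h <= r0 -> cube x (rho * h) y ->
    `|Q a y - dotP (Ubasis p (y - x)) (bs a x)| <= CT * h `^ s.

Lemma cube_scaled (x z : 'rV[R]_d) (h r : R) : 0 < h -> `|z| <= r -> cube x (r * h) (x + h *: z).
Proof.
by move=> h0 zr; rewrite /cube /= addrAC subrr add0r normrZ gtr0_norm// mulrC ler_pM2r.
Qed.

(** The derivatives of the quantile functions need not be bounded uniformly in
    the level, but the rescaled polynomial is close to the quantile function on
    the window, hence bounded there, and [coef_le_grid] bounds its coefficients.
    This confines the parameters to a set with a polynomial net. *)
Lemma scaled_coefs_bounded : exists2 B : R, 0 <= B &
  forall a x (h t : R) u, alo <= a <= ahi -> X0 x -> 0 < h -> h <= 1 -> rho * h <= r0 ->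
    0 <= t <= 1 -> norm1 u = 1 -> norm1 (shifted t (rescale h (bs a x)) u) <= B.
Proof.
have k1 := kap1; have CT0 := CT_ge0.
have [MQ MQ0 HQ] := cond_quantile_bounded.
have [C C0 HC] := @coef_le_grid R d p 1 ltr01.
pose N : R := #|{: mindex d p}|%:R.
exists (N * (C * (MQ + CT)) + 1); first by rewrite addr_ge0// !(mulr_ge0, addr_ge0)// ltW.
move=> a x h t u aa X0x h0 h1 hr /andP[t0 t1] u1.
have cw w : `|rescale h (bs a x) w| <= C * (MQ + CT).
  apply: HC => z; rewrite dotP_rescale.
  set y := x + h *: grid_point 1 z.
  have yE : h *: grid_point 1 z = y - x by rewrite /y addrAC subrr add0r.
  have xy : cube x (rho * h) y.
    apply: cube_scaled => //; apply: le_trans (grid_point_norm ltr01 z) _; lra.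
  have Sy : S y.
    apply: interior_subset; apply: (cubeS X0x); rewrite /cube /=; exact: le_trans hr.
  rewrite yE; have hq := HQ _ _ aa Sy; have hT := bsP aa X0x h0 hr xy.
  have /andP[_ hs1] := powR_small h0 h1.
  have hT' : CT * h `^ s <= CT by rewrite -[leRHS]mulr1 ler_wpM2l.
  set T := dotP _ _ in hT *; rewrite -(subKr (Q a y) T).
  by apply: le_trans (ler_normB _ _) _; apply: lerD => //; exact: le_trans hT'.
rewrite /norm1; apply: (@le_trans _ _ (\sum_w (C * (MQ + CT) + t * `|u w|))).
  apply: ler_sum => w _; rewrite ffunE; apply: le_trans (ler_normD _ _) _.
  by rewrite normrM (ger0_norm t0) lerD.
rewrite big_split /= sumr_const -[X in X + _]mulr_natl -mulr_sumr.
by rewrite -/(norm1 u) u1 mulr1 lerD.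
Qed.

Variables (B Cs M lo hi : R).
Local Notation c1 := (rho ^+ p).
Hypothesis CsE : Cs = score_cst d p kap CK LK B.
Hypothesis B_ge0 : 0 <= B.
Hypothesis lo_gt0 : 0 < lo.
Hypothesis lohi : lo <= hi.
Hypothesis inc : forall x y y', S x -> - M <= y -> y <= y' -> y' <= M ->
  lo * (y' - y) <= F y' x - F y x <= hi * (y' - y).
Variable MQ : R.
Hypothesis QM : forall a x, alo <= a <= ahi -> S x -> `|Q a x| <= MQ.
Hypothesis M_large : MQ + CT + c1 + 2 * Cs <= M.

(** Given the covariate, the mean of the score is of order [t] by
    [mean_score_ge], up to the bias [h `^ s] of the polynomial approximation; the
    correction of the bracket has mean of order [eta], the conditional
    distribution function being Lipschitz. *)
Lemma conditional_mean_bracket a x (h t : R) u eta xi z g :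
  alo <= a <= ahi -> X0 x -> 0 < h -> h <= 1 -> rho * h <= r0 -> 0 <= t <= 1 ->
  norm1 u = 1 -> 0 < eta <= 1 -> `|z| <= rho ->
  z = h^-1 *: (xi - x) -> g = shifted t (rescale h (bs a x)) u ->
  lo * t * dotP (Ubasis p z) u ^+ 2 * K z -
    (hi * CT * c1 * CK + Cs * (3 * hi * Cs + 1)) * (h `^ s + eta)
  <= \int[k xi]_y bracket K kap CK LK B a g u h x eta (xi, y).
Proof.
move=> aa X0x h0 h1 hr /andP[t0 t1] u1 /andP[e0 e1] zr zE gE.
have [_ LK0 _ [_ Kb _ _]] := Kprops.
have k1 := kap1; have CT0 := CT_ge0; have Ml := M_large.
have cS : compact S by case: hypX.
have Cs1 : 1 <= Cs by rewrite CsE; apply: (score_cst_ge1 p Kprops).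
have hi0 := lt_le_trans lo_gt0 lohi.
have xiE : h *: z = xi - x by rewrite zE scalerA mulfV ?scale1r// gt_eqF.
have xxi : cube x (rho * h) xi.
  rewrite (_ : xi = x + h *: z); first exact: cube_scaled.
  by rewrite xiE addrC subrK.
have Sxi : S xi.
  apply: interior_subset; apply: (cubeS X0x); rewrite /cube /=; exact: le_trans hr.
set A := dotP (Ubasis p z) u; set m := dotP (Ubasis p z) g.
set T := dotP (Ubasis p (xi - x)) (bs a x).
have mE : m = T + t * A by rewrite /m gE dotP_shifted dotP_rescale xiE.
have hq := QM aa Sxi; have hT : `|Q a xi - T| <= CT * h `^ s := bsP aa X0x h0 hr xxi.
have /andP[hs0 hs1] := powR_small h0 h1.
have hT' : CT * h `^ s <= CT by rewrite -[leRHS]mulr1 ler_wpM2l.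
have Ab : `|A| <= c1.
  apply: le_trans (dotP_bound _ _ zr) _; first by rewrite lerDr; lra.
  by rewrite u1 mulr1.
have tAb : `|t * A| <= c1.
  by rewrite normrM (ger0_norm t0) -[leRHS]mul1r ler_pM.
have [K0 KC] := andP (Kb z).
have Fq : F (Q a xi) xi = a.
  apply: (cond_quantileE cS hypF) => //; have /andP[a1 a2] := aa.
  by rewrite (lt_le_trans alo_gt0 a1) (le_lt_trans a2).
set dl := Cs * eta.
have dl0 : 0 < dl by rewrite mulr_gt0//; lra.
have dl1 : dl <= Cs by rewrite -[leRHS]mulr1 ler_pM2l//; lra.
have bm : - (MQ + CT + c1) <= m <= MQ + CT + c1.
  move: hq hT tAb; rewrite mE !ler_norml => /andP[? ?] /andP[? ?] /andP[? ?].
  by apply/andP; split; lra.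
have bq : - M <= Q a xi <= M.
  move: hq; have := exprn_ge0 p (_ : 0 <= rho); rewrite ler_norml => /(_ _) c10 /andP[? ?].
  have {}c10 : 0 <= c1 by apply: c10; lra.
  by apply/andP; split; lra.
have mean := @mean_score_ge R (F ^~ xi) lo hi M (Q a xi) m a t A (CT * h `^ s)
  lo_gt0 lohi (fun y y' => inc Sxi) Fq bq.
have {}mean : lo * t * A ^+ 2 - hi * (CT * h `^ s) * `|A| <= (F m xi - a) * A.
  apply: mean => //; first by move: bm => /andP[? ?]; apply/andP; split; lra.
  by rewrite mE -[X in `|X|]opprK normrN; have -> : - (T + t * A - Q a xi - t * A) = Q a xi - T by ring.
have kint : fine (k xi `[m - dl, m + dl]%classic) <= 3 * hi * dl.
  have /andP[_ h3] := @inc xi (m - 2 * dl) (m + dl) Sxi ltac:(move: bm => /andP[? ?]; lra)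
    ltac:(lra) ltac:(move: bm => /andP[? ?]; lra).
  apply: (@le_trans _ _ (F (m + dl) xi - F (m - 2 * dl) xi)); last by lra.
  rewrite -lee_fin fineK; last first.
    by rewrite ge0_fin_numE// (le_lt_trans _ (ltry 1))// -(@prob_kernel _ _ _ _ _ k xi) le_measure ?inE.
  rewrite -(@cond_cdf_itv _ _ k); last lra.
  apply: le_measure; rewrite ?inE//; move=> y /=; rewrite !in_itv /= => /andP[y1 ->].
  by rewrite andbT; lra.
have -> : (fun y => bracket K kap CK LK B a g u h x eta (xi, y)) =
    (fun y => (A * K z) * \1_(`]-oo, m]%classic) y + (- Cs) * \1_(`[m - dl, m + dl]%classic) y
      + (- (a * A * K z) - Cs * eta)).
  apply/funext => y; rewrite /bracket /= -zE zr -CsE /score -/A -/m -/dl.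
  rewrite !indicE; have -> : (y \in (`]-oo, m]%classic : set R)) = (y <= m).
    by apply/idP/idP; rewrite inE /= in_itv.
  have -> : (y \in (`[m - dl, m + dl]%classic : set R)) = (`|y - m| <= dl).
    by rewrite ler_distl; apply/idP/idP; rewrite inE /= in_itv.
  rewrite [X in _ = _ + (_ - X)](_ : _ = Cs * eta)//; ring.
rewrite (Rintegral_two_indic _ _ _ (@prob_kernel _ _ _ _ _ k xi))//.
rewrite -/(F m xi).
have h4 : Cs * fine (k xi `[m - dl, m + dl]%classic) <= Cs * (3 * hi * dl).
  by rewrite ler_pM2l//; lra.
have h5 := ler_wpM2r K0 mean.
have h6 : hi * (CT * h `^ s) * `|A| * K z <= hi * (CT * h `^ s) * c1 * CK.
  have h7 : 0 <= hi * (CT * h `^ s) by rewrite mulr_ge0 ?mulr_ge0 ?(ltW hi0) ?(ltW hs0).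
  apply: ler_pM => //; first by rewrite mulr_ge0.
  by rewrite ler_wpM2l.
have h8 : 0 <= hi * CT * c1 * CK * eta.
  by rewrite !mulr_ge0 ?exprn_ge0 ?(ltW hi0) ?(ltW e0)//; [lra|exact: le_trans KC].
have h9 : 0 <= Cs * (3 * hi * Cs + 1) * h `^ s.
  have Cs0 : 0 <= Cs by exact: le_trans Cs1.
  apply: mulr_ge0; last exact: ltW.
  by apply: mulr_ge0 => //; apply: addr_ge0 => //; rewrite !mulr_ge0// ltW.
rewrite /dl in h4 *.
move: h4 h5 h6 h8 h9; lra.
Qed.

End conditional_means.

Lemma cube_rescale (R : realType) (d : nat) (x z0 xi : 'rV[R]_d) (h r : R) : 0 < h ->
  cube (x + h *: z0) (h * r) xi = (`|h^-1 *: (xi - x) - z0| <= r) :> Prop.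
Proof.
move=> h0; rewrite /cube /=; congr is_true.
have -> : xi - (x + h *: z0) = h *: (h^-1 *: (xi - x) - z0).
  by rewrite scalerBr scalerA mulfV ?gt_eqF// scale1r opprD addrA.
by rewrite normrZ gtr0_norm// ler_pM2l.
Qed.

Section bracket_bounds.
Variables (R : realType) (d p : nat) (K : 'rV[R]_d -> R) (kap CK LK Kl : R).
Hypothesis Kprops : kernel_props K kap CK LK Kl.
Local Notation rho := (kap + 1).

Lemma bracket_bound (B a h eta : R) (g u : {ffun mindex d p -> R}) x Xy :
  0 <= B -> 0 <= a <= 1 -> norm1 u <= 1 -> 0 <= eta <= 1 ->
  `|bracket K kap CK LK B a g u h x eta Xy| <=
     (rho ^+ p * CK + 2 * score_cst d p kap CK LK B) *
     (`|h^-1 *: (Xy.1 - x)| <= rho)%R%:R.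
Proof.
move=> B0 a01 u1 /andP[e0 e1]; rewrite /bracket; case: ifP => zr; last by rewrite normr0 mulr0.
rewrite mulr1; apply: le_trans (ler_normB _ _) _; apply: lerD.
  exact: (score_bound Kprops).
have Cs0 : 0 <= score_cst d p kap CK LK B.
  by apply: le_trans (score_cst_ge1 p Kprops B0).
rewrite normrM (ger0_norm Cs0) mulrC ler_wpM2r// ger0_norm ?addr_ge0//.
by case: (`|_| <= _); rewrite ?mulr1n ?mulr0n; lra.
Qed.

End bracket_bounds.

Section bracket_moments.
Variables (R : realType) (dOm : measure_display) (Om : measurableType dOm)
  (P : probability Om R) (d p : nat) (XY : {RV P >-> ('rV[R]_d * R)%type})
  (k : R.-pker 'rV[R]_d ~> R) (alo ahi : R) (X0 : set 'rV[R]_d)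
  (K : 'rV[R]_d -> R) (kap CK LK Kl L s : R).
Local Notation X := (fst \o XY).
Local Notation Y := (snd \o XY).
Local Notation S := (law_support P X).
Local Notation F := (cond_cdf k).
Local Notation Q := (cond_quantile F).
Local Notation rho := (kap + 1).

(** The conditional bounds are integrated over the window.  For the main term,
    the squared direction is large on a cube of size comparable to the window by
    [normalized_large_on_cube]; the other terms and the second moment are at most
    a constant times the probability of the window, of order [h ^+ d]. *)
Lemma bracket_moments : (0 < d)%N -> cond_distribution P X Y k ->
  0 < alo -> ahi < 1 -> assumption_X P X X0 -> assumption_F S F ->
  kernel_props K kap CK LK Kl -> 0 < L -> 0 < s -> (lfloor s <= p)%N ->
  holder_class S alo ahi Q L s ->
  exists (bs : R -> 'rV[R]_d -> {ffun mindex d p -> R}) (B c C hs : R),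
  [/\ 0 <= B, 0 < c, 0 < C & 0 < hs <= 1] /\
  forall a x, alo <= a <= ahi -> X0 x ->
    (forall w : mindex d p, (mdeg (multi_of w) <= lfloor s)%N ->
       bs a x w = partial (multi_of w) (Q a) x) /\
    forall (h t eta : R) u, 0 < h -> h <= hs -> 0 <= t <= 1 -> norm1 u = 1 -> 0 < eta <= 1 ->
    let g := shifted t (rescale h (bs a x)) u in
    let W := bracket K kap CK LK B a g u h x eta in
    [/\ norm1 g <= B, forall Xy, `|W Xy| <= C, measurable_fun setT W,
        h ^+ d * (c * t - C * (h `^ s + eta)) <= \int[P]_w W (XY w) &
        \int[P]_w (W (XY w) ^+ 2) <= C * h ^+ d].
Proof.
move=> d_gt0 kP alo_gt0 ahi_lt1 hypX hypF Kprops L_gt0 s_gt0 sp Qhold.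
have mX : measurable_fun setT X by apply: measurableT_comp => //; exact: measurable_fst.
have mY : measurable_fun setT Y by apply: measurableT_comp => //; exact: measurable_snd.
have P1 : P setT = 1%E := @probability_setT _ _ _ P.
have cS : compact S by case: hypX.
have [kap1 LK0 Kl0 [_ Kb _ KlK]] := Kprops.
have CK0 : 0 <= CK by have /andP[h1 h2] := Kb 0; exact: le_trans h2.
have [r0 [fl [fh [r00 fl0 fh0 cubes]]]] := design_cubes mX hypX.
have cubeS x : X0 x -> cube x r0 `<=` S° by case/cubes.
have [bs [CT CT0 bsP]] :=
  local_polynomial d_gt0 hypX Kprops L_gt0 s_gt0 sp Qhold cubeS.
have bsP2 a x aa X0x := (bsP a x aa X0x).2.
have [B B0 HB] :=
  scaled_coefs_bounded alo_gt0 ahi_lt1 hypX hypF Kprops s_gt0 Qhold cubeS CT0 bsP2.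
have [MQ MQ0 HQ] := cond_quantile_bounded alo_gt0 ahi_lt1 hypX hypF Qhold.
have [Cs CsE] : exists Cs, Cs = score_cst d p kap CK LK B by eexists.
have Cs1 : 1 <= Cs by rewrite CsE; exact: (score_cst_ge1 p Kprops).
pose M := MQ + CT + rho ^+ p + 2 * Cs.
have [lo [hi [lo0 lohi inc]]] := cond_cdf_increments cS hypF M.
have hi0 := lt_le_trans lo0 lohi.
have [cc [e0 [cc0 e00 Hcc]]] := @normalized_large_on_cube R d p d_gt0.
have rho1 : 1 <= rho by lra.
have rho0 : 0 < rho by lra.
have r1p : 0 <= rho ^+ p by rewrite exprn_ge0// ltW.
pose Cpsi := hi * CT * rho ^+ p * CK + Cs * (3 * hi * Cs + 1).
have Cpsi0 : 0 <= Cpsi.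
  have Cs0 : 0 <= Cs by exact: le_trans Cs1.
  by rewrite /Cpsi !(addr_ge0, mulr_ge0)// ltW.
pose Cb := rho ^+ p * CK + 2 * Cs.
have Cb0 : 0 < Cb by rewrite /Cb ltr_wpDl// ?mulr_ge0// mulr_gt0//; lra.
pose c := lo * cc ^+ 2 * Kl * (fl * (2 * e0) ^+ d).
have c0 : 0 < c by rewrite !mulr_gt0// ?exprn_gt0// mulr_gt0.
pose V := fh * (2 * rho) ^+ d.
have V0 : 0 < V by rewrite mulr_gt0// exprn_gt0// mulr_gt0.
pose C := Cpsi * V + Cb + Cb ^+ 2 * V.
have w1 : 0 <= Cpsi * V by rewrite mulr_ge0// ltW.
have w3 : 0 <= Cb ^+ 2 * V by rewrite mulr_ge0 ?sqr_ge0// ltW.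
have C1 : Cpsi * V <= C by rewrite /C -addrA lerDl addr_ge0// ltW.
have C2 : Cb <= C by rewrite /C addrAC lerDr addr_ge0.
have C3 : Cb ^+ 2 * V <= C by rewrite /C lerDr addr_ge0// ltW.
have C0 : 0 < C by exact: lt_le_trans C2.
pose hs := Num.min 1 (r0 / rho).
exists bs, B, c, C, hs; split.
  by split => //; rewrite lt_min ltr01 divr_gt0//= ge_min lexx.
move=> a x aa X0x; split; first exact: (bsP a x aa X0x).1.
move=> h t eta u h0 hhs t01 u1 eta01 /=.
set g := shifted _ _ _; set W := bracket _ _ _ _ _ _ _ _ _ _ _.
have [h1 hr] : h <= 1 /\ rho * h <= r0.
  move: hhs; rewrite /hs le_min => /andP[-> h2]; split => //.
  by rewrite mulrC -ler_pdivlMr.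
have a01 : 0 <= a <= 1.
  by have /andP[a1 a2] := aa; rewrite (le_trans (ltW alo_gt0) a1) (le_trans a2 (ltW ahi_lt1)).
have /andP[t0 t1] := t01; have /andP[eta0 eta1] := eta01.
have gB : norm1 g <= B by exact: HB.
have Wb Xy : `|W Xy| <= Cb * (`|h^-1 *: (Xy.1 - x)| <= rho)%R%:R.
  by rewrite /Cb CsE; apply: (bracket_bound Kprops); rewrite ?u1 ?(ltW eta0).
have WCb Xy : `|W Xy| <= Cb.
  apply: le_trans (Wb Xy) _; rewrite -[leRHS]mulr1 ler_pM2l//.
  by case: (`|_| <= _).
have mW : measurable_fun setT W by exact: (measurable_bracket Kprops).
have [z0 [z0d Hz0]] := Hcc u u1.
pose big := cube x (rho * h).
pose small := cube (x + h *: z0) (h * e0).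
have bigE xi : big xi = (`|h^-1 *: (xi - x)| <= rho) :> Prop.
  have := @cube_rescale R d x 0 xi h rho h0.
  by rewrite scaler0 addr0 subr0 mulrC.
have smallE xi : small xi = (`|h^-1 *: (xi - x) - z0| <= e0) :> Prop.
  exact: cube_rescale.
have small_big xi : small xi -> big xi.
  rewrite bigE smallE => zz.
  rewrite -(subrK z0 (_ *: _)); apply: le_trans (ler_normD _ _) _.
  have dR : 1 <= d%:R :> R by rewrite ler1n.
  have := ler_wpM2r (_ : 0 <= `|z0| + e0) dR; rewrite mul1r => h2.
  apply: le_trans (lerD zz (lexx _)) _; rewrite addrC.
  by apply: le_trans (h2 _) (le_trans z0d rho1); rewrite addr_ge0// ltW.
have mbig : measurable big by apply: measurable_cube; rewrite mulr_ge0// ltW.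
have msmall : measurable small by apply: measurable_cube; rewrite mulr_ge0// ltW.
have big_r0 : big `<=` cube x r0.
  by move=> xi; rewrite /big /cube /= => h2; exact: le_trans hr.
have Pbig : fine (P (X @^-1` big)) <= V * h ^+ d.
  have /andP[_ h2] := (cubes x X0x).2 x (rho * h) ltac:(by rewrite mulr_ge0// ltW) big_r0.
  by apply: le_trans h2 _; rewrite /V mulrA exprMn mulrA.
have Psmall : fl * (2 * e0) ^+ d * h ^+ d <= fine (P (X @^-1` small)).
  have /andP[h2 _] := (cubes x X0x).2 (x + h *: z0) (h * e0) ltac:(by rewrite mulr_ge0// ltW)
    (fun xi sm => big_r0 xi (small_big xi sm)).
  apply: le_trans h2; rewrite (_ : 2 * (h * e0) = 2 * e0 * h); last by ring.
  by rewrite [(2 * e0 * h) ^+ d]exprMn mulrA.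
have mPX A : measurable A -> measurable (X @^-1` A).
  by move=> mA; rewrite -[X in measurable X]setTI; exact: mX.
have /andP[hs0 hs1] := powR_small s_gt0 h0 h1.
split => //.
- by move=> Xy; exact: le_trans (WCb Xy) C2.
- pose be := Cpsi * (h `^ s + eta); pose al := lo * t * cc ^+ 2 * Kl.
  have al0 : 0 <= al by rewrite !mulr_ge0 ?exprn_ge0// ltW.
  have be0 : 0 <= be by rewrite mulr_ge0// addr_ge0// ltW.
  pose psi xi : R := al * \1_small xi + (- be) * \1_big xi + 0.
  have psib xi : `|psi xi| <= Cb + al + be.
    rewrite /psi addr0; apply: le_trans (ler_normD _ _) _.
    rewrite [`|al * _|]normrM [`|- be * _|]normrM normrN (ger0_norm al0) (ger0_norm be0).
    have i1 (A : set 'rV[R]_d) y : `|\1_A y : R| <= 1.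
      by rewrite indicE; case: (y \in A); rewrite ?normr0 ?normr1.
    apply: le_trans (lerD (ler_wpM2l al0 (i1 small xi)) (ler_wpM2l be0 (i1 big xi))) _.
    by rewrite !mulr1 -addrA lerDr ltW.
  have mpsi : measurable_fun setT psi.
    by apply: measurable_funD => //; apply: measurable_funD; apply: measurable_funM => //;
      exact: measurable_indic.
  have le_cond xi : psi xi <= \int[k xi]_y W (xi, y).
    have [zr|zr] := leP `|h^-1 *: (xi - x)| rho; last first.
      have nb : ~ big xi by rewrite bigE leNgt zr.
      have ns : ~ small xi by move/small_big.
      rewrite /psi !indicE !memNset// !mulr0 !addr0.
      rewrite (_ : (fun y => W (xi, y)) = (fun=> 0)); first by rewrite Rintegral_cst1//; exact: prob_kernel.
      by apply/funext => y; rewrite /W /bracket /= leNgt zr.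
    apply: le_trans (conditional_mean_bracket alo_gt0 ahi_lt1 hypX hypF Kprops s_gt0 cubeS
      CT0 bsP2 CsE B0 lo0 lohi inc HQ (lexx _) aa X0x h0 h1 hr t01 u1 eta01 zr erefl erefl).
    set z := h^-1 *: (xi - x).
    have E1 : \1_big xi = 1 :> R by rewrite indicE mem_set// bigE.
    rewrite /psi E1 indicE mulr1 addr0 -/Cpsi -/be lerD2r.
    have rhs0 : 0 <= lo * t * dotP (Ubasis p z) u ^+ 2 * K z.
      have /andP[K0 _] := Kb z; apply: mulr_ge0 => //.
      by apply: mulr_ge0 (sqr_ge0 _); rewrite mulr_ge0// ltW.
    case: (pselect (small xi)) => sm; last by rewrite memNset// mulr0.
    rewrite mem_set// mulr1 /al; move: sm; rewrite smallE -/z => zz.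
    have Acc := Hz0 _ zz.
    have KK : Kl <= K z.
      apply: KlK; apply: le_trans z0d; rewrite ler_pM2l ?ltr0n//.
      rewrite -(subrK z0 z) addrC [leRHS]addrC; apply: le_trans (ler_normD _ _) _.
      by rewrite addrC lerD.
    apply: ler_pM => //; [by rewrite !mulr_ge0 ?exprn_ge0// ltW|exact: ltW|].
    rewrite ler_wpM2l ?mulr_ge0// ?(ltW lo0)//.
    rewrite -[leRHS]real_normK ?num_real// lerXn2r ?nnegrE//; exact: ltW.
  have WCb' Xy : `|W Xy| <= Cb + al + be.
    by apply: le_trans (WCb Xy) _; rewrite -addrA lerDl addr_ge0.
  have := @le_expectation_cond _ _ _ P _ _ _ _ X Y k mX mY kP W psi (Cb + al + be) mW mpsi
    WCb' psib le_cond.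
  rewrite (_ : (fun w => W (X w, Y w)) = (fun w => W (XY w))); last first.
    by apply/funext => w /=; rewrite -surjective_pairing.
  apply: le_trans.
  have -> : (fun w => psi (X w)) =
     (fun w => al * \1_(X @^-1` small) w + (- be) * \1_(X @^-1` big) w + 0).
    by apply/funext => w; rewrite /psi !indicE.
  rewrite (Rintegral_two_indic _ _ _ P1 (mPX _ msmall) (mPX _ mbig)) addr0.
  have h2 := ler_wpM2l al0 Psmall; have h3 := ler_wpM2l be0 Pbig.
  have h4 : be * (V * h ^+ d) <= C * (h `^ s + eta) * h ^+ d.
    rewrite /be mulrA; apply: ler_wpM2r; first by rewrite exprn_ge0// ltW.
    by rewrite mulrAC ler_wpM2r// addr_ge0// ltW.
  have h5 : al * (fl * (2 * e0) ^+ d * h ^+ d) = h ^+ d * (c * t).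
    by rewrite /al /c; ring.
  move: h2 h3 h4; rewrite h5 mulNr; lra.
- apply: (@le_trans _ _ (\int[P]_w (0 * \1_(X @^-1` big) w + Cb ^+ 2 * \1_(X @^-1` big) w + 0))).
    apply: le_Rintegral => //.
    + apply: (bounded_integrable P1 (C := Cb ^+ 2)).
        by apply: measurable_funX; exact: measurableT_comp.
      by move=> w; rewrite normrX lerXn2r ?nnegrE// ltW.
    + apply: (bounded_integrable P1 (C := Cb ^+ 2)).
        by apply: measurable_funD => //; apply: measurable_funD; apply: measurable_funM => //;
          apply: measurable_indic; exact: mPX.
      move=> w; rewrite mul0r add0r addr0 indicE normrM ger0_norm ?sqr_ge0//.
      by case: (_ \in _); rewrite ?normr1 ?normr0 ?mulr1 ?mulr0// sqr_ge0.
    + move=> w _; rewrite mul0r add0r addr0 indicE.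
      rewrite -[W _ ^+ 2]real_normK ?num_real//.
      have := Wb (XY w); case: (pselect (big (X w))) => bw.
        by rewrite mem_set// mulr1 => h2; rewrite lerXn2r ?nnegrE ?(ltW Cb0).
      rewrite memNset// mulr0 => h2.
      move: bw h2; rewrite bigE /= => /negP/negPf ->; rewrite mulr0 => h2.
      by rewrite (_ : `|_| = 0) ?expr0n//; apply/eqP; rewrite eq_le h2 normr_ge0.
  rewrite (Rintegral_two_indic _ _ _ P1 (mPX _ mbig) (mPX _ mbig)) mul0r add0r addr0.
  apply: (@le_trans _ _ (Cb ^+ 2 * (V * h ^+ d))); first by rewrite ler_wpM2l// sqr_ge0.
  by rewrite mulrA ler_wpM2r// exprn_ge0// ltW.
Qed.

End bracket_moments.

(** * Uniform deviation and rate of convergence *)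

Lemma finite_union_bound d0 (Om : measurableType d0) (R : realType)
    (P : probability Om R) (I : eqType) (D : I -> set Om) (b : R) (r : seq I) :
  (forall z, measurable (D z) /\ (P (D z) <= b%:E)%E) ->
  measurable (\bigcup_(z in [set` r]) D z) /\
  (P (\bigcup_(z in [set` r]) D z) <= ((size r)%:R * b)%:E)%E.
Proof.
move=> Db; elim: r => [|z r [mr Pr]].
  rewrite (_ : [set` [::]] = set0); last by apply/seteqP; split.
  by rewrite bigcup_set0 measure0 mul0r; split; [exact: measurable0|].
rewrite (_ : [set` z :: r] = z |` [set` r]); last first.
  apply/seteqP; split => y /=; rewrite inE; first by case/orP => [/eqP|]; [left|right].
  by case=> [->|yr]; rewrite ?eqxx ?yr ?orbT.
have [mz Pz] := Db z.
rewrite bigcup_setU1; split; first exact: measurableU.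
apply: le_trans (measureU2 _ mz mr) _.
by rewrite /= -natr1 mulrDl mul1r addrC EFinD leeD.
Qed.

Section uniform_deviation.
Variables (R : realType) (dOm : measure_display) (Om : measurableType dOm)
  (P : probability Om R) (d p : nat) (XY : {RV P >-> ('rV[R]_d * R)%type})
  (Z : nat -> {RV P >-> ('rV[R]_d * R)%type}).
Variables (alo ahi : R) (X0 : set 'rV[R]_d) (K : 'rV[R]_d -> R) (kap CK LK Kl s : R).
Variables (bs : R -> 'rV[R]_d -> {ffun mindex d p -> R}) (B c C hs : R).
Hypothesis iidZ : iid_copies P Z XY.
Hypothesis alo_gt0 : 0 < alo.
Hypothesis ahi_lt1 : ahi < 1.
Hypothesis s_gt0 : 0 < s.
Hypothesis Kprops : kernel_props K kap CK LK Kl.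
Hypothesis B_ge0 : 0 <= B.
Hypothesis C_gt0 : 0 < C.
Hypothesis hs_le1 : hs <= 1.
Hypothesis moments : forall a x, alo <= a <= ahi -> X0 x ->
  forall (h t eta : R) u, 0 < h -> h <= hs -> 0 <= t <= 1 -> norm1 u = 1 -> 0 < eta <= 1 ->
    let g := shifted t (rescale h (bs a x)) u in
    let W := bracket K kap CK LK B a g u h x eta in
    [/\ norm1 g <= B, forall Xy, `|W Xy| <= C, measurable_fun setT W,
        h ^+ d * (c * t - C * (h `^ s + eta)) <= \int[P]_w W (XY w) &
        \int[P]_w (W (XY w) ^+ 2) <= C * h ^+ d].

(** A level, a location, a bandwidth and a direction.  The coordinates in which
    the net is taken are those in which the bracketing is Lipschitz; they include
    the inverse bandwidth and the coefficients of the local polynomial, although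
    these are functions of the other ones. *)
Let param : Type := R * 'rV[R]_d * R * {ffun mindex d p -> R}.
Let coord : finType := (bool + 'I_d + (mindex d p + mindex d p))%type.

Let poly_of (t : R) (q : param) : {ffun mindex d p -> R} :=
  let: (a, x, h, u) := q in shifted t (rescale h (bs a x)) u.

Let crd (t : R) (q : param) (j : coord) : R :=
  let: (a, x, h, u) := q in
  match j with
  | inl (inl b) => if b then a else h^-1
  | inl (inr i) => x ord0 i
  | inr (inl w) => u w
  | inr (inr w) => poly_of t q w
  end.

Definition net_dim : nat := #|{: coord}|.

Variables (M1 M2 M rX : R).
Hypothesis M1_gt0 : 0 < M1.
Hypothesis M2_gt0 : 0 < M2.
Hypothesis M_gt0 : 0 < M.
Hypothesis X0_bounded : forall x, X0 x -> `|x| <= rX.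
Hypothesis M_large : (7 * net_dim + 1)%:R * M2 ^+ d + C * (M1 `^ s + 3) <= c * M.

(** At the centre of a cell, [chernoff_iid] with [l] = [rho] bounds the
    probability that the sum of the brackets is nonpositive by a power of 1 / n,
    whose exponent grows linearly with [M].  There are at most
    n ^ (7 * net_dim) cells, and [M_large] makes the sum over the cells at most
    1 / n.  In each cell the bracket of the centre bounds all the scores. *)
Lemma uniform_score_positive (n : nat) (h rho : R) :
  0 < h -> h <= 1 -> M1 * h <= hs -> (3 <= n)%N -> n%:R^-1 <= h ->
  M2 <= n%:R -> rX <= n%:R -> B <= n%:R -> kap <= n%:R ->
  #|{: mindex d p}|%:R <= n%:R :> R ->
  M * rho <= 1 -> rho * C <= 1 / 2 -> h `^ s <= rho -> n%:R^-1 <= rho ->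
  ln n%:R <= n%:R * h ^+ d * rho ^+ 2 ->
  exists A, [/\ measurable A, (P A <= (n%:R^-1)%:E)%E &
    forall w a x h' u, ~ A w -> alo <= a <= ahi -> X0 x ->
      h / M2 <= h' -> h' <= M1 * h -> norm1 u = 1 ->
      0 < \sum_(i < n) score K a (shifted (M * rho) (rescale h' (bs a x)) u) u
            (h'^-1 *: ((Z i w).1 - x)) (Z i w).2].
Proof.
move=> h0 h1 hhs n3 nh nM2 nrX nB nkap ncard t1 lC hsrho nrho nln.
have [kap1 LK0 _ _] := Kprops.
have n0 : 0 < n%:R :> R by rewrite ltr0n (leq_trans _ n3).
have n3R : 3 <= n%:R :> R by rewrite ler_nat.
have n1R : 1 <= n%:R :> R by lra.
pose t := M * rho.
have rho0 : 0 < rho by apply: lt_le_trans nrho; rewrite invr_gt0.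
have t0 : 0 <= t by rewrite mulr_ge0// ltW.
pose Theta : set param := [set q | let: (a, x, h', u) := q in
  [/\ alo <= a <= ahi, X0 x, h / M2 <= h' <= M1 * h & norm1 u = 1]].
pose eta : R := n%:R^-1.
have eta0 : 0 < eta by rewrite invr_gt0.
have eta1 : eta <= 1 by rewrite invf_le1.
have eta01 : 0 < eta <= 1 by rewrite eta0.
have u_le (u : {ffun mindex d p -> R}) b w : norm1 u <= b -> `|u w| <= b.
  by apply: le_trans; rewrite /norm1 (bigD1 w)//= lerDl sumr_ge0.
have h'P h' : h / M2 <= h' <= M1 * h -> [/\ 0 < h', h' <= hs & h'^-1 <= n%:R ^+ 2].
  move=> /andP[hl hu].
  have hM2 : 0 < h / M2 by rewrite divr_gt0.
  have h'0 : 0 < h' by exact: lt_le_trans hl.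
  split => //; first exact: le_trans hhs.
  apply: (@le_trans _ _ (h / M2)^-1); first by rewrite lef_pV2.
  rewrite invf_div expr2; apply: ler_pM => //; [exact: ltW|by rewrite invr_ge0 ltW|].
  by rewrite invf_ple ?posrE.
have gB a x h' u : alo <= a <= ahi -> X0 x -> h / M2 <= h' <= M1 * h -> norm1 u = 1 ->
    norm1 (shifted t (rescale h' (bs a x)) u) <= B.
  move=> aa X0x /h'P[h'0 h'hs _] u1.
  by have [] := moments aa X0x h'0 h'hs (t := t) (eta := eta) (u := u) _ u1 eta01;
     rewrite ?t0.
have crd_le q j : Theta q -> `|crd t q j| <= n%:R ^+ 2.
  have nn2 : n%:R <= n%:R ^+ 2 :> R by rewrite expr2 ler_peMr// ltW.
  have n12 : 1 <= n%:R ^+ 2 :> R by exact: le_trans nn2.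
  case: q => [[[a x] h'] u] /= [aa X0x hh u1].
  have [h'0 h'hs h'n] := h'P _ hh.
  case: j => [[[]|i]|[w|w]] /=.
  - have /andP[a1 a2] := aa; rewrite ger0_norm ?(le_trans (ltW alo_gt0))//.
    by apply: le_trans n12; apply: le_trans a2 (ltW _).
  - by rewrite ger0_norm// invr_ge0 ltW.
  - apply: le_trans (rV_coord_le _ _) _; apply: le_trans (X0_bounded X0x) _.
    exact: le_trans nn2.
  - by apply: le_trans n12; apply: u_le; rewrite u1.
  - by apply: le_trans nn2; apply: le_trans nB; apply: u_le; exact: gB.
(* The coordinates are at most n^2 and a displacement of eps moves the rescaled
   covariates by eps (n^2 + kap) <= n^-1 = eta; this needs 2 n^2 / eps < n^7 cells
   in each coordinate. *)
pose eps : R := n%:R ^- 4.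
have eps0 : 0 < eps by rewrite invr_gt0 exprn_gt0.
have epsn : eps * n%:R ^+ 3 = eta.
  by rewrite /eps /eta; field; rewrite gt_eqF.
have n3_ge1 : 1 <= n%:R ^+ 3 :> R by rewrite exprn_ege1.
have epseta : eps <= eta by rewrite -epsn ler_peMr// ltW.
have cells : 2 * n%:R ^+ 2 / eps < (n ^ 7)%N%:R.
  rewrite natrX /eps invrK -mulrA -exprD (exprS _ 6) ltr_pM2r ?exprn_gt0//.
  by lra.
have [ctr Hctr] := proper_net (0, 0, 0, [ffun=> 0]) eps0 crd_le cells.
pose W (q : param) : 'rV[R]_d * R -> R := let: (a, x, h', u) := q in
  bracket K kap CK LK B a (poly_of t q) u h' x eta.
pose bad (z : {ffun coord -> 'I_(n ^ 7)}) : set Om :=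
  if `[< Theta (ctr z) >] then [set w | \sum_(i < n) W (ctr z) (Z i w) <= 0] else set0.
have mZ i : measurable_fun setT (Z i) by [].
have bad_small z : measurable (bad z) /\
    (P (bad z) <= (expR (- (ln n%:R * (7 * net_dim + 1)%:R)))%:E)%E.
  rewrite /bad; case: ifPn => [/asboolP|_]; last first.
    by split; [exact: measurable0|rewrite measure0 lee_fin expR_ge0].
  case: (ctr z) => [[[a x] h'] u] [aa X0x hh u1].
  have [h'0 h'hs h'n] := h'P _ hh.
  have [|_ WC mW EW EW2] := moments aa X0x h'0 h'hs (t := t) (eta := eta) (u := u) _ u1 eta01.
    by rewrite t0.
  split; first exact: (measurable_sum_le0 mZ).
  apply: le_trans (chernoff_iid (l := rho) mZ _ iidZ mW WC _ lC EW EW2 n) _ => //.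
    exact: ltW.
  rewrite lee_fin ler_expR lerN2.
  have /andP[hl hu] := hh.
  have h's : h' `^ s <= M1 `^ s * rho.
    apply: (@le_trans _ _ ((M1 * h) `^ s)).
      by apply: ge0_ler_powR; rewrite ?nnegrE//; [exact: ltW|exact: ltW|rewrite mulr_ge0// ltW].
    by rewrite powRM ?(ltW M1_gt0) ?(ltW h0)// ler_wpM2l ?powR_ge0.
  have h'd : h ^+ d / M2 ^+ d <= h' ^+ d.
    by rewrite -expr_div_n lerXn2r ?nnegrE// ?(ltW h'0)// divr_ge0// ltW.
  have step1 : rho * ((7 * net_dim + 1)%:R * M2 ^+ d) <=
      c * t - C * (h' `^ s + eta) - 2 * rho * C.
    have e1 : C * (h' `^ s + eta) <= C * (M1 `^ s * rho + rho).
      by rewrite ler_pM2l// lerD.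
    have e2 := ler_wpM2r (ltW rho0) M_large.
    move: e1 e2; rewrite /t; lra.
  have M2d : 0 < M2 ^+ d by rewrite exprn_gt0.
  have D0 : 0 <= rho * ((7 * net_dim + 1)%:R * M2 ^+ d).
    by rewrite !mulr_ge0// ltW.
  apply: (@le_trans _ _ (n%:R * (rho * (h ^+ d / M2 ^+ d *
      (rho * ((7 * net_dim + 1)%:R * M2 ^+ d)))))).
    rewrite [leRHS](_ : _ = n%:R * h ^+ d * rho ^+ 2 * (7 * net_dim + 1)%:R); last first.
      by field; rewrite gt_eqF.
    by rewrite ler_wpM2r.
  rewrite ler_pM2l// [leRHS](_ : _ = rho * (h' ^+ d *
     (c * t - C * (h' `^ s + eta) - 2 * rho * C))); last by ring.
  by rewrite ler_pM2l// ler_pM// mulr_ge0 ?invr_ge0 ?exprn_ge0 ?ltW.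
pose centres : seq {ffun coord -> 'I_(n ^ 7)} := enum {ffun coord -> 'I_(n ^ 7)}.
have [mbad Pbad] := finite_union_bound centres bad_small.
exists (\bigcup_(z in [set` centres]) bad z); split => //.
- apply: le_trans Pbad _; rewrite lee_fin -cardE card_ffun card_ord -/net_dim -expnM.
  rewrite expRN [ln _ * _]mulrC expRM_natl lnK// natrX addn1 exprS invfM.
  by rewrite mulrCA mulfV ?mulr1// expf_neq0// gt_eqF.
- move=> w a x h' u nA aa X0x hl hu u1.
  have Tq : Theta (a, x, h', u) by split => //; rewrite hl.
  have [z [Tz Hz]] := Hctr _ Tq.
  have nbad : ~ bad z w by move=> bz; apply: nA; exists z => //=; rewrite mem_enum.
  move: nbad; rewrite /bad; case: ifPn => [_|/asboolP //] /negP; rewrite -ltNge => posW.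
  apply: lt_le_trans posW _; apply: ler_sum => i _.
  move: Tz Hz; rewrite /W; case: (ctr z) => [[[a' x'] h''] u'] [aa' X0x' hh' u'1] Hz.
  have [h'0 h'hs h'n] := h'P h' (introT andP (conj hl hu)).
  have [h''0 h''hs h''n] := h'P _ hh'.
  have a01 b : alo <= b <= ahi -> 0 <= b <= 1.
    move=> /andP[b1 b2]; rewrite (le_trans (ltW alo_gt0) b1).
    exact: le_trans b2 (ltW ahi_lt1).
  have sum_eps (f : mindex d p -> R) : (forall v, `|f v| <= eps) ->
      norm1 [ffun v => f v] <= eta.
    move=> fe; apply: (@le_trans _ _ (\sum_(v : mindex d p) eps)).
      by apply: ler_sum => v _; rewrite ffunE.
    rewrite sumr_const -[leLHS]mulr_natl -epsn mulrC ler_pM2l//.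
    by apply: le_trans ncard _; rewrite exprS ler_peMr ?(ltW n0)// exprn_ege1.
  apply: (@bracket_le_score R d p K kap CK LK Kl Kprops B a a' eta eps (n%:R ^+ 2)) => //.
  - exact: a01.
  - exact: a01.
  - exact: le_trans h'hs hs_le1.
  - exact: le_trans h''hs hs_le1.
  - by rewrite u1.
  - by rewrite u'1.
  - by apply: gB => //; rewrite hl.
  - by apply: sum_eps => v; have := Hz (inr (inr v)).
  - by apply: sum_eps => v; have := Hz (inr (inl v)).
  - by apply: le_trans epseta; have := Hz (inl (inl true)).
  - by apply/rV_norm_leP => [|j]; [exact: ltW|have := Hz (inl (inr j)); rewrite !mxE].
  - by have := Hz (inl (inl false)).
  - rewrite -epsn ler_pM2l//.
    have n2 : n%:R <= n%:R ^+ 2 :> R by rewrite expr2 ler_peMr// ltW.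
    apply: (@le_trans _ _ (2 * n%:R ^+ 2)).
      by rewrite mulr_natl mulr2n lerD// (le_trans nkap).
    by rewrite (exprS _ 2) ler_wpM2r ?sqr_ge0//; lra.
Qed.

End uniform_deviation.

(** Consequences of n h^d >= ln n >= 1: the bandwidth is at least 1 / n, and the
    rate [rho] dominates 1 / n and satisfies the relation n h^d rho^2 >= ln n that
    turns the exponential inequality into a power of n. *)
Lemma rate_facts (R : realType) (d n : nat) (h s : R) : (0 < d)%N -> (4 <= n)%N ->
  0 < h -> h <= 1 -> ln n%:R / (n%:R * h ^+ d) <= 1 ->
  let rho := h `^ s + Num.sqrt (ln n%:R / (n%:R * h ^+ d)) in
  [/\ n%:R^-1 <= h, h `^ s <= rho, n%:R^-1 <= rho &
      ln n%:R <= n%:R * h ^+ d * rho ^+ 2].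
Proof.
move=> d0 n3 h0 h1 q1 /=; set q := _ / _ in q1 *.
have nR : 4 <= n%:R :> R by rewrite ler_nat.
have n0 : 0 < n%:R :> R by lra.
have hd0 : 0 < h ^+ d by rewrite exprn_gt0.
have ln1 : 1 <= ln n%:R :> R.
  rewrite -[leLHS]expRK ler_ln ?posrE ?expR_gt0//; apply: le_trans nR.
  have := @expR_le_quad R (1 / 2); rewrite ger0_norm// => /(_ (lexx _)) e2.
  have -> : expR 1 = expR (1 / 2) * expR (1 / 2) :> R by rewrite -expRD -splitr.
  have e3 : expR (1 / 2) <= 2 :> R by lra.
  have := expR_ge0 (1 / 2 : R); nra.
have nhd0 : 0 < n%:R * h ^+ d by rewrite mulr_gt0.
have hd1 : h ^+ d <= 1 by rewrite exprn_ile1// ltW.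
have nh : n%:R^-1 <= h ^+ d.
  rewrite -[leLHS]mulr1 ler_pdivrMl//; apply: le_trans ln1 _.
  by move: q1; rewrite /q ler_pdivrMr// mul1r.
have q0 : n%:R ^- 2 <= q.
  rewrite /q ler_pdivlMr//; apply: le_trans ln1.
  rewrite (_ : n%:R ^- 2 * (n%:R * h ^+ d) = h ^+ d / n%:R); last first.
    by field; rewrite gt_eqF.
  by rewrite ler_pdivrMr// mul1r (le_trans hd1)//; lra.
have n20 : 0 <= n%:R ^- 2 :> R by rewrite invr_ge0 exprn_ge0// ltW.
have qq0 : 0 <= q by exact: le_trans q0.
split.
- apply: le_trans nh _; case: (d) d0 => // m _.
  by rewrite exprS ler_piMr ?(ltW h0)// exprn_ile1// ltW.
- by rewrite lerDl sqrtr_ge0.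
- apply: (@le_trans _ _ (Num.sqrt q)); last by rewrite lerDr powR_ge0.
  rewrite -[leLHS]ger0_norm ?invr_ge0 ?(ltW n0)// -sqrtr_sqr ler_sqrt//.
  by rewrite exprVn.
- have E : ln n%:R = n%:R * h ^+ d * q by rewrite /q mulrC divfK// gt_eqF.
  rewrite {1}E ler_pM2l// -[leLHS](sqr_sqrtr qq0).
  by rewrite lerXn2r ?nnegrE ?addr_ge0 ?sqrtr_ge0 ?powR_ge0// lerDr powR_ge0.
Qed.

Lemma rate_small (R : realType) (h s q del : R) : 0 < h -> 0 < s -> 0 < del -> 0 <= q ->
  h <= (del / 2) `^ s^-1 -> q <= (del / 2) ^+ 2 -> h `^ s + Num.sqrt q <= del.
Proof.
move=> h0 s0 del0 q0 hd qd; rewrite (splitr del); apply: lerD.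
  have E : del / 2 = ((del / 2) `^ s^-1) `^ s.
    by rewrite -powRrM mulVf ?gt_eqF// powRr1// divr_ge0// ltW.
  rewrite [leRHS]E; apply: ge0_ler_powR; rewrite ?nnegrE ?powR_ge0//; exact: ltW.
rewrite -[leRHS]ger0_norm ?divr_ge0 ?(ltW del0)// -sqrtr_sqr ler_sqrt//.
exact: sqr_ge0.
Qed.

Theorem proposition2
  (R : realType) (dOm : measure_display) (Om : measurableType dOm)
  (P : probability Om R) (d p : nat) (d_gt0 : (0 < d)%N)
  (XY : {RV P >-> ('rV[R]_d * R)%type})
  (Z : nat -> {RV P >-> ('rV[R]_d * R)%type})
  (iidZ : iid_copies P Z XY)
  (kYX : R.-pker 'rV[R]_d ~> R)
  (kYXP : cond_distribution P (fst \o XY) (snd \o XY) kYX)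
  (alo ahi : R) (alo_gt0 : 0 < alo) (alo_le_ahi : alo <= ahi) (ahi_lt1 : ahi < 1)
  (X0 : set 'rV[R]_d) (K : 'rV[R]_d -> R)
  (hypX : assumption_X P (fst \o XY) X0)
  (hypF : assumption_F (law_support P (fst \o XY)) (cond_cdf kYX))
  (hypK : assumption_K K)
  (bhat : nat -> Om -> R -> R -> 'rV[R]_d -> {ffun mindex d p -> R})
  (bhatP : forall n w a h x, alo <= a <= ahi -> 0 < h ->
     is_minimizer (objective K n (fun i => Z i w) a h x) (bhat n w a h x))
  (h : nat -> R) (h_gt0 : forall n, 0 < h n)
  (h_cvg0 : h @ \oo --> (0 : R))
  (h_rate : (fun n => ln n%:R / (n%:R * h n ^+ d)) @ \oo --> (0 : R))
  (hhat : nat -> {RV P >-> R}) (hhat_gt0 : forall n w, 0 < hhat n w)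
  (hhat_OP : O_P P (fun n w => (hhat n w)%:E) h)
  (hhatV_OP : O_P P (fun n w => (hhat n w)^-1%:E) (fun n => (h n)^-1))
  (L s : R) (L_gt0 : 0 < L) (s_gt0 : 0 < s) (s_le_p : (lfloor s <= p)%N)
  (Qhold : holder_class (law_support P (fst \o XY)) alo ahi
             (cond_quantile (cond_cdf kYX)) L s)
  (v : mindex d p) (v_le : (mdeg (multi_of v) <= lfloor s)%N) :
  O_P P
    (fun n w => sup_abs
       [set ax : R * 'rV[R]_d | alo <= ax.1 <= ahi /\ X0 ax.2]
       (fun ax => bhat n w ax.1 (hhat n w) ax.2 v -
                  partial (multi_of v) (cond_quantile (cond_cdf kYX) ax.1) ax.2))
    (fun n => h n ^- mdeg (multi_of v) *
              (h n `^ s + Num.sqrt (ln n%:R / (n%:R * h n ^+ d)))).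

Proof.
set S := law_support P (fst \o XY).
have [kap [CK [LK [Kl Kprops]]]] := kernel_propsP hypK.
have [bs [B [c [C [hs [[B0 c0 C0 /andP[hs0 hs1]] HM]]]]]] :=
  @bracket_moments R dOm Om P d p XY kYX alo ahi X0 K kap CK LK Kl L s d_gt0 kYXP
    alo_gt0 ahi_lt1 hypX hypF Kprops L_gt0 s_gt0 s_le_p Qhold.
have [rX rXP] : exists rX : R, forall x, X0 x -> `|x| <= rX.
  have cX0 : compact X0 by case: hypX.
  have [M0 [_ HM0]] := compact_bounded cX0.
  by exists (M0 + 1) => x; apply: HM0; rewrite ltrDl.
move=> e e0.
have e3 : 0 < e / 3 by rewrite divr_gt0.
have [M1 M10 ev1] := hhat_OP _ e3; have [M2 M20 ev2] := hhatV_OP _ e3.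
(* The constant for which Chernoff's exponent beats the number of cells. *)
pose M := ((7 * net_dim d p + 1)%:R * M2 ^+ d + C * (M1 `^ s + 3)) / c.
have M0 : 0 < M.
  rewrite divr_gt0// ltr_wpDl//; first by rewrite mulr_ge0// exprn_ge0// ltW.
  by rewrite mulr_gt0// ltr_wpDl// powR_ge0.
have ME : (7 * net_dim d p + 1)%:R * M2 ^+ d + C * (M1 `^ s + 3) <= c * M.
  by rewrite /M [c * _]mulrC divfK// gt_eqF.
set m := mdeg (multi_of v).
exists (M * M2 ^+ m); first by rewrite mulr_gt0// exprn_gt0.
pose del := Num.min M^-1 (C^-1 / 2).
have del0 : 0 < del by rewrite lt_min invr_gt0 M0 divr_gt0// invr_gt0.
pose hmax := Num.min (Num.min 1 (hs / M1)) ((del / 2) `^ s^-1).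
have hmax0 : 0 < hmax by rewrite !lt_min ltr01 divr_gt0//= powR_gt0// divr_gt0.
pose qmax := Num.min 1 ((del / 2) ^+ 2).
have qmax0 : 0 < qmax by rewrite lt_min ltr01 exprn_gt0// divr_gt0.
pose big := `|M2| + `|rX| + `|B| + `|kap| + #|{: mindex d p}|%:R + 3 / e.
have evh : \forall n \near \oo, h n <= hmax.
  by move/cvgr0_norm_le : h_cvg0 => /(_ _ hmax0); apply: filterS => n; rewrite gtr0_norm.
have evq : \forall n \near \oo, ln n%:R / (n%:R * h n ^+ d) <= qmax.
  move/cvgr0_norm_le : h_rate => /(_ _ qmax0); apply: filterS => n.
  exact: le_trans (ler_norm _).
near=> n.
have hn : h n <= hmax by near: n.
have qn : ln n%:R / (n%:R * h n ^+ d) <= qmax by near: n.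
have n4 : (4 <= n)%N by near: n; exact: nbhs_infty_ge.
have nbig : big <= n%:R by near: n; exact: nbhs_infty_ger.
have B1 : (mu_ext P [set w | (M1 * h n)%:E < `|(hhat n w)%:E|] <= (e / 3)%:E)%E by near: n.
have B2 : (mu_ext P [set w | (M2 * (h n)^-1)%:E < `|(hhat n w)^-1%:E|] <= (e / 3)%:E)%E.
  by near: n.
have hn0 := h_gt0 n.
have [h1 hM1 hdel] : [/\ h n <= 1, M1 * h n <= hs & h n <= (del / 2) `^ s^-1].
  move: hn; rewrite !le_min => /andP[/andP[-> h2] ->]; split => //.
  by rewrite mulrC -ler_pdivlMr.
move: qn; rewrite le_min => /andP[q1 qdel].
have [nh hsr nr lnr] := @rate_facts R d n (h n) s d_gt0 n4 hn0 h1 q1.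
set rho := h n `^ s + _ in hsr nr lnr *.
have q0 : 0 <= ln n%:R / (n%:R * h n ^+ d) :> R.
  by rewrite divr_ge0 ?ln_ge0 ?ler1n// ?mulr_ge0 ?exprn_ge0 ?(ltW hn0)// (leq_trans _ n4).
have rdel : rho <= del by exact: (rate_small hn0 s_gt0 del0 q0 hdel qdel).
have [rM rC] : M * rho <= 1 /\ rho * C <= 1 / 2.
  move: rdel; rewrite le_min => /andP[r1 r2]; split.
    by rewrite mulrC -ler_pdivlMr// div1r.
  by rewrite -ler_pdivlMr// div1r mulrC.
have rho0 : 0 < rho by apply: lt_le_trans nr; rewrite invr_gt0 ltr0n (leq_trans _ n4).
have big_le (b : R) : b <= big -> b <= n%:R by move/le_trans; apply.
have Nb := normr_ge0.
have e30 : 0 <= 3 / e by rewrite divr_ge0// ltW.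
have [nM2 nrX nB nkap] : [/\ M2 <= n%:R, rX <= n%:R, B <= n%:R & kap <= n%:R].
  by split; apply: big_le; rewrite /big; apply: le_trans (ler_norm _) _;
    rewrite -!addrA; do ?[rewrite lerDl; do ?apply: addr_ge0 => // | rewrite ler_wpDl//].
have [ncard ne] : #|{: mindex d p}|%:R <= n%:R :> R /\ 3 / e <= n%:R.
  by split; apply: big_le; rewrite /big; [rewrite -addrA ler_wpDl ?lerDl ?addr_ge0|
    rewrite lerDr ?addr_ge0].
have moments a x (ax : alo <= a <= ahi) (X0x : X0 x) := (HM a x ax X0x).2.
have [A [mA PA HA]] := @uniform_score_positive R dOm Om P d p XY Z alo ahi X0 K kap CK LK Kl s
  bs B c C hs iidZ alo_gt0 ahi_lt1 s_gt0 Kprops B0 C0 hs1 moments M1 M2 M rX M10 M20 M0 rXP ME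
  n (h n) rho hn0 h1 hM1 (leq_trans (isT : (3 <= 4)%N) n4) nh nM2 nrX nB nkap ncard rM rC
  hsr nr lnr.
set E1 := [set w | _] in B1; set E2 := [set w | _] in B2.
apply: (@le_trans _ _ (mu_ext P (E1 `|` (E2 `|` A)))); last first.
  apply: le_trans (outer_measureU2 (mu_ext P) _ _) _.
  have EE : (e%:E = (e / 3)%:E + ((e / 3)%:E + (e / 3)%:E))%E.
    by rewrite -!EFinD; congr EFin; field.
  rewrite EE; apply: leeD => //; apply: le_trans (outer_measureU2 (mu_ext P) _ _) _.
  apply: leeD => //; apply: (@le_trans _ _ (mu_ext P A)) => //.
  have -> : mu_ext P A = P A by exact: measurable_mu_extE.
  apply: le_trans PA _.
  by rewrite lee_fin invf_ple ?posrE ?ltr0n ?(leq_trans _ n4)// invf_div.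
apply: le_mu_ext.
move=> w /= far; apply: contrapT => nEw.
have [nE1 nE2 nAw] : [/\ ~ E1 w, ~ E2 w & ~ A w].
  by split => ?; apply: nEw; [left|right; left|right; right].
have hh0 := hhat_gt0 n w.
have hhu : hhat n w <= M1 * h n.
  by rewrite leNgt; apply/negP => ?; apply: nE1; rewrite /E1 /= gtr0_norm// lte_fin.
have hhl : (hhat n w)^-1 <= M2 / h n.
  rewrite leNgt; apply/negP => ?; apply: nE2.
  by rewrite /E2 /= gtr0_norm ?invr_gt0// lte_fin.
have hhl' : h n / M2 <= hhat n w.
  by rewrite -[leRHS]invrK invf_pge ?posrE ?invr_gt0 ?divr_gt0// invf_div.
move: far; apply/negP; rewrite -leNgt.
have sup_ge0 T (D : set T) (g : T -> R) : (0 <= sup_abs D g)%E.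
  by apply: ereal_sup_ubound; left.
rewrite gee0_abs//; apply: ge_ereal_sup => _ [->|[[a x] /= [aa X0x] <-]].
  rewrite lee_fin; apply: mulr_ge0; apply: mulr_ge0; rewrite ?invr_ge0 ?exprn_ge0//;
    exact: ltW.
have min_b := bhatP n w a (hhat n w) x aa hh0.
set bh := bhat n w a (hhat n w) x in min_b *.
have [vE _] := HM a x aa X0x.
rewrite lee_fin -(vE v v_le).
have n_gt0 : (0 < n)%N by exact: leq_trans n4.
have K0 z : 0 <= K z by case: hypK.
have small : norm1 (rescale (hhat n w) [ffun w => bh w - bs a x w]) <= M * rho.
  rewrite leNgt; apply/negP => large.
  have [u [u1]] := minimizer_score K0 n_gt0 hh0 (ltW (mulr_gt0 M0 rho0)) min_b large.
  by rewrite leNgt => /negP; apply; exact: HA.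
have coef : hhat n w ^+ m * `|bh v - bs a x v| <= M * rho.
  apply: le_trans small; rewrite /norm1 (bigD1 v)//= !ffunE normrM.
  by rewrite ger0_norm ?lerDl ?sumr_ge0// exprn_ge0// ltW.
have -> : M * M2 ^+ m * (h n ^- m * rho) = (M2 / h n) ^+ m * (M * rho).
  by rewrite expr_div_n; ring.
apply: (@le_trans _ _ ((hhat n w)^-1 ^+ m * (M * rho))).
  by rewrite exprVn -ler_pdivrMl ?invr_gt0 ?exprn_gt0// invrK.
apply: ler_wpM2r; first by rewrite mulr_ge0// ltW.
by apply: lerXn2r; rewrite ?nnegrE ?invr_ge0 ?divr_ge0// ltW.
Unshelve. all: by end_near. Qed.
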